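(* Let $A\neq0$ be a smooth non-negative function supported in $[-D,D]^3$, and let $\chi$ be the unique solution of $\Delta_{g_{\mathbb E}}\chi=-4\pi A$ on $\mathbb R^3$ with $\chi\to1$ at infinity. Fix $R>\sqrt3 D$. There exists a sequence of spaces $(\mathcal U_{n,R},g_n)$ which are scalar-flat but whose Gromov-Hausdorff limit is $(B(0,R),\chi^4g_{\mathbb E})$, which is of scalar curvature $$\mathrm{Scal}(\chi^4g_{\mathbb E})=32\pi\chi^{-5}A\neq0$$ (that is, not identically zero).
   Context: $g_{\mathbb E}$ is the Euclidean metric on $\mathbb R^3$, $B(p,r)$ the open Euclidean ball, $D>0$. The spaces $(\mathcal U_{n,R},g_n)$ are of the following form. For each $n\in\mathbb N$ subdivide $[-D,D]^3$ into $(2n)^3$ boxes of side $D/n$ with centers $p_{i,n}$. Let $\alpha_{i,n}\ge0$ be parameters with $\sup_{i,n}n^4|\alpha_{i,n}-A(p_{i,n})(D/n)^3|<\infty$ (a Brill-Lindquist-Riemann sum with no charge), and disregard boxes with $\alpha_{i,n}=0$. Put $\chi_n(x)=1+\sum_i\frac{\alpha_{i,n}}{|x-p_{i,n}|}$, $g_n=\chi_n^4g_{\mathbb E}$ and $\mathcal U_{n,R}=B(0,R)\smallsetminus\bigcup_iB(p_{i,n},\tfrac{D}{n^2})$. A set equipped with a Riemannian metric is regarded as a metric space with the distance given by the infimum of lengths of piecewise smooth paths inside the set. The Gromov-Hausdorff distance of two metric spaces is the infimum of Hausdorff distances of their images under distance-preserving maps into a common metric space. *)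

(* Defs.v *)
From HB Require Import structures.
From mathcomp Require Import all_boot all_order all_algebra.
From mathcomp Require Import all_classical all_reals all_analysis.

Set Implicit Arguments.
Unset Strict Implicit.
Unset Printing Implicit Defensive.

Import Order.TTheory GRing.Theory Num.Theory.
Import numFieldNormedType.Exports.

Local Open Scope classical_set_scope.
Local Open Scope ring_scope.

(* The library norm on 'rV[R]_3 is the sup norm, hence this definition. Topology
   and derivatives on 'rV[R]_3 do not depend on the choice of the norm. *)
Definition enorm (R : realType) (x : 'rV[R]_3) : R :=
  Num.sqrt (\sum_(k < 3) x 0 k ^+ 2).

Definition eball (R : realType) (p : 'rV[R]_3) (r : R) : set 'rV[R]_3 :=
  [set x | enorm (x - p) < r].

Definition cube (R : realType) (D : R) : set 'rV[R]_3 :=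
  [set x | forall k, - D <= x 0 k <= D].

Definition partial (R : realType) (i : 'I_3) (f : 'rV[R]_3 -> R)
  (x : 'rV[R]_3) : R := 'D_(delta_mx 0 i) f x.

Fixpoint Ck (R : realType) (k : nat) (f : 'rV[R]_3 -> R) : Prop :=
  match k with
  | 0 => continuous f
  | k'.+1 => forall i : 'I_3,
      (forall x, derivable f x (delta_mx 0 i)) /\ Ck k' (partial i f)
  end.

Definition smooth (R : realType) (f : 'rV[R]_3 -> R) : Prop :=
  forall k, Ck k f.

Definition laplacian (R : realType) (f : 'rV[R]_3 -> R) (x : 'rV[R]_3) : R :=
  \sum_(i < 3) partial i (partial i f) x.

Definition tends_at_infinity (R : realType) (f : 'rV[R]_3 -> R) (l : R) : Prop :=
  forall e : R, 0 < e ->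
    exists M : R, forall x, M < enorm x -> `|f x - l| < e.

(* The classical solution; by the maximum principle there is at most one. *)
Definition poisson_solution (R : realType) (A chi : 'rV[R]_3 -> R) : Prop :=
  [/\ Ck 2 chi,
      forall x, laplacian chi x = - 4 * pi * A x
    & tends_at_infinity chi 1].

(* A Riemannian metric in the standard coordinates is given by its matrix
   (g_ij) at each point. *)
Definition metric_field (R : realType) : Type := 'rV[R]_3 -> 'M[R]_3.

Definition conformal_metric (R : realType) (f : 'rV[R]_3 -> R) :
  metric_field R := fun x => (f x ^+ 4)%:M.

Definition christoffel (R : realType) (g : metric_field R) (k i j : 'I_3)
    (x : 'rV[R]_3) : R :=
  2^-1 * \sum_(l < 3) invmx (g x) k l *
    (partial i (fun y => g y j l) x + partial j (fun y => g y i l) x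
     - partial l (fun y => g y i j) x).

(* R^l_{kij}, with R(e_i, e_j) e_k = \sum_l R^l_{kij} e_l and
   R(X, Y) Z = nabla_X nabla_Y Z - nabla_Y nabla_X Z - nabla_[X, Y] Z. *)
Definition riemann (R : realType) (g : metric_field R) (l k i j : 'I_3)
    (x : 'rV[R]_3) : R :=
  partial i (christoffel g l j k) x - partial j (christoffel g l i k) x
  + \sum_(m < 3) (christoffel g l i m x * christoffel g m j k x
                  - christoffel g l j m x * christoffel g m i k x).

(* Ric(Y, Z) is the trace of X |-> R(X, Y) Z, so round spheres have positive
   curvature. *)
Definition ricci (R : realType) (g : metric_field R) (j k : 'I_3)
    (x : 'rV[R]_3) : R := \sum_(l < 3) riemann g l k l j x.

Definition scal (R : realType) (g : metric_field R) (x : 'rV[R]_3) : R :=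
  \sum_(j < 3) \sum_(k < 3) invmx (g x) j k * ricci g j k x.

Definition smooth_curve (R : realType) (c : R -> 'rV[R]_3) : Prop :=
  forall (n : nat) (t : R), derivable (derive1n n c) t 1.

(* Smoothness on a closed subinterval means that of an extension to R. *)
Definition piecewise_smooth (R : realType) (gamma : R -> 'rV[R]_3) : Prop :=
  exists s : seq R, itv_partition 0 1 s /\
    forall i, (i < size s)%N ->
      exists c : R -> 'rV[R]_3, smooth_curve c /\
        forall t, nth 0 (0 :: s) i <= t <= nth 0 (0 :: s) i.+1 ->
          gamma t = c t.

(* At the finitely many breakpoints, and at 0 and 1, the derivative may be a
   dummy value, which does not affect the integral. *)
Definition curve_length (R : realType) (g : metric_field R)
    (gamma : R -> 'rV[R]_3) : \bar R :=
  (\int[lebesgue_measure]_(t in `[0%R, 1%R])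
    (Num.sqrt ((derive1 gamma t *m g (gamma t) *m (derive1 gamma t)^T) 0 0))%:E)%E.

(* Extended-real valued: +oo when no path inside S joins x to y. *)
Definition riem_dist (R : realType) (S : set 'rV[R]_3) (g : metric_field R)
    (x y : 'rV[R]_3) : \bar R :=
  ereal_inf [set curve_length g gamma | gamma in
    [set gamma : R -> 'rV[R]_3 |
      [/\ piecewise_smooth gamma, gamma 0 = x, gamma 1 = y
        & forall t, 0 <= t <= 1 -> S (gamma t)]]].

Definition hausdorff_dist (R : realType) (Z : metricType R) (A B : set Z) :
  \bar R :=
  maxe (ereal_sup [set ereal_inf [set (mdist a b)%:E | b in B] | a in A])
       (ereal_sup [set ereal_inf [set (mdist a b)%:E | a in A] | b in B]).

(* A space is a set S with a distance d on it; values of d and f off S are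
   irrelevant. *)
Definition dist_preserving (R : realType) (T : Type) (S : set T)
    (d : T -> T -> \bar R) (Z : metricType R) (f : T -> Z) : Prop :=
  forall x y, S x -> S y -> (mdist (f x) (f y))%:E = d x y.

(* If d takes the value +oo on S there is no embedding and GH_dist is +oo. *)
Definition GH_dist (R : realType) (T1 T2 : Type)
    (S1 : set T1) (d1 : T1 -> T1 -> \bar R)
    (S2 : set T2) (d2 : T2 -> T2 -> \bar R) : \bar R :=
  ereal_inf [set h | exists (Z : metricType R) (f1 : T1 -> Z) (f2 : T2 -> Z),
    [/\ dist_preserving S1 d1 f1, dist_preserving S2 d2 f2
      & h = hausdorff_dist (f1 @` S1) (f2 @` S2)]].

(* [-D, D] is cut into 2n intervals of length D / n along each axis. *)
Definition box (n : nat) : finType := {ffun 'I_3 -> 'I_(2 * n)}.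

Definition center (R : realType) (D : R) (n : nat) (i : box n) : 'rV[R]_3 :=
  \row_(k < 3) (- D + ((i k)%:R + 2^-1) * (D / n%:R)).

Definition BLRS (R : realType) (D : R) (A : 'rV[R]_3 -> R)
    (alpha : forall n, box n -> R) : Prop :=
  (forall n (i : box n), 0 <= alpha n i) /\
  has_ubound [set s | exists n (i : box n), (0 < n)%N /\
    s = n%:R ^+ 4 * `|alpha n i - A (center D i) * (D / n%:R) ^+ 3|].

Definition chi_n (R : realType) (D : R) (n : nat) (alpha : box n -> R)
    (x : 'rV[R]_3) : R :=
  1 + \sum_(i : box n) alpha i / enorm (x - center D i).

(* Only boxes with alpha i != 0 are excised; the other ones do not contribute
   to chi_n. *)
Definition U_nR (R : realType) (D r : R) (n : nat) (alpha : box n -> R) :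
  set 'rV[R]_3 :=
  eball 0 r `\`
    \bigcup_(i in [set i : box n | alpha i != 0])
      eball (center D i) (D / n%:R ^+ 2).

(* Main.v *)
(* Take [alpha i := A (p i) (D / n)^3]. For [f > 0] the scalar curvature of
   [f^4 g_E] is [- 8 f^-5 Delta f], so [chi_n], a sum of point potentials, gives
   a scalar-flat metric, and [chi] gives [32 pi chi^-5 A].

   Uniform convergence of [chi_n] to [chi]: replace each [1 / |x - p|] by the
   smooth [1 / sqrt (rho^2 + |x - p|^2)], whose Laplacian is
   [- 3 rho^2 / (rho^2 + |x - p|^2)^(5/2)], an approximate identity of mass
   [4 pi]. For small [rho] and large [n] the Laplacian of the smoothed sum
   differs from [- 4 pi A] by at most a small multiple of that of a fixed
   superharmonic barrier, so the maximum principle makes the smoothed sum close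
   to [chi]. Outside the excised balls, the smoothing changes the sum by
   [O (sqrt rho + 1 / n)], because
   [0 <= 1 / |y| - 1 / sqrt (rho^2 + |y|^2) <= sqrt rho / |y|^(3/2)] and [|y|^(-3/2)]
   is dominated by the product of the [|y_k|^(-1/2)].

   Distances: paths avoiding the holes are compared by the ratio of conformal
   factors. Conversely a path in the ball is cut into pieces of length about
   the mesh [h = D / n], each of which is replaced by a polygonal path making a
   detour of length [O (eta)], [eta = D / n^2], around at most one hole; the
   total loss is [O (eta / h) = O (1 / n)]. *)

From HB Require Import structures.
Require Import Defs.
From mathcomp Require Import all_boot all_order all_algebra.
From mathcomp Require Import all_classical all_reals all_analysis.
From mathcomp Require Import measurable_realfun ring lra.
Import Order.TTheory GRing.Theory Num.Theory.
Import numFieldNormedType.Exports.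
Local Open Scope classical_set_scope.
Local Open Scope ring_scope.
Set Implicit Arguments.
Unset Strict Implicit.
Unset Printing Implicit Defensive.

(** * Euclidean geometry and compactness *)

(** [poisson_solution] provides only the Laplacian of [chi] and its limit at infinity, so [chi] is
    compared with the sums at the level of Laplacians. The error must be small relative to the
    Laplacian of the barrier [psi (D ^+ 2) 0], which decays like [|x|^-5]: on an unbounded domain a
    uniform bound would not feed the maximum principle. The mass [4 pi] of the approximate identity
    is found by integrating out one coordinate at a time, with explicit primitives and with
    Lipschitz constants depending on [rho] alone, so that a midpoint rule applies three times.

    [chi_n] is singular at the centres, whereas the length theory below works with conformal factors
    continuous on the whole space. [chi_cut] agrees with [chi_n] on the perforated ball, is
    continuous, and is at least 1, so that its metric dominates the Euclidean one.

    Lengths are handled through primitives of the speed: every comparison of lengths becomes the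
    monotonicity of a function of one variable, and the Lebesgue integral is met only at the
    interface with [curve_length] and to produce primitives. *)

Section euclidean.
Context {R : realType}.
Implicit Types (x y z u v : 'rV[R]_3) (a b e r t : R).

Definition dotp x y : R := \sum_(k < 3) x 0 k * y 0 k.

Lemma sum3 (V : nmodType) (F : 'I_3 -> V) :
  \sum_(k < 3) F k = F 0 + F 1 + F 2%:R.
Proof.
rewrite !big_ord_recl big_ord0 addr0 addrA.
by congr (F _ + F _ + F _); apply/val_inj.
Qed.

Lemma dotpE x y : dotp x y = x 0 0 * y 0 0 + x 0 1 * y 0 1 + x 0 2%:R * y 0 2%:R.
Proof. exact: sum3. Qed.

Lemma dotpC x y : dotp x y = dotp y x.
Proof. by rewrite !dotpE; ring. Qed.

Lemma dotpDl x y z : dotp (x + y) z = dotp x z + dotp y z.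
Proof. by rewrite !dotpE !mxE; ring. Qed.

Lemma dotpDr x y z : dotp x (y + z) = dotp x y + dotp x z.
Proof. by rewrite !dotpE !mxE; ring. Qed.

Lemma dotpZl a x y : dotp (a *: x) y = a * dotp x y.
Proof. by rewrite !dotpE !mxE; ring. Qed.

Lemma dotpZr a x y : dotp x (a *: y) = a * dotp x y.
Proof. by rewrite !dotpE !mxE; ring. Qed.

Lemma dotpNl x y : dotp (- x) y = - dotp x y.
Proof. by rewrite !dotpE !mxE; ring. Qed.

Lemma dotpNr x y : dotp x (- y) = - dotp x y.
Proof. by rewrite !dotpE !mxE; ring. Qed.

Lemma dotpp_ge0 x : 0 <= dotp x x.
Proof. by apply: sumr_ge0 => k _; rewrite -expr2 sqr_ge0. Qed.

Lemma dotpp_eq0 x : (dotp x x == 0) = (x == 0).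
Proof.
apply/idP/eqP => [|->]; last by rewrite dotpE !mxE !mul0r !addr0.
rewrite psumr_eq0 => [/allP x0|k _]; last by rewrite -expr2 sqr_ge0.
apply/rowP => k; have := x0 k (mem_index_enum _).
by rewrite /= mulf_eq0 orbb mxE => /eqP.
Qed.

Lemma enormE x : enorm x = Num.sqrt (dotp x x).
Proof. by congr Num.sqrt; apply: eq_bigr => k _; rewrite expr2. Qed.

Lemma enorm_ge0 x : 0 <= enorm x.
Proof. exact: sqrtr_ge0. Qed.

Lemma sqr_enorm x : enorm x ^+ 2 = dotp x x.
Proof. by rewrite enormE sqr_sqrtr ?dotpp_ge0. Qed.

Lemma enorm_eq0 x : (enorm x == 0) = (x == 0).
Proof. by rewrite -sqrf_eq0 sqr_enorm dotpp_eq0. Qed.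

Lemma enorm_gt0 x : (0 < enorm x) = (x != 0).
Proof. by rewrite lt_neqAle enorm_ge0 andbT eq_sym enorm_eq0. Qed.

Lemma enorm0 : enorm (0 : 'rV[R]_3) = 0.
Proof. by apply/eqP; rewrite enorm_eq0. Qed.

Lemma enormN x : enorm (- x) = enorm x.
Proof. by rewrite !enormE dotpNl dotpNr opprK. Qed.

Lemma enormB x y : enorm (x - y) = enorm (y - x).
Proof. by rewrite -enormN opprB. Qed.

Lemma enormZ a x : enorm (a *: x) = `|a| * enorm x.
Proof.
by rewrite !enormE dotpZl dotpZr mulrA -expr2 sqrtrM ?sqr_ge0// sqrtr_sqr.
Qed.

(** Lagrange's identity: the gap between the squares is the squared norm of the cross product. *)
Lemma CauchySchwarz x y : dotp x y <= enorm x * enorm y.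
Proof.
have [xy0|xy0] := lerP (dotp x y) 0.
  by rewrite (le_trans xy0)// mulr_ge0 ?enorm_ge0.
rewrite -ler_sqr ?nnegrE ?(ltW xy0) ?mulr_ge0 ?enorm_ge0// exprMn !sqr_enorm.
rewrite -subr_ge0 !dotpE.
set a := x 0 0; set b := x 0 1; set c := x 0 2%:R.
set a' := y 0 0; set b' := y 0 1; set c' := y 0 2%:R.
rewrite [X in 0 <= X](_ : _ = (a * b' - b * a') ^+ 2 + (a * c' - c * a') ^+ 2
  + (b * c' - c * b') ^+ 2); last by ring.
by rewrite !addr_ge0 ?sqr_ge0.
Qed.

Lemma ler_enormD x y : enorm (x + y) <= enorm x + enorm y.
Proof.
rewrite -ler_sqr ?nnegrE ?addr_ge0 ?enorm_ge0// sqrrD !sqr_enorm.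
rewrite dotpDl !dotpDr (dotpC y x).
have := CauchySchwarz x y; lra.
Qed.

Lemma ler_enormB x y z : enorm (x - z) <= enorm (x - y) + enorm (y - z).
Proof. by rewrite -{1}(subrKA y) ler_enormD. Qed.

Lemma lerB_enorm x y : enorm x - enorm y <= enorm (x - y).
Proof. by rewrite lerBlDr -{1}(subrK y x) ler_enormD. Qed.

Lemma ler_dist_enorm x y : `|enorm x - enorm y| <= enorm (x - y).
Proof.
rewrite ler_norml lerB_enorm andbT lerNl opprB enormB; exact: lerB_enorm.
Qed.

Lemma coord_le_enorm x (k : 'I_3) : `|x 0 k| <= enorm x.
Proof.
rewrite -ler_sqr ?nnegrE ?enorm_ge0// sqr_enorm -normrX ger0_norm ?sqr_ge0//.
rewrite /dotp (bigD1 k)//= -expr2 lerDl.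
by apply: sumr_ge0 => i _; rewrite -expr2 sqr_ge0.
Qed.

Lemma enorm_le_coord x a : (forall k, `|x 0 k| <= a) -> enorm x <= Num.sqrt 3 * a.
Proof.
move=> xa; have a0 : 0 <= a by exact: le_trans (xa 0).
rewrite -ler_sqr ?nnegrE ?mulr_ge0 ?enorm_ge0 ?sqrtr_ge0// exprMn (@sqr_sqrtr _ 3)//.
rewrite sqr_enorm dotpE.
have h k : x 0 k * x 0 k <= a ^+ 2.
  by rewrite -expr2 -(ger0_norm (sqr_ge0 (x 0 k))) normrX lerXn2r// nnegrE.
have := h 0; have := h 1; have := h 2%:R; lra.
Qed.

Lemma enorm_le_norm x : enorm x <= 2 * `|x|.
Proof.
apply: (@le_trans _ _ (Num.sqrt 3 * `|x|)).
  apply: enorm_le_coord => k.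
  rewrite [leRHS]/Num.Def.normr/= mx_normrE.
  exact: (le_bigmax _ (fun ij : 'I_1 * 'I_3 => `|x ij.1 ij.2|) (0, k)).
apply: ler_wpM2r => //; rewrite -ler_sqr ?nnegrE ?sqrtr_ge0// (@sqr_sqrtr _ 3)//; lra.
Qed.

Lemma norm_le_enorm x : `|x| <= enorm x.
Proof.
rewrite [leLHS]/Num.Def.normr/= mx_normrE; apply: bigmax_le => [|[i j] _].
  exact: enorm_ge0.
by rewrite /= (ord1 i) coord_le_enorm.
Qed.

Lemma near_enorm x e : 0 < e -> \forall y \near x, enorm (y - x) < e.
Proof.
move=> e0; apply/nbhs_ballP; exists (e / 2) => /=; first by rewrite divr_gt0.
move=> y; rewrite -ball_normE /= distrC => xy.
have := enorm_le_norm (y - x); lra.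
Qed.

Lemma enorm_continuous : continuous (@enorm R).
Proof.
move=> x; apply/(@cvgrPdist_lt _ _ _ (nbhs x)) => e e0.
apply: (@filterS _ (nbhs x) _ _ _ _ (near_enorm x e0)) => y.
by rewrite enormB; apply: le_lt_trans; exact: ler_dist_enorm.
Qed.

Lemma continuousP_enorm (f : 'rV[R]_3 -> R) x :
  (forall e, 0 < e -> exists2 d : R, 0 < d &
    forall y, enorm (y - x) < d -> `|f y - f x| <= e) -> {for x, continuous f}.
Proof.
move=> fx; apply/(@cvgrPdist_le _ _ _ (nbhs x)) => e /fx[d d0 fd].
by apply: (@filterS _ (nbhs x) _ _ _ _ (near_enorm x d0)) => y yx; rewrite distrC fd.
Qed.

Lemma enormB_continuous z : continuous (fun y => enorm (y - z)).
Proof.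
move=> x; apply: continuousP_enorm => e e0; exists e => // y yx.
have := ler_dist_enorm (y - z) (x - z); rewrite opprB addrA subrK; lra.
Qed.

Lemma closed_eball_compact r : compact [set x : 'rV[R]_3 | enorm x <= r].
Proof.
apply: bounded_closed_compact.
  exists r; split; first exact: num_real.
  move=> M rM x /= xr; rewrite (le_trans (norm_le_enorm _))// (le_trans xr)//.
  exact: ltW.
rewrite (_ : [set x | _] = @enorm R @^-1` [set y | y <= r])//.
by apply: closed_comp => [x _|]; [exact: enorm_continuous|exact: closed_le].
Qed.

Lemma seq_min_gt0 (T : eqType) (s : seq T) (d : T -> R) :
  (forall c, 0 < d c) -> exists2 m : R, 0 < m & forall c, c \in s -> m <= d c.
Proof.
move=> d0; elim: s => [|a s [m m0 hm]]; first by exists 1.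
exists (Num.min m (d a)); first by rewrite lt_min m0 d0.
move=> b; rewrite inE => /orP[/eqP->|ys]; first by rewrite ge_min lexx orbT.
by rewrite ge_min hm.
Qed.

(* Heine-Cantor: a violating [f] gives a Lebesgue number of the cover by
   balls on which [f] varies by at most [e / 2]. *)
Lemma unif_cont_compact (f : 'rV[R]_3 -> R) r e : continuous f -> 0 < e ->
  exists2 d : R, 0 < d & forall x y, enorm x <= r -> enorm (x - y) <= d ->
    `|f x - f y| <= e.
Proof.
move=> cf e0; pose K := [set x : 'rV[R]_3 | enorm x <= r].
have dx x : exists2 d : R, 0 < d & forall y, enorm (y - x) < d -> `|f y - f x| <= e / 2.
  have /(@cvgrPdist_le _ _ _ (nbhs x))/(_ (e / 2)) := cf x.
  rewrite divr_gt0// => /(_ isT)/nbhs_ballP[d /= d0 hd]; exists d => // y yd.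
  rewrite distrC; apply: hd; rewrite -ball_normE /=.
  by rewrite distrC (le_lt_trans (norm_le_enorm _)).
pose d x := sval (cid2 (dx x)).
have d0 x : 0 < d x by rewrite /d; case: cid2.
have hd x y : enorm (y - x) < d x -> `|f y - f x| <= e / 2.
  by rewrite /d; case: cid2 => /= d' _; exact.
have := @closed_eball_compact r; rewrite compact_cover => cK.
have [||D DK Dcov] := cK _ K (fun x => [set y | enorm (y - x) < d x / 2]).
- move=> x _; rewrite (_ : [set y | _] = (fun y => enorm (y - x)) @^-1` [set z | z < d x / 2])//.
  apply: open_comp => [y _|]; last exact: open_lt.
  exact: enormB_continuous.
- by move=> x Kx; exists x => //=; rewrite subrr enorm0 divr_gt0.
have [m m0 mD] := seq_min_gt0 (finmap.enum_fset D) (fun x => divr_gt0 (d0 x) (ltr0Sn _ 1)).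
exists (m / 2); first by rewrite divr_gt0.
move=> x y Kx xy; have [z zD zx] := Dcov x Kx.
have mz := mD z zD.
rewrite /= in zx.
have h1 := hd z x; have h2 := hd z y.
have zy : enorm (y - z) < d z.
  have := ler_enormB y x z; rewrite (enormB y x); lra.
rewrite -(subrKA (f z)) (le_trans (ler_normD _ _))//.
have := h2 zy; rewrite distrC.
have : enorm (x - z) < d z by have := d0 z; lra.
move=> /h1; lra.
Qed.

Lemma cont_bounded_compact (f : 'rV[R]_3 -> R) r : continuous f ->
  exists M, forall x, enorm x <= r -> `|f x| <= M.
Proof.
move=> cf; have : compact (f @` [set x : 'rV[R]_3 | enorm x <= r]).
  apply: continuous_compact; last exact: closed_eball_compact.
  exact: continuous_subspaceT.
move=> /compact_bounded[M [_ hM]]; exists (M + 1) => x xr.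
by apply: hM; [rewrite ltrDl|exists x].
Qed.

End euclidean.

(** * Scalar curvature of conformally flat metrics *)

Section real_derivatives.
Context {R : realType} {V : normedModType R}.
Implicit Types (f g h : V -> R) (x v : V) (a df dg : R).

Lemma scaleRE a (y : R) : a *: (y : R^o) = a * y.
Proof. by []. Qed.

Lemma is_deriveD_fun f g x v df dg : is_derive x v f df -> is_derive x v g dg ->
  is_derive x v (fun y => f y + g y) (df + dg).
Proof. exact: is_deriveD. Qed.

Lemma is_deriveB_fun f g x v df dg : is_derive x v f df -> is_derive x v g dg ->
  is_derive x v (fun y => f y - g y) (df - dg).
Proof. exact: is_deriveB. Qed.

Lemma is_deriveM_fun f g x v df dg : is_derive x v f df -> is_derive x v g dg ->
  is_derive x v (fun y => f y * g y) (f x * dg + g x * df).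
Proof. exact: is_deriveM. Qed.

Lemma is_deriveZ_fun a f x v df : is_derive x v f df ->
  is_derive x v (fun y => a * f y) (a * df).
Proof. exact: is_deriveZ. Qed.

Lemma is_deriveV_fun f x v df : f x != 0 -> is_derive x v f df ->
  is_derive x v (fun y => (f y)^-1) (- (f x) ^- 2 * df).
Proof.
move=> fx [dvf <-]; have dV := derivableV fx dvf.
apply: (@DeriveDef _ _ _ _ _ _ _ dV).
have -> := deriveV fx dvf.
exact: scaleRE.
Qed.

End real_derivatives.

(** The differentiated function has the shape of a Christoffel symbol of [h ^ 4 g_E], with Kronecker
    deltas for [a], [b], [c] and partial derivatives of [h] for [u], [v], [w]. *)
Lemma derive_quotient_comb {R : realType} (V : normedModType R)
    (h u v w : V -> R) (x e : V) (a b c : R) :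
  h x != 0 -> derivable h x e -> derivable u x e -> derivable v x e ->
  derivable w x e ->
  'D_e (fun y => 2 * (h y)^-1 * (a * u y + b * v y - c * w y)) x =
  2 * ((h x)^-1 * (a * 'D_e u x + b * 'D_e v x - c * 'D_e w x)
       - (h x) ^- 2 * 'D_e h x * (a * u x + b * v x - c * w x)).
Proof.
move=> h0 /derivableP dh /derivableP du /derivableP dv /derivableP dw.
have := is_deriveM_fun (is_deriveZ_fun 2 (is_deriveV_fun h0 dh))
  (is_deriveB_fun (is_deriveD_fun (is_deriveZ_fun a du) (is_deriveZ_fun b dv))
    (is_deriveZ_fun c dw)).
by move=> /@derive_val ->; ring.
Qed.

(** Here [c], [p i] and [q i j] stand for the value of the conformal factor and its first and second
    partial derivatives at a point, [chr k i j] for the Christoffel symbol with upper index [k], and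
    [dchr m k i j] for its derivative in direction [m]. The curvature formula is then a rational
    identity. *)
Lemma scal_conformal_algebra {R : realFieldType} (c : R) (p : 'I_3 -> R)
    (q : 'I_3 -> 'I_3 -> R) : c != 0 ->
  let chr (k i j : 'I_3) := 2 * c^-1 *
    ((k == j)%:R * p i + (k == i)%:R * p j - (i == j)%:R * p k) in
  let dchr (m k i j : 'I_3) := 2 * (c^-1 * ((k == j)%:R * q m i
      + (k == i)%:R * q m j - (i == j)%:R * q m k)
    - c ^- 2 * p m * ((k == j)%:R * p i + (k == i)%:R * p j
      - (i == j)%:R * p k)) in
  \sum_(j < 3) (c ^+ 4)^-1 * (\sum_(l < 3) (dchr l l j j - dchr j l l j
    + \sum_(m < 3) (chr l l m * chr m j j - chr l j m * chr m l j)))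
  = - 8 * c ^- 5 * \sum_(i < 3) q i i.
Proof.
move=> c0 chr dchr; rewrite !sum3 /chr /dchr /=.
by field.
Qed.

Section conformal_curvature.
Context {R : realType}.
Variables (f : 'rV[R]_3 -> R) (x : 'rV[R]_3).
Hypothesis f1 : \forall y \near x, 0 < f y /\
  forall i : 'I_3, derivable f y (delta_mx 0 i).
Hypothesis f2 : forall i j : 'I_3, derivable (partial j f) x (delta_mx 0 i).

Let chr (k i j : 'I_3) (y : 'rV[R]_3) : R := 2 * (f y)^-1 *
  ((k == j)%:R * partial i f y + (k == i)%:R * partial j f y
   - (i == j)%:R * partial k f y).

Lemma partial_conformal (i j l : 'I_3) y : derivable f y (delta_mx 0 i) ->
  partial i (fun y => conformal_metric f y j l) y =
  (j == l)%:R * (4 * f y ^+ 3 * partial i f y).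
Proof.
move=> df; rewrite /partial /conformal_metric.
rewrite (_ : (fun y => _) = (j == l)%:R \*: (f ^+ 4)); last first.
  by apply/funext => z /=; rewrite mxE -[LHS]mulr_natl.
rewrite deriveZ/=; last exact: derivableX.
by rewrite deriveX//= /GRing.scale/= mulr_natl.
Qed.

(** Stated on a neighbourhood of [x], because the curvature differentiates the symbols once more. *)
Lemma christoffel_conformal (k i j : 'I_3) :
  \forall y \near x, chr k i j y = christoffel (conformal_metric f) k i j y.
Proof.
apply: (@filterS _ (nbhs x) _ _ _ _ f1) => y [fy df].
have fy0 := lt0r_neq0 fy.
rewrite /christoffel /chr.
under eq_bigr do rewrite !partial_conformal//.
rewrite {1}/conformal_metric invmx_scalar.
rewrite (bigD1 k)//= big1 ?addr0; last first.
  by move=> l lk; rewrite !mxE eq_sym (negbTE lk) mul0r.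
rewrite !mxE eqxx mulr1n (eq_sym j k) (eq_sym i k).
by move: (f y) fy0 (partial i f y) (partial j f y) (partial k f y) => c c0 *; field.
Qed.

Lemma partial_christoffel_conformal (m k i j : 'I_3) :
  partial m (christoffel (conformal_metric f) k i j) x =
  2 * ((f x)^-1 * ((k == j)%:R * partial m (partial i f) x
    + (k == i)%:R * partial m (partial j f) x
    - (i == j)%:R * partial m (partial k f) x)
  - (f x) ^- 2 * partial m f x * ((k == j)%:R * partial i f x
    + (k == i)%:R * partial j f x - (i == j)%:R * partial k f x)).
Proof.
have [fx df] := nbhs_singleton f1.
rewrite {1}/partial -(near_eq_derive _ (christoffel_conformal k i j)).
by rewrite derive_quotient_comb// gt_eqF.
Qed.

Lemma scal_conformal :
  scal (conformal_metric f) x = - 8 * f x ^- 5 * laplacian f x.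
Proof.
have [fx df] := nbhs_singleton f1; have fx0 := lt0r_neq0 fx.
rewrite -(scal_conformal_algebra (fun i => partial i f x)
  (fun i j => partial i (partial j f) x) fx0).
rewrite /scal {1}/conformal_metric invmx_scalar.
apply: eq_bigr => j _; rewrite (bigD1 j)//= big1 ?addr0; last first.
  by move=> k kj; rewrite !mxE eq_sym (negbTE kj) mul0r.
rewrite mxE eqxx mulr1n; congr (_ * _); apply: eq_bigr => l _.
rewrite /riemann !partial_christoffel_conformal; congr (_ + _); first by rewrite !eqxx.
have chrE k i m : christoffel (conformal_metric f) k i m x = chr k i m x.
  by rewrite (nbhs_singleton (christoffel_conformal k i m)).
by apply: eq_bigr => m _; rewrite !chrE /chr !eqxx.
Qed.

End conformal_curvature.

(** The two difference quotients are the same function; this gives access to the one-variable chain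
    rule and mean value theorem. *)
Lemma is_derive_lineP {R : realType} {V : normedModType R} (f : V -> R) (x v : V)
    (df : R) :
  is_derive x v f df <-> is_derive (0 : R) 1 (fun h : R => f (h *: v + x)) df.
Proof.
have E : (fun h : R => h^-1 *: ((f \o shift x) (h *: v) - f x)) =
    (fun h : R => h^-1 *: (((fun h : R => f (h *: v + x)) \o shift (0 : R))
      (h *: (1 : R^o)) - f (0 *: v + x))).
  apply/funext => h /=; rewrite addr0 scale0r add0r; congr (_ *: (f (_ *: _ + _) - _)).
  by rewrite scaleRE mulr1.
split=> -[d1 d2].
  by apply: DeriveDef; rewrite ?/derivable ?/derive -E.
by apply: DeriveDef; rewrite ?/derivable ?/derive E.
Qed.

Section chain_rule.
Context {R : realType} {V : normedModType R}.
Implicit Types (f : V -> R) (x v : V).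

Lemma is_derive_line f x v (t df : R) : is_derive (x + t *: v) v f df <->
  is_derive t 1 (fun h : R => f (x + h *: v)) df.
Proof.
suff E : (fun h : R => f (h *: v + (x + t *: v))) =
    (fun h : R => f (x + (h *: (1 : R^o) + t) *: v)).
  have := is_derive_lineP (V := R^o) (fun h => f (x + h *: v)) t 1 df.
  have := is_derive_lineP f (x + t *: v) v df; rewrite E => L1 L2.
  by split=> [/L1/L2|/L2/L1].
apply/funext => h; congr f.
by rewrite scaleRE mulr1 scalerDl addrCA.
Qed.

Lemma is_derive_comp1 f (g : R -> R) x v (df dg : R) : is_derive x v f df ->
  is_derive (f x) 1 g dg -> is_derive x v (fun y => g (f y)) (dg * df).
Proof.
move=> /is_derive_lineP fx gx; apply/is_derive_lineP.
apply: (@is_derive1_comp _ g (fun h : R => f (h *: v + x)) 0 dg df) => //.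
by rewrite scale0r add0r.
Qed.

Lemma is_derive_sum_fun (I : Type) (s : seq I) (P : pred I) (h : I -> V -> R)
    (dh : I -> R) x v : (forall i, is_derive x v (h i) (dh i)) ->
  is_derive x v (fun y => \sum_(i <- s | P i) h i y) (\sum_(i <- s | P i) dh i).
Proof.
move=> hdh; elim: s => [|i s IH].
  rewrite big_nil (_ : (fun y => _) = cst 0) ?big_nil//; first exact: is_derive_cst.
  by apply/funext => y; rewrite big_nil.
rewrite big_cons (_ : (fun y => _) = fun y => if P i then h i y +
    \sum_(i <- s | P i) h i y else \sum_(i <- s | P i) h i y); last first.
  by apply/funext => y; rewrite big_cons.
by case: (P i) => //; exact: is_deriveD_fun.
Qed.

End chain_rule.

(** * Potentials of point charges *)

Section potential.
Context {R : realType}.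
Implicit Types (a : R) (p x v w : 'rV[R]_3) (f g : 'rV[R]_3 -> R).

Lemma is_derive_coord (k : 'I_3) x v : is_derive x v (fun y => y 0 k) (v 0 k).
Proof.
apply/is_derive_lineP.
have -> : (fun h : R => (h *: v + x) 0 k) = (fun h : R => v 0 k * h + x 0 k).
  by apply/funext => h; rewrite !mxE mulrC.
have := is_deriveD_fun (is_deriveZ_fun (v 0 k) (is_derive_id (0 : R^o) 1))
  (is_derive_cst (x 0 k) (0 : R^o) 1).
by rewrite mulr1 addr0.
Qed.

Lemma is_derive_dotB p x v w :
  is_derive x w (fun y => dotp (y - p) v) (dotp w v).
Proof.
have -> : (fun y => dotp (y - p) v) = fun y => \sum_(k < 3) (v 0 k * (y 0 k - p 0 k)).
  by apply/funext => y; apply: eq_bigr => k _; rewrite !mxE mulrC.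
have -> : dotp w v = \sum_(k < 3) (v 0 k * (w 0 k - 0)).
  by apply: eq_bigr => k _; rewrite subr0 mulrC.
apply: is_derive_sum_fun => k; apply: is_deriveZ_fun.
apply: is_deriveB_fun; exact: is_derive_coord.
Qed.

Lemma is_derive_dotBB p x v :
  is_derive x v (fun y => dotp (y - p) (y - p)) (2 * dotp (x - p) v).
Proof.
have -> : (fun y => dotp (y - p) (y - p)) =
    fun y => \sum_(k < 3) ((y 0 k - p 0 k) * (y 0 k - p 0 k)).
  by apply/funext => y; apply: eq_bigr => k _; rewrite !mxE.
have -> : 2 * dotp (x - p) v = \sum_(k < 3) ((x 0 k - p 0 k) * v 0 k +
    (x 0 k - p 0 k) * v 0 k).
  by rewrite big_split/= mulr_natl mulr2n; congr (_ + _); apply: eq_bigr => k _;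
    rewrite !mxE.
apply: is_derive_sum_fun => k.
have d : is_derive x v (fun y => y 0 k - p 0 k) (v 0 k).
  rewrite -[v 0 k]subr0; apply: is_deriveB_fun; exact: is_derive_coord.
exact: is_deriveM_fun.
Qed.

Definition rad a p x : R := Num.sqrt (a + dotp (x - p) (x - p)).

(* [psi 0 p] is the potential of a unit point charge at [p], and [psi (rho ^ 2) p]
   a smooth superharmonic regularization of it. *)
Definition psi a p x : R := (rad a p x)^-1.

Lemma rad_gt0 a p x : 0 < a + dotp (x - p) (x - p) -> 0 < rad a p x.
Proof. by rewrite sqrtr_gt0. Qed.

Lemma sqr_rad a p x : 0 < a + dotp (x - p) (x - p) ->
  rad a p x ^+ 2 = a + dotp (x - p) (x - p).
Proof. by move=> h; rewrite sqr_sqrtr// ltW. Qed.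

Lemma is_derive_psi a p x v : 0 < a + dotp (x - p) (x - p) ->
  is_derive x v (psi a p) (- dotp (x - p) v * psi a p x ^+ 3).
Proof.
move=> h; have r0 := lt0r_neq0 (rad_gt0 h).
have d1 : is_derive x v (fun y => a + dotp (y - p) (y - p)) (0 + 2 * dotp (x - p) v).
  apply: is_deriveD_fun; exact: is_derive_dotBB.
have d2 := is_derive_comp1 d1 (is_derive1_sqrt h).
have d3 := is_deriveV_fun (f := rad a p) r0 d2.
apply: (is_derive_eq d3).
by rewrite /psi -/(rad a p x); field.
Qed.

Lemma is_derive_dpsi a p x v w : 0 < a + dotp (x - p) (x - p) ->
  is_derive x w (fun y => - dotp (y - p) v * psi a p y ^+ 3)
   (3 * dotp (x - p) v * dotp (x - p) w * psi a p x ^+ 5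
    - dotp w v * psi a p x ^+ 3).
Proof.
move=> h; have d1 := is_derive_psi w h.
have d2 := is_deriveM_fun d1 (is_deriveM_fun d1 d1).
have d3 := is_deriveZ_fun (-1) (is_derive_dotB p x v w).
have d4 := is_deriveM_fun d3 d2.
rewrite (_ : (fun y => _) = (fun y => -1 * dotp (y - p) v *
  (psi a p y * (psi a p y * psi a p y)))).
  by apply: (is_derive_eq d4); ring.
by apply/funext => y; ring.
Qed.

Lemma near_psi_pos a p x : 0 <= a -> 0 < a + dotp (x - p) (x - p) ->
  \forall y \near x, 0 < a + dotp (y - p) (y - p).
Proof.
rewrite le_eqVlt => /orP[/eqP<-|a0 _]; last first.
  by apply: (@nearW _ (nbhs x)) => y; rewrite ltr_pwDl// dotpp_ge0.
rewrite add0r -sqr_enorm exprn_even_gt0//= => xp.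
have xp0 : 0 < enorm (x - p) by rewrite lt_neqAle eq_sym xp enorm_ge0.
apply: (@filterS _ (nbhs x) _ _ _ _ (near_enorm x xp0)) => y yx.
rewrite add0r -sqr_enorm exprn_gt0//.
have := ler_enormB x y p; rewrite (enormB x y); lra.
Qed.

(* Near [x], [p i] are the partial derivatives of [f], and [q i j] is the
   derivative of [p j] in direction [i] at [x]. *)
Definition twice_diff (f : 'rV[R]_3 -> R) x (p : 'I_3 -> 'rV[R]_3 -> R)
    (q : 'I_3 -> 'I_3 -> R) : Prop :=
  (\forall y \near x, forall i : 'I_3, is_derive y (delta_mx 0 i) f (p i y)) /\
  forall i j : 'I_3, is_derive x (delta_mx 0 i) (p j) (q i j).

Lemma twice_diff_partial f x (p : 'I_3 -> 'rV[R]_3 -> R) (q : 'I_3 -> 'I_3 -> R)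
    (j : 'I_3) : twice_diff f x p q ->
  \forall y \near x, p j y = partial j f y.
Proof.
move=> [f1 _]; apply: (@filterS _ (nbhs x) _ _ _ _ f1) => y fy.
by have [_ <-] := fy j.
Qed.

Lemma twice_diff_partial2 f x (p : 'I_3 -> 'rV[R]_3 -> R) (q : 'I_3 -> 'I_3 -> R)
    (i j : 'I_3) : twice_diff f x p q ->
  is_derive x (delta_mx 0 i) (partial j f) (q i j).
Proof.
move=> fpq; apply: near_eq_is_derive (twice_diff_partial j fpq) _.
by case: fpq.
Qed.

Lemma twice_diff_laplacian f x (p : 'I_3 -> 'rV[R]_3 -> R) (q : 'I_3 -> 'I_3 -> R) :
  twice_diff f x p q ->
  laplacian f x = \sum_(i < 3) q i i.
Proof.
by move=> fpq; apply: eq_bigr => i _; have [_] := twice_diff_partial2 i i fpq.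
Qed.

Lemma twice_diff_cst (c : R) x :
  twice_diff (cst c) x (fun=> cst 0) (fun _ _ => 0).
Proof.
by split=> [|i j]; [apply: (@nearW _ (nbhs x)) => y i|]; exact: is_derive_cst.
Qed.

Lemma twice_diffD f g x
    (p : 'I_3 -> 'rV[R]_3 -> R) (q : 'I_3 -> 'I_3 -> R)
    (p' : 'I_3 -> 'rV[R]_3 -> R) (q' : 'I_3 -> 'I_3 -> R) :
  twice_diff f x p q -> twice_diff g x p' q' ->
  twice_diff (fun y => f y + g y) x (fun i y => p i y + p' i y)
    (fun i j => q i j + q' i j).
Proof.
move=> [f1 f2] [g1 g2]; split=> [|i j]; last exact: is_deriveD_fun.
apply: (@filterS2 _ (nbhs x) _ _ _ _ _ f1 g1) => y fy gy i.
exact: is_deriveD_fun.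
Qed.

Lemma twice_diffZ (c : R) f x (p : 'I_3 -> 'rV[R]_3 -> R) (q : 'I_3 -> 'I_3 -> R) :
  twice_diff f x p q ->
  twice_diff (fun y => c * f y) x (fun i y => c * p i y) (fun i j => c * q i j).
Proof.
move=> [f1 f2]; split=> [|i j]; last exact: is_deriveZ_fun.
apply: (@filterS _ (nbhs x) _ _ _ _ f1) => y fy i; exact: is_deriveZ_fun.
Qed.

(** Regularity at [x] is asked only of the members of [s]: the point charges of zero strength, whose
    centre may be [x], will be filtered out. *)
Lemma twice_diff_sum (I : eqType) (s : seq I) (f : I -> 'rV[R]_3 -> R) x
    (p : I -> 'I_3 -> 'rV[R]_3 -> R) (q : I -> 'I_3 -> 'I_3 -> R) :
  (forall i, i \in s -> twice_diff (f i) x (p i) (q i)) ->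
  twice_diff (fun y => \sum_(i <- s) f i y) x
    (fun k y => \sum_(i <- s) p i k y) (fun j k => \sum_(i <- s) q i j k).
Proof.
elim: s => [_|i s IH fpq].
  have -> : (fun y => \sum_(i <- [::]) f i y) = cst 0.
    by apply/funext => y; rewrite big_nil.
  have -> : (fun k y => \sum_(i <- [::]) p i k y) = fun=> cst 0.
    by apply/funext => k; apply/funext => y; rewrite big_nil.
  have -> : (fun j k => \sum_(i <- [::]) q i j k) = fun _ _ => 0.
    by apply/funext => k; apply/funext => y; rewrite big_nil.
  exact: twice_diff_cst.
have -> : (fun y => \sum_(i <- i :: s) f i y) =
    fun y => f i y + \sum_(i <- s) f i y by apply/funext => y; rewrite big_cons.
have -> : (fun k y => \sum_(i <- i :: s) p i k y) =
    fun k y => p i k y + \sum_(i <- s) p i k y.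
  by apply/funext => k; apply/funext => y; rewrite big_cons.
have -> : (fun j k => \sum_(i <- i :: s) q i j k) =
    fun j k => q i j k + \sum_(i <- s) q i j k.
  by apply/funext => k; apply/funext => y; rewrite big_cons.
apply: twice_diffD; first by apply: fpq; rewrite mem_head.
by apply: IH => j js; apply: fpq; rewrite inE js orbT.
Qed.

Lemma dotp_delta x (i : 'I_3) : dotp x (delta_mx 0 i) = x 0 i.
Proof.
rewrite /dotp (bigD1 i)//= big1 ?addr0 => [|k ki]; rewrite mxE eqxx/=.
  by rewrite eqxx mulr1.
by rewrite (negbTE ki) mulr0.
Qed.

Lemma twice_diff_psi a p x : 0 <= a -> 0 < a + dotp (x - p) (x - p) ->
  twice_diff (psi a p) x
    (fun i y => - dotp (y - p) (delta_mx 0 i) * psi a p y ^+ 3)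
    (fun i j => 3 * dotp (x - p) (delta_mx 0 j) * dotp (x - p) (delta_mx 0 i)
      * psi a p x ^+ 5 - dotp (delta_mx 0 i) (delta_mx 0 j) * psi a p x ^+ 3).
Proof.
move=> a0 h; split=> [|i j]; last exact: is_derive_dpsi.
apply: (@filterS _ (nbhs x) _ _ _ _ (near_psi_pos a0 h)) => y hy i.
exact: is_derive_psi.
Qed.

(** The trace is [3 |x - p|^2 psi^5 - 3 * 3 psi^3 + 6 psi^3] up to regrouping, and [|x - p|^2] is
    [rad^2 - a], so only the term in [a] survives. For [a = 0] this is the harmonicity of the
    Newtonian potential away from [p]. *)
Lemma laplacian_psi_sum a p x : 0 < a + dotp (x - p) (x - p) ->
  \sum_(i < 3) (3 * dotp (x - p) (delta_mx 0 i) * dotp (x - p) (delta_mx 0 i)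
      * psi a p x ^+ 5
    - dotp (delta_mx 0 i) (delta_mx 0 i) * psi a p x ^+ 3)
  = - 3 * a * psi a p x ^+ 5.
Proof.
move=> h; have r0 := lt0r_neq0 (rad_gt0 h).
rewrite big_split/= sumrN.
rewrite (eq_bigr (fun i : 'I_3 => 3 * psi a p x ^+ 5 * ((x - p) 0 i * (x - p) 0 i)));
  last by move=> i _; rewrite dotp_delta; ring.
rewrite -mulr_sumr -/(dotp (x - p) (x - p)).
rewrite (eq_bigr (fun=> psi a p x ^+ 3)); last first.
  by move=> i _; rewrite dotp_delta mxE !eqxx mul1r.
rewrite sumr_const card_ord.
move: r0 (sqr_rad h); rewrite /psi -mulr_natl.
move: (rad a p x) (dotp _ _) => r s r0 E; have -> : a = r ^+ 2 - s by lra.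
by field.
Qed.

End potential.

(** * Maximum principle on the whole space *)

Section maximum_principle.
Context {R : realType}.

(** At the minimum [dg 0 = 0]; a negative derivative of [dg] there would make [dg] negative just to
    the right of 0, and the mean value theorem would give a value of [g] below [g 0]. *)
Lemma min_second_derivative (g dg : R -> R) (d2 : R) :
  (forall t : R, is_derive t 1 g (dg t)) -> is_derive (0 : R) 1 dg d2 ->
  (forall t, g 0 <= g t) -> 0 <= d2.
Proof.
move=> g1 g2 gmin.
have dg0 : dg 0 = 0.
  have in01 : (0 : R) \in `]-1, 1[ by rewrite in_itv/= ltrN10 ltr01.
  have [_ <-] : is_derive (0 : R) 1 g (dg 0) by exact: g1.
  have d (t : R) : t \in `]-1, 1[ -> derivable g t 1 by move=> _; case: (g1 t).
  have le11 : -1 <= 1 :> R by lra.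
  by have [_] := derive1_at_min le11 d in01 (fun t _ => gmin t).
rewrite leNgt; apply/negP => d20; case: (g2) => dd dv.
have cv : (fun h => h^-1 *: ((dg \o shift 0) (h *: (1 : R^o)) - dg 0)) @ 0^' --> d2.
  by rewrite -dv; exact: dd.
have /(_ _)/nbhs_ballP[e /= e0 he] := cvgr_lt _ cv _ d20.
have neg (t : R) : 0 < t -> t < e -> dg t < 0.
  move=> t0 te; have := he t; rewrite /ball/= sub0r normrN gtr0_norm//.
  move=> /(_ te (lt0r_neq0 t0)); rewrite dg0 addr0 subr0 !scaleRE mulr1.
  by rewrite pmulr_rlt0// invr_gt0.
have e20 : 0 < e / 2 by rewrite divr_gt0.
have gc : {within `[0, e / 2], continuous g}.
  by apply: derivable_within_continuous => t _; case: (g1 t).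
have [c] := MVT e20 (fun t _ => g1 t) gc.
rewrite in_itv/= subr0 => /andP[c0 ce] E.
have := gmin (e / 2); have : dg c * (e / 2) < 0 by rewrite pmulr_llt0// neg//; lra.
lra.
Qed.

(** A negative value would produce a global minimum, where all second derivatives along the axes are
    non-negative. The strict inequality makes this test conclusive; in the applications it is
    provided by the barrier. *)
Lemma superharmonic_ge0 (W : 'rV[R]_3 -> R) p q : continuous W ->
  (forall x, twice_diff W x p (q x)) -> (forall x, \sum_(i < 3) q x i i < 0) ->
  tends_at_infinity W 0 -> forall x, 0 <= W x.
Proof.
move=> cW dW LW W0 x; rewrite leNgt; apply/negP => Wx.
have [M hM] := W0 (- W x) (ltac:(lra)).
(* Outside this ball [W] exceeds [W x], and [x] lies inside it, so a minimum over the ball is a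
   minimum over the whole space. *)
pose r := Num.max M (enorm x).
have [|y _ ymin] := EVT_min_rV _ (@closed_eball_compact R r) (continuous_subspaceT cW).
  by exists x; rewrite /= le_max lexx orbT.
have xr : W y <= W x by apply: ymin; rewrite inE /= le_max lexx orbT.
have {}ymin z : W y <= W z.
  have [zr|zr] := lerP (enorm z) r; first by apply: ymin; rewrite inE.
  have Mz : M < enorm z by apply: le_lt_trans zr; rewrite le_max lexx.
  by have := hM z Mz; rewrite subr0 ltr_norml => /andP[? _]; lra.
have := LW y; apply/negP; rewrite -leNgt; apply: sumr_ge0 => i _.
pose e_i : 'rV[R]_3 := delta_mx 0 i.
apply: (@min_second_derivative (fun t => W (y + t *: e_i)) (fun t => p i (y + t *: e_i))).
- move=> t; apply/(is_derive_line W y e_i).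
  by have [h _] := dW (y + t *: e_i); exact: (nbhs_singleton h i).
- apply/(is_derive_line (p i) y e_i); rewrite scale0r addr0.
  by have [_ h] := dW y; exact: (h i i).
- by move=> t; rewrite scale0r addr0.
Qed.

End maximum_principle.

(** * Continuity from continuous partial derivatives *)

Section partials_continuity.
Context {R : realType}.
Implicit Types (f : 'rV[R]_3 -> R) (x y z : 'rV[R]_3).

Lemma MVT_le (g dg : R -> R) (s M : R) :
  (forall t : R, is_derive t 1 g (dg t)) ->
  (forall t, `|t| <= `|s| -> `|dg t| <= M) -> `|g s - g 0| <= M * `|s|.
Proof.
move=> gd dM.
have gc A : {within A, continuous g}.
  apply: continuous_subspaceT => t; apply/differentiable_continuous.
  by apply/derivable1_diffP; case: (gd t).
have [s0|s0|->] := ltgtP s 0; last by rewrite subrr !normr0 mulr0.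
- have [c] := MVT s0 (fun t _ => gd t) (gc _).
  rewrite in_itv/= => /andP[sc c0] E.
  rewrite distrC E normrM sub0r normrN; apply: ler_wpM2r => //; apply: dM.
  by rewrite !ltr0_norm//; lra.
- have [c] := MVT s0 (fun t _ => gd t) (gc _).
  rewrite in_itv/= => /andP[sc c0] E.
  rewrite E normrM subr0; apply: ler_wpM2r => //; apply: dM.
  by rewrite !gtr0_norm//; lra.
Qed.

Lemma ord3 (j : 'I_3) : j = 0 \/ j = 1 \/ j = 2%:R.
Proof.
by case: j => [[|[|[|//]]] hj]; [left|right; left|right; right]; exact/val_inj.
Qed.

Lemma enorm_mono x y : (forall k, `|x 0 k| <= `|y 0 k|) -> enorm x <= enorm y.
Proof.
move=> xy; rewrite ler_sqrt; last by apply: sumr_ge0 => k _; rewrite sqr_ge0.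
by apply: ler_sum => k _; rewrite -real_normK ?num_real// -[leRHS]real_normK
  ?num_real// lerXn2r ?nnegrE.
Qed.

Lemma partial_line_le f z (k : 'I_3) (s M : R) :
  (forall x, derivable f x (delta_mx 0 k)) ->
  (forall t, `|t| <= `|s| -> `|partial k f (z + t *: delta_mx 0 k)| <= M) ->
  `|f (z + s *: delta_mx 0 k) - f z| <= M * `|s|.
Proof.
move=> df fM.
have := @MVT_le (fun t => f (z + t *: delta_mx 0 k))
  (fun t => partial k f (z + t *: delta_mx 0 k)) s M.
rewrite scale0r addr0; apply => // t.
by apply/(is_derive_line f z); exact/derivableP.
Qed.

(** [Ck] speaks of derivatives along the axes only. The partials are bounded by some [M] near [x],
    and going from [x] to [y] one coordinate at a time changes [f] by at most
    [3 * M * enorm (y - x)]. *)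
Lemma continuous_of_partials f :
  (forall i x, derivable f x (delta_mx 0 i)) ->
  (forall i, continuous (partial i f)) -> continuous f.
Proof.
move=> df cf x.
have [M M0 [d d0 hM]] : exists2 M : R, 0 < M & exists2 d : R, 0 < d &
    forall y, enorm (y - x) < d -> forall i, `|partial i f y| <= M.
  pose M := 1 + \sum_(i < 3) `|partial i f x|.
  exists M; first by rewrite ltr_pwDl// sumr_ge0.
  have : \forall y \near x, forall i, `|partial i f y - partial i f x| < 1.
    apply: (filter_forall (F := nbhs x)) => i.
    have /(@cvgrPdist_lt _ _ _ (nbhs x)) := cf i x.
    move=> /(_ 1 ltr01); apply: (@filterS _ (nbhs x)) => y.
    by rewrite distrC.
  move=> /nbhs_ballP[d /= d0 hd]; exists d => // y yd i.
  have : `|partial i f y - partial i f x| < 1.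
    by apply: hd; rewrite -ball_normE/= distrC (le_lt_trans (norm_le_enorm _)).
  have : `|partial i f x| <= \sum_(i < 3) `|partial i f x|.
    by rewrite [leRHS](bigD1 i)//= lerDl sumr_ge0.
  have := ler_normD (partial i f y - partial i f x) (partial i f x).
  rewrite subrK /M; lra.
apply: continuousP_enorm => e e0.
exists (Num.min d (e / (3 * M))); first by rewrite lt_min d0 divr_gt0// mulr_gt0.
move=> y; rewrite lt_min => /andP[yd ye].
pose s (k : 'I_3) := (y - x) 0 k; pose e_ (k : 'I_3) : 'rV[R]_3 := delta_mx 0 k.
(* The displacement from [x] stays dominated, coordinate by coordinate, by [y - x], so the whole
   move takes place where [M] bounds the partials. *)
have step z (k : 'I_3) : (forall j, `|(z - x) 0 j| <= `|s j|) -> (z - x) 0 k = 0 ->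
    `|f (z + s k *: e_ k) - f z| <= M * enorm (y - x).
  move=> zs zk; apply: (@le_trans _ _ (M * `|s k|)); last first.
    by rewrite ler_pM2l// coord_le_enorm.
  apply: partial_line_le => // t ts; apply: hM; apply: le_lt_trans yd.
  apply: enorm_mono => j.
  have [->|jk] := eqVneq j k.
    move: zk; rewrite !mxE !eqxx mulr1 => zk.
    by rewrite addrAC zk add0r (le_trans ts)// /s !mxE.
  move: (zs j); rewrite !mxE (negbTE jk) andbF mulr0 addr0.
  by rewrite /s !mxE.
have E : y = x + s 0 *: e_ 0 + s 1 *: e_ 1 + s 2%:R *: e_ 2%:R.
  by apply/rowP => j; case: (ord3 j) => [->|[->|->]]; rewrite /s !mxE /=; ring.
have h0 := step x 0; have h1 := step (x + s 0 *: e_ 0) 1.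
have h2 := step (x + s 0 *: e_ 0 + s 1 *: e_ 1) 2%:R.
have {}h0 : `|f (x + s 0 *: e_ 0) - f x| <= M * enorm (y - x).
  by apply: h0 => [j|]; rewrite subrr mxE ?normr0.
have {}h1 : `|f (x + s 0 *: e_ 0 + s 1 *: e_ 1) - f (x + s 0 *: e_ 0)|
    <= M * enorm (y - x).
  apply: h1 => [j|]; rewrite (addrC x) addrK; last by rewrite !mxE /= mulr0.
  by case: (ord3 j) => [->|[->|->]]; rewrite /s !mxE /= ?mulr0 ?mulr1 ?normr0.
have {}h2 : `|f y - f (x + s 0 *: e_ 0 + s 1 *: e_ 1)| <= M * enorm (y - x).
  rewrite {1}E; apply: h2 => [j|]; rewrite -(addrA x) (addrC x) addrK; last first.
    by rewrite !mxE /= !mulr0 addr0.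
  by case: (ord3 j) => [->|[->|->]];
    rewrite /s !mxE /= ?(mulr0, mulr1, addr0, add0r, normr0).
have : enorm (y - x) * (3 * M) < e by rewrite -ltr_pdivlMr// mulr_gt0.
rewrite -[f y - f x](subrKA (f (x + s 0 *: e_ 0 + s 1 *: e_ 1))).
rewrite -[f (_ + _ + _) - f x](subrKA (f (x + s 0 *: e_ 0))).
have := ler_normD (f y - f (x + s 0 *: e_ 0 + s 1 *: e_ 1))
  (f (x + s 0 *: e_ 0 + s 1 *: e_ 1) - f (x + s 0 *: e_ 0) + (f (x + s 0 *: e_ 0) - f x)).
have := ler_normD (f (x + s 0 *: e_ 0 + s 1 *: e_ 1) - f (x + s 0 *: e_ 0))
  (f (x + s 0 *: e_ 0) - f x).
lra.
Qed.

Lemma Ck2_twice_diff f x : Ck 2 f ->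
  twice_diff f x (fun i => partial i f) (fun i j => partial i (partial j f) x).
Proof.
move=> f2; split=> [|i j]; last first.
  by apply: derivableP; have [_ /(_ i)[]] := f2 j.
by apply: (@nearW _ (nbhs x)) => y i; apply: derivableP; have [] := f2 i.
Qed.

Lemma Ck2_continuous f : Ck 2 f -> continuous f.
Proof.
move=> f2; apply: continuous_of_partials => i; first by have [] := f2 i.
by apply: continuous_of_partials => j; have [_ /(_ j)[]] := f2 i.
Qed.

Lemma psi_continuous (a : R) (p x : 'rV[R]_3) : 0 < a + dotp (x - p) (x - p) ->
  {for x, continuous (psi a p)}.
Proof.
move=> h; have -> : psi a p = (fun t => t^-1) \o Num.sqrt \o
    (fun y => a + enorm (y - p) ^+ 2).
  by apply/funext => y; rewrite /= sqr_enorm.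
apply: continuous_comp.
  apply: (@continuous_comp _ _ _ (fun y => enorm (y - p)) (fun t : R => a + t ^+ 2)).
    exact: enormB_continuous.
  by apply: continuousD; [exact: cst_continuous|exact: exprn_continuous].
apply: continuous_comp; first exact: sqrt_continuous.
by apply: inv_continuous; rewrite /= sqr_enorm lt0r_neq0// rad_gt0.
Qed.

End partials_continuity.

(** * Riemann sums of the approximate identity *)

Section riemann_sums.
Context {R : realType}.
Implicit Types (f F : R -> R) (a h t u : R).

Lemma lipschitz_of_derive f df (L : R) : (forall t : R, is_derive t 1 f (df t)) ->
  (forall t, `|df t| <= L) -> forall s t, `|f s - f t| <= L * `|s - t|.
Proof.
move=> fd dL s t.
have := @MVT_le R (fun u => f (t + u)) (fun u => df (t + u)) (s - t) L.
rewrite addr0 subrKC; apply=> // u.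
have := is_derive_line f t 1 u (df (t + u)).
rewrite (_ : (fun h => f (t + h *: (1 : R^o))) = fun u => f (t + u)); last first.
  by apply/funext => v; rewrite scaleRE mulr1.
by rewrite scaleRE mulr1 => h; apply/h; exact: fd.
Qed.

(** On each cell the mean value theorem writes the increment of [F] as [h * f c], and replacing [c]
    by the midpoint costs at most [L * h ^+ 2]. The cells run downwards from [t], which is the order
    in which [t - p] meets the centres [p]. *)
Lemma riemann_sum_le f F (L h t : R) (m : nat) : 0 < h ->
  (forall t : R, is_derive t 1 F (f t)) ->
  (forall s t, `|f s - f t| <= L * `|s - t|) ->
  `|\sum_(j < m) h * f (t - (j%:R + 2^-1) * h) - (F t - F (t - m%:R * h))|
    <= m%:R * (L * h ^+ 2).
Proof.
move=> h0 dF fL; elim: m => [|m IH].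
  by rewrite big_ord0 !mul0r subr0 subrr subr0 normr0.
rewrite big_ord_recr/=; set S := \sum_(_ < _) _ in IH *.
pose a := t - m.+1%:R * h; pose b := t - m%:R * h.
have ab : a < b.
  by rewrite /a /b ltrD2l ltrN2 ltr_pM2r// ltr_nat.
have Fc : {within `[a, b], continuous F}.
  apply: continuous_subspaceT => s; apply/differentiable_continuous.
  by apply/derivable1_diffP; case: (dF s).
have [c] := MVT ab (fun t _ => dF t) Fc.
have -> : b - a = h by rewrite /a /b -natr1; ring.
rewrite in_itv/= => /andP[ac cb] E.
have Ecell : `|h * f (t - (m%:R + 2^-1) * h) - (F b - F a)| <= L * h ^+ 2.
  rewrite E mulrC -mulrBl normrM (gtr0_norm h0) expr2 mulrA ler_pM2r//.
  (* A negative [L] contradicts the Lipschitz bound at [c + 1] and [c]. *)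
  have [L0|L0] := lerP 0 L; last first.
    have := fL (c + 1) c; rewrite addrAC subrr add0r normr1 mulr1.
    by move=> /le_lt_trans/(_ L0); rewrite normr_lt0.
  apply: le_trans (fL _ _) _; apply: ler_wpM2l => //.
  move: ac cb; rewrite /a /b -natr1 => ac cb; rewrite ler_norml; apply/andP; split; lra.
rewrite -/a -[in leRHS]natr1 [in leRHS]mulrDl mul1r.
have -> : F t - F a = (F t - F b) + (F b - F a) by ring.
rewrite (_ : _ - _ = (S - (F t - F b)) + (h * f (t - (m%:R + 2^-1) * h) - (F b - F a)));
  last by ring.
by rewrite (le_trans (ler_normD _ _))// lerD.
Qed.

(* [F] is an odd primitive of [f] increasing to [I / 2], with tail at most
   [tau] beyond [d]. *)
Definition kernel_spec f F (I L d tau : R) :=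
  [/\ forall t : R, is_derive t 1 F (f t),
      forall s t, `|f s - f t| <= L * `|s - t|,
      forall t, F (- t) = - F t,
      forall t, F t <= I / 2
    & forall t, d <= t -> I / 2 - tau <= F t].

(** The sum is close to [F (t + D) - F (t - D)], that is, to [F (t + D) + F (D - t)], and each of
    these is at most [I / 2]. *)
Lemma kernel_sum_le f F (I L d tau : R) (D t : R) (n : nat) : 0 < D -> (0 < n)%N ->
  kernel_spec f F I L d tau ->
  \sum_(j < 2 * n) D / n%:R * f (t - (- D + (j%:R + 2^-1) * (D / n%:R)))
    <= I + 2 * D * L * (D / n%:R).
Proof.
move=> D0 n0 [dF fL Fodd FI _].
have h0 : 0 < D / n%:R by rewrite divr_gt0// ltr0n.
have n0R : n%:R != 0 :> R by rewrite pnatr_eq0 -lt0n.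
have := riemann_sum_le (t + D) (2 * n) h0 dF fL.
rewrite natrM (_ : 2 * n%:R * (D / n%:R) = 2 * D); last by field.
rewrite (_ : 2 * n%:R * (L * (D / n%:R) ^+ 2) = 2 * D * L * (D / n%:R)); last by field.
rewrite ler_norml => /andP[_].
under eq_bigr => j _.
  rewrite (_ : t + D - (j%:R + 2^-1) * (D / n%:R) =
    t - (- D + (j%:R + 2^-1) * (D / n%:R))); last by ring.
  over.
have := FI (t + D); have := FI (- (t + D - 2 * D)); rewrite Fodd; lra.
Qed.

(** For [|t| <= D - d] both [t + D] and [D - t] are at least [d], so each of the two halves misses
    at most [tau]. *)
Lemma kernel_sum_ge f F (I L d tau : R) (D t : R) (n : nat) : 0 < D -> (0 < n)%N ->
  kernel_spec f F I L d tau -> `|t| <= D - d ->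
  I - 2 * tau - 2 * D * L * (D / n%:R) <=
  \sum_(j < 2 * n) D / n%:R * f (t - (- D + (j%:R + 2^-1) * (D / n%:R))).
Proof.
move=> D0 n0 [dF fL Fodd FI Fd]; rewrite ler_norml => /andP[t1 t2].
have h0 : 0 < D / n%:R by rewrite divr_gt0// ltr0n.
have n0R : n%:R != 0 :> R by rewrite pnatr_eq0 -lt0n.
have := riemann_sum_le (t + D) (2 * n) h0 dF fL.
rewrite natrM (_ : 2 * n%:R * (D / n%:R) = 2 * D); last by field.
rewrite (_ : 2 * n%:R * (L * (D / n%:R) ^+ 2) = 2 * D * L * (D / n%:R)); last by field.
rewrite ler_norml => /andP[+ _].
under eq_bigr => j _.
  rewrite (_ : t + D - (j%:R + 2^-1) * (D / n%:R) =
    t - (- D + (j%:R + 2^-1) * (D / n%:R))); last by ring.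
  over.
have h1 : d <= t + D by lra.
have h2 : d <= - (t + D - 2 * D) by lra.
have := Fd _ h1; have := Fd _ h2; rewrite Fodd; lra.
Qed.

Lemma atanVE u : 0 < u -> atan u^-1 = pi / 2 - atan u.
Proof.
move=> u0; have := atan_gtNpi2 u; have := atan_ltpi2 u; have := atanK u.
have a0 : 0 < atan u by rewrite -(@atan0 R) lt_atan.
move: (atan u) a0 => th th0 E th1 th2.
rewrite -[pi / 2 - th]tanK; last first.
  rewrite in_itv/=; apply/andP; split; lra.
congr atan; rewrite -E /tan invf_div cosB sinB.
by rewrite cos_pihalf sin_pihalf !mul0r !mul1r ?(sub0r, add0r, subr0, addr0).
Qed.

Lemma atan_bounds u : 0 < u -> u / (1 + u ^+ 2) <= atan u <= u.
Proof.
move=> u0.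
have ac : {within `[0, u], continuous (@atan R)}.
  by apply: continuous_subspaceT => s; exact: continuous_atan.
have [c] := MVT u0 (fun t _ => is_derive1_atan t) ac.
rewrite in_itv/= atan0 !subr0 => /andP[c0 cu] ->.
have c2 : c ^+ 2 <= u ^+ 2 by rewrite lerXn2r ?nnegrE ?ltW.
have c20 := sqr_ge0 c.
apply/andP; split.
  rewrite mulrC ler_pM2r// lef_pV2 ?posrE ?lerD2l//; lra.
by rewrite -[leRHS]mul1r ler_pM2r// invf_le1; lra.
Qed.

(** The function is a primitive of [2 / (1 + u^2)^2]. With [v = 1 / u] its rational part is
    [v / (1 + v^2)] and its arctangent is [pi / 2 - atan v]; the bounds on [atan v] leave a defect
    between 0 and [v - v / (1 + v^2) <= v^3]. *)
Lemma atan_kernel_bounds u : 0 < u ->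
  pi / 2 - u ^- 3 <= u / (1 + u ^+ 2) + atan u <= pi / 2.
Proof.
move=> u0; have v0 : 0 < u^-1 by rewrite invr_gt0.
have /andP[] := atan_bounds v0; rewrite atanVE//.
have -> : u^-1 / (1 + u^-1 ^+ 2) = u / (1 + u ^+ 2).
  by field; rewrite lt0r_neq0//=; have := sqr_ge0 u; lra.
move=> h1 h2; apply/andP; split; last lra.
suff : u^-1 <= u / (1 + u ^+ 2) + u ^- 3 by lra.
rewrite -subr_ge0 (_ : _ - _ = (u ^+ 3 * (1 + u ^+ 2))^-1).
  by rewrite invr_ge0 mulr_ge0// ?addr_ge0 ?exprn_ge0 ?sqr_ge0 ?ltW.
by field; rewrite lt0r_neq0//=; have := sqr_ge0 u; lra.
Qed.

End riemann_sums.

(** * Integrating the approximate identity one coordinate at a time *)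

Section kernels.
Context {R : realType}.
Variables (rho a d : R).
Hypotheses (rho0 : 0 < rho) (rhoa : rho ^+ 2 <= a) (d0 : 0 < d).
Implicit Types t : R.

(** [psi] as a function of a single coordinate [t], with [a] collecting [rho ^+ 2] and the squares
    of the other coordinates. *)
Definition inv_hyp (a t : R) : R := (Num.sqrt (a + t ^+ 2))^-1.
Let M := inv_hyp a.

Let a0 : 0 < a. Proof. by rewrite (lt_le_trans _ rhoa)// exprn_gt0. Qed.

Let at0 t : 0 < a + t ^+ 2. Proof. by rewrite ltr_pwDl ?sqr_ge0. Qed.

Lemma inv_hyp_gt0 t : 0 < M t.
Proof. by rewrite invr_gt0 sqrtr_gt0. Qed.

Lemma sqr_inv_hyp t : M t ^+ 2 = (a + t ^+ 2)^-1.
Proof. by rewrite exprVn sqr_sqrtr// ltW. Qed.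

Lemma sqr_inv_hypE t : t ^+ 2 * M t ^+ 2 = 1 - a * M t ^+ 2.
Proof. by rewrite sqr_inv_hyp; field; exact: lt0r_neq0. Qed.

Lemma inv_hyp_le t : M t <= rho^-1.
Proof.
rewrite lef_pV2 ?posrE ?sqrtr_gt0//.
rewrite -(gtr0_norm rho0) -sqrtr_sqr ler_sqrt ?(ltW (at0 t))//.
by rewrite (le_trans rhoa)// lerDl sqr_ge0.
Qed.

Lemma inv_hyp_norm_le1 t : `|t| * M t <= 1.
Proof.
rewrite -ler_sqr ?nnegrE ?mulr_ge0 ?(ltW (inv_hyp_gt0 t))// expr1n exprMn.
rewrite real_normK ?num_real// sqr_inv_hypE gerBl.
by rewrite mulr_ge0 ?(ltW a0) ?sqr_ge0.
Qed.

Lemma inv_hyp_le_tail t : d <= t -> M t ^+ 2 <= d ^- 2.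
Proof.
move=> dt; rewrite sqr_inv_hyp lef_pV2 ?posrE ?exprn_gt0//.
have : d ^+ 2 <= t ^+ 2 by rewrite lerXn2r ?nnegrE ?(ltW d0)// (le_trans (ltW d0)).
have := a0; lra.
Qed.

Lemma is_derive_inv_hyp t : is_derive t 1 M (- t * M t ^+ 3).
Proof.
have r0 : Num.sqrt (a + t ^+ 2) != 0 by rewrite lt0r_neq0// sqrtr_gt0.
have d1 : is_derive t 1 (fun t : R => a + t * t) (0 + (t * 1 + t * 1)).
  by apply: is_deriveD_fun; apply: is_deriveM_fun.
have at0' : 0 < a + t * t by rewrite -expr2.
have d2 := is_derive_comp1 d1 (is_derive1_sqrt at0').
have d3 := is_deriveV_fun (f := fun t => Num.sqrt (a + t * t)) r0 d2.
rewrite (_ : M = fun t => (Num.sqrt (a + t * t))^-1); last by apply/funext.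
by apply: (is_derive_eq d3); rewrite /M /inv_hyp; field.
Qed.

Lemma is_derive_inv_hypX k t :
  is_derive t 1 (fun t => M t ^+ k) (- (k%:R * t * M t ^+ k.+2)).
Proof.
elim: k => [|k IH]; first by rewrite !mul0r oppr0; exact: is_derive_cst.
have := is_deriveM_fun (is_derive_inv_hyp t) IH.
rewrite (_ : (fun y => M y * M y ^+ k) = fun t => M t ^+ k.+1); last first.
  by apply/funext => y; rewrite -exprS.
by move=> d1; apply: (is_derive_eq d1); rewrite !exprS -natr1; ring.
Qed.

(** The derivative of [M ^+ k] is [k * t * M ^+ k.+2] up to sign, where [|t| * M <= 1] and
    [M <= rho^-1]. The constant does not depend on [a], hence is uniform in the coordinates not yet
    summed over. *)
Lemma inv_hypX_lipschitz k c s t : 0 <= c ->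
  `|c * M s ^+ k - c * M t ^+ k| <= c * k%:R * rho^-1 ^+ k.+1 * `|s - t|.
Proof.
move=> c0.
apply: (@lipschitz_of_derive R (fun t => c * M t ^+ k)
  (fun t => c * (- (k%:R * t * M t ^+ k.+2)))) => u.
  by apply: is_deriveZ_fun; exact: is_derive_inv_hypX.
rewrite normrM (ger0_norm c0) normrN 2!normrM normr_nat -!mulrA ler_wpM2l//.
rewrite ler_wpM2l// normrX (gtr0_norm (inv_hyp_gt0 u)) exprS mulrA.
rewrite -[leRHS]mul1r ler_pM ?inv_hyp_norm_le1 ?mulr_ge0 ?exprn_ge0//
  ?(ltW (inv_hyp_gt0 u))//.
by rewrite lerXn2r ?nnegrE ?inv_hyp_le ?invr_ge0 ?(ltW rho0) ?(ltW (inv_hyp_gt0 u)).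
Qed.

Let is_derive_tM t : is_derive t 1 (fun t => t * M t) (a * M t ^+ 3).
Proof.
have := is_deriveM_fun (is_derive_id (t : R^o) 1) (is_derive_inv_hyp t).
move=> d1; apply: (is_derive_eq d1).
rewrite (_ : a * M t ^+ 3 = (a * M t ^+ 2) * M t); last by ring.
by rewrite -[a * _](subKr 1) -sqr_inv_hypE; ring.
Qed.

Let tM_le1 t : t * M t <= 1.
Proof.
apply: le_trans (inv_hyp_norm_le1 t); rewrite ler_pM2r ?inv_hyp_gt0//.
exact: ler_norm.
Qed.

Let tM_geN1 t : -1 <= t * M t.
Proof.
by have := tM_le1 (- t); rewrite /M /inv_hyp sqrrN mulNr lerNl.
Qed.

(** With [w = t * M t] one has [dw = a M^3 dt] and [a M^2 = 1 - w^2], so the integrand becomes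
    [3 rho^2 / a^2 (1 - w^2) dw]. The missing tail is [rho^2 / a^2 (1 - w)^2 (2 + w)], at most
    [3 rho^2 M^4]. The total mass [4 rho^2 / a^2] is the integrand of [kernel4] in the next
    coordinate. *)
Lemma kernel5 : kernel_spec (fun t => 3 * rho ^+ 2 * M t ^+ 5)
  (fun t => rho ^+ 2 / a ^+ 2 * (3 * (t * M t) - (t * M t) ^+ 3))
  (4 * rho ^+ 2 / a ^+ 2) (3 * rho ^+ 2 * 5 * rho^-1 ^+ 6) d
  (3 * rho ^+ 2 / d ^+ 4).
Proof.
have c0 : 0 <= rho ^+ 2 / a ^+ 2 by rewrite divr_ge0 ?sqr_ge0.
split=> [t|s t|t|t|t dt].
- have d1 := is_derive_tM t.
  have d2 := is_deriveZ_fun (rho ^+ 2 / a ^+ 2) (is_deriveB_fun (is_deriveZ_fun 3 d1)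
    (is_deriveM_fun d1 (is_deriveM_fun d1 d1))).
  rewrite (_ : (fun t => _) = (fun t => rho ^+ 2 / a ^+ 2 *
    (3 * (t * M t) - (t * M t) * ((t * M t) * (t * M t))))); last first.
    by apply/funext => u; ring.
  apply: (is_derive_eq d2).
  rewrite (_ : 3 * _ - _ = 3 * (a * M t ^+ 3) * (1 - t ^+ 2 * M t ^+ 2)); last by ring.
  by rewrite sqr_inv_hypE; field; exact: lt0r_neq0.
- by apply: inv_hypX_lipschitz; rewrite mulr_ge0 ?sqr_ge0.
- by rewrite /M /inv_hyp sqrrN; ring.
- have w1 := tM_le1 t; have w2 := tM_geN1 t; move: (t * M t) w1 w2 => w w1 w2.
  rewrite -subr_ge0 (_ : _ - _ = rho ^+ 2 / a ^+ 2 * ((1 - w) ^+ 2 * (2 + w))).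
    by apply: mulr_ge0 => //; apply: mulr_ge0; [exact: sqr_ge0|lra].
  by field; exact: lt0r_neq0.
- have t0 : 0 < t by exact: lt_le_trans dt.
  have w1 := tM_le1 t.
  have w0 : 0 <= t * M t by rewrite mulr_ge0 ?ltW ?inv_hyp_gt0.
  have Mw : (t * M t) ^+ 2 = 1 - a * M t ^+ 2 by rewrite exprMn sqr_inv_hypE.
  have Md : (M t ^+ 2) ^+ 2 <= (d ^- 2) ^+ 2.
    by rewrite lerXn2r ?inv_hyp_le_tail// nnegrE ?invr_ge0 sqr_ge0.
  move: (t * M t) w1 w0 Mw => w w1 w0 Mw.
  have h : (1 - w) ^+ 2 * (2 + w) <= 3 * (a * M t ^+ 2) ^+ 2.
    have -> : a * M t ^+ 2 = (1 - w) * (1 + w) by rewrite -[LHS](subKr 1) -Mw; ring.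
    rewrite exprMn mulrCA ler_wpM2l ?sqr_ge0//.
    by have := mulr_ge0 w0 w0; nra.
  rewrite lerBlDr -lerBlDl.
  apply: (@le_trans _ _ (rho ^+ 2 / a ^+ 2 * ((1 - w) ^+ 2 * (2 + w)))).
    by rewrite le_eqVlt; apply/orP; left; apply/eqP; field; exact: lt0r_neq0.
  apply: (@le_trans _ _ (rho ^+ 2 / a ^+ 2 * (3 * (a * M t ^+ 2) ^+ 2))).
    exact: ler_wpM2l.
  apply: (@le_trans _ _ (3 * rho ^+ 2 * (M t ^+ 2) ^+ 2)).
    by rewrite le_eqVlt; apply/orP; left; apply/eqP; field; exact: lt0r_neq0.
  apply: ler_wpM2l; first by rewrite mulr_ge0 ?sqr_ge0.
  suff -> : d ^- 4 = (d ^- 2) ^+ 2 by [].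
  by rewrite exprVn -exprM.
Qed.

(** By [FE] the primitive is [2 rho^2 / a^(3/2)] times the function of [atan_kernel_bounds] at
    [t / sqrt a], which gives both the bound and the tail. The total mass [2 pi rho^2 / a^(3/2)] is
    the integrand of [kernel3]. *)
Lemma kernel4 : kernel_spec (fun t => 4 * rho ^+ 2 * M t ^+ 4)
  (fun t => 4 * rho ^+ 2 * ((2 * a)^-1 * (t * M t ^+ 2)
     + (2 * a * Num.sqrt a)^-1 * atan ((Num.sqrt a)^-1 * t)))
  (2 * pi * rho ^+ 2 / (Num.sqrt a) ^+ 3) (4 * rho ^+ 2 * 4 * rho^-1 ^+ 5) d
  (2 * rho ^+ 2 / d ^+ 3).
Proof.
have b0 : 0 < Num.sqrt a by rewrite sqrtr_gt0.
have bE : Num.sqrt a ^+ 2 = a by rewrite sqr_sqrtr// ltW.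
have bn0 := lt0r_neq0 b0; have an0 := lt0r_neq0 a0.
have c0 : 0 <= 2 * rho ^+ 2 / Num.sqrt a ^+ 3.
  by rewrite divr_ge0 ?(exprn_ge0 3 (ltW b0))// mulr_ge0 ?sqr_ge0.
have FE t : 4 * rho ^+ 2 * ((2 * a)^-1 * (t * M t ^+ 2)
     + (2 * a * Num.sqrt a)^-1 * atan ((Num.sqrt a)^-1 * t)) =
  2 * rho ^+ 2 / Num.sqrt a ^+ 3 * ((Num.sqrt a)^-1 * t /
    (1 + ((Num.sqrt a)^-1 * t) ^+ 2) + atan ((Num.sqrt a)^-1 * t)).
  rewrite sqr_inv_hyp; have := lt0r_neq0 (at0 t).
  move: (Num.sqrt a) bE bn0 => b bE bn0; rewrite -bE => h.
  by field; rewrite bn0 h.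
split=> [t|s t|t|t|t dt].
- have d1 := is_deriveZ_fun (2 * a)^-1 (is_deriveM_fun (is_derive_id (t : R^o) 1)
    (is_derive_inv_hypX 2 t)).
  have d2 := is_deriveZ_fun (Num.sqrt a)^-1 (is_derive_id (t : R^o) 1).
  have d3 := is_derive_comp1 d2 (is_derive1_atan ((Num.sqrt a)^-1 * t)).
  have d4 := is_deriveZ_fun (4 * rho ^+ 2) (is_deriveD_fun d1
    (is_deriveZ_fun (2 * a * Num.sqrt a)^-1 d3)).
  apply: (is_derive_eq d4).
  rewrite (_ : M t ^+ 4 = (M t ^+ 2) ^+ 2); last by ring.
  rewrite sqr_inv_hyp; have := lt0r_neq0 (at0 t).
  move: (Num.sqrt a) bE bn0 => b bE bn0; rewrite -bE => h.
  by field; rewrite bn0 h.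
- by apply: inv_hypX_lipschitz; rewrite mulr_ge0 ?sqr_ge0.
- by rewrite /M /inv_hyp sqrrN !mulrN atanN mulNr; ring.
- rewrite FE; set s := (Num.sqrt a)^-1 * t.
  rewrite (_ : 2 * pi * _ / _ / 2 = 2 * rho ^+ 2 / Num.sqrt a ^+ 3 * (pi / 2));
    last by field.
  apply: ler_wpM2l => //.
  have [s0|s0] := ltrP 0 s; first by case/andP: (atan_kernel_bounds s0).
  have h1 : atan s <= 0 by rewrite -(@atan0 R) le_atan.
  have h2 : s / (1 + s ^+ 2) <= 0.
    by rewrite mulr_le0_ge0// invr_ge0; have := sqr_ge0 s; lra.
  by have := @pi_ge0 R; lra.
- rewrite FE; set s := (Num.sqrt a)^-1 * t.
  have t0 : 0 < t by exact: lt_le_trans dt.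
  have s0 : 0 < s by rewrite mulr_gt0 ?invr_gt0.
  rewrite (_ : 2 * pi * _ / _ / 2 = 2 * rho ^+ 2 / Num.sqrt a ^+ 3 * (pi / 2));
    last by field.
  have /andP[h _] := atan_kernel_bounds s0.
  rewrite lerBlDr -lerBlDl -mulrBr.
  apply: (@le_trans _ _ (2 * rho ^+ 2 / Num.sqrt a ^+ 3 * s ^- 3)).
    by apply: ler_wpM2l => //; lra.
  rewrite (_ : _ * s ^- 3 = 2 * rho ^+ 2 / t ^+ 3); last first.
    by rewrite /s; field; rewrite bn0 lt0r_neq0.
  apply: ler_wpM2l; first by rewrite mulr_ge0 ?sqr_ge0.
  rewrite lef_pV2 ?posrE ?exprn_gt0//.
  by rewrite lerXn2r ?nnegrE ?(ltW d0) ?(ltW t0).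
Qed.

End kernels.

(** No other coordinate is left, so [a] is [rho ^+ 2] and the total mass is [4 * pi] whatever [rho].
    The tail comes from [1 - w <= 1 - w^2] for [w = t * M t] in [[0, 1]]. *)
Lemma kernel3 {R : realType} (rho d : R) : 0 < rho -> 0 < d ->
  kernel_spec (fun t => 2 * pi * rho ^+ 2 * inv_hyp (rho ^+ 2) t ^+ 3)
  (fun t => 2 * pi * (t * inv_hyp (rho ^+ 2) t)) (4 * pi)
  (2 * pi * rho ^+ 2 * 3 * rho^-1 ^+ 4) d (2 * pi * rho ^+ 2 / d ^+ 2).
Proof.
move=> rho0 d0; have pi0 := @pi_ge0 R.
have lerho : rho ^+ 2 <= rho ^+ 2 by [].
split=> [t|s t|t|t|t dt].
- have := is_deriveM_fun (is_derive_id (t : R^o) 1) (is_derive_inv_hyp rho0 lerho t).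
  move=> d1; apply: (is_derive_eq (is_deriveZ_fun (2 * pi) d1)).
  have := sqr_inv_hypE rho0 lerho t; move: (inv_hyp _ _) => m E.
  transitivity (2 * pi * (m * (1 - t ^+ 2 * m ^+ 2))); first by ring.
  by rewrite E; ring.
- apply: (inv_hypX_lipschitz rho0 lerho).
  by apply: mulr_ge0; [exact: mulr_ge0|exact: sqr_ge0].
- by rewrite /inv_hyp sqrrN; ring.
- rewrite (_ : 4 * pi / 2 = 2 * pi * 1); last by field.
  rewrite ler_wpM2l ?mulr_ge0//.
  apply: le_trans (inv_hyp_norm_le1 rho0 lerho t).
  by rewrite ler_wpM2r ?ler_norm// ltW// (inv_hyp_gt0 rho0 lerho).
- have t0 : 0 < t by exact: lt_le_trans dt.
  have := inv_hyp_norm_le1 rho0 lerho t; rewrite (gtr0_norm t0).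
  have := sqr_inv_hypE rho0 lerho t.
  have := inv_hyp_le_tail rho0 lerho d0 dt.
  have : 0 < t * inv_hyp (rho ^+ 2) t.
    by rewrite mulr_gt0// (inv_hyp_gt0 rho0 lerho).
  rewrite -exprMn; move: (inv_hyp _ _) => m; set w := t * m => w0 md wm w1.
  rewrite (_ : 4 * pi / 2 = 2 * pi * 1); last by field.
  rewrite lerBlDr -lerBlDl -mulrBr -(mulrA (2 * pi)) ler_wpM2l ?mulr_ge0//.
  apply: (@le_trans _ _ (rho ^+ 2 * m ^+ 2)); last by rewrite ler_wpM2l ?sqr_ge0.
  have : w ^+ 2 <= w by rewrite expr2 -[leRHS]mulr1 ler_wpM2l// ltW.
  lra.
Qed.

(** * The triple midpoint sum of the approximate identity *)

Section triple_sums.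
Context {R : realType}.

Lemma eq_ler (a b : R) : a = b -> a <= b.
Proof. by move=> ->. Qed.

Lemma sum_ffun3 (V : nmodType) (T : finType) (G : T -> T -> T -> V) :
  \sum_(i : {ffun 'I_3 -> T}) G (i 0) (i 1) (i 2%:R) =
  \sum_a \sum_b \sum_c G a b c.
Proof.
pose g (u : T * (T * T)) : {ffun 'I_3 -> T} :=
  [ffun k => if k == 0 then u.1 else if k == 1 then u.2.1 else u.2.2].
pose g' (i : {ffun 'I_3 -> T}) := (i 0, (i 1, i 2%:R)).
rewrite (reindex g) /=; last first.
  exists g' => [[a [b c]] _|i _]; rewrite /g/g' ?ffunE//=.
  by apply/ffunP => k; rewrite ffunE; case: (ord3 k) => [->|[->|->]].
under [in RHS]eq_bigr do rewrite pair_big/=.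
rewrite pair_big/=; apply: eq_bigr => -[a [b c]] _.
by rewrite /g !ffunE.
Qed.

(** The error [e] is the one committed by the inner sum that stands for [g j]; it is summed over an
    interval of length [2 * D]. *)
Lemma kernel_sum_le2 f F (I L d tau D t e : R) (n : nat) (g : 'I_(2 * n) -> R) :
  0 < D -> (0 < n)%N -> kernel_spec f F I L d tau ->
  (forall j : 'I_(2 * n), g j <= f (t - (- D + (j%:R + 2^-1) * (D / n%:R))) + e) ->
  \sum_(j < 2 * n) D / n%:R * g j <= I + 2 * D * L * (D / n%:R) + 2 * D * e.
Proof.
move=> D0 n0 sf ge.
have h0 : 0 < D / n%:R by rewrite divr_gt0// ltr0n.
have n0R : n%:R != 0 :> R by rewrite pnatr_eq0 -lt0n.
have := kernel_sum_le t D0 n0 sf; rewrite -(lerD2r (2 * D * e)).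
apply: le_trans.
rewrite (_ : 2 * D * e = \sum_(j < 2 * n) D / n%:R * e); last first.
  by rewrite sumr_const card_ord -(mulr_natl _ (2 * n)) natrM; field.
rewrite -big_split/=; apply: ler_sum => j _.
by rewrite -mulrDr ler_pM2l.
Qed.

Lemma kernel_sum_ge2 f F (I L d tau D t e : R) (n : nat) (g : 'I_(2 * n) -> R) :
  0 < D -> (0 < n)%N -> kernel_spec f F I L d tau -> `|t| <= D - d ->
  (forall j : 'I_(2 * n), f (t - (- D + (j%:R + 2^-1) * (D / n%:R))) - e <= g j) ->
  I - 2 * tau - 2 * D * L * (D / n%:R) - 2 * D * e <=
    \sum_(j < 2 * n) D / n%:R * g j.
Proof.
move=> D0 n0 sf td ge.
have h0 : 0 < D / n%:R by rewrite divr_gt0// ltr0n.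
have n0R : n%:R != 0 :> R by rewrite pnatr_eq0 -lt0n.
have := kernel_sum_ge D0 n0 sf td; rewrite -(lerD2r (- (2 * D * e))).
move=> /le_trans; apply.
rewrite (_ : 2 * D * e = \sum_(j < 2 * n) D / n%:R * e); last first.
  by rewrite sumr_const card_ord -(mulr_natl _ (2 * n)) natrM; field.
rewrite -sumrB/=; apply: ler_sum => j _.
by rewrite -mulrBr ler_pM2l.
Qed.

Variables (D rho d : R) (n : nat) (x : 'rV[R]_3).
Hypotheses (D0 : 0 < D) (rho0 : 0 < rho) (d0 : 0 < d) (n0 : (0 < n)%N).

Let q (j : nat) : R := - D + (j%:R + 2^-1) * (D / n%:R).
Let B (y : R) := rho ^+ 2 + y ^+ 2.

Lemma center_coord (i : box n) (k : 'I_3) : Defs.center D i 0 k = q (i k).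
Proof. by rewrite mxE. Qed.

Lemma psi_center (i : box n) : psi (rho ^+ 2) (Defs.center D i) x =
  inv_hyp (B (x 0 0 - q (i 0)) + (x 0 1 - q (i 1)) ^+ 2) (x 0 2%:R - q (i 2%:R)).
Proof.
rewrite /psi /rad /inv_hyp dotpE; congr (Num.sqrt _)^-1.
by rewrite /B !(mxE, center_coord) /q; ring.
Qed.

Lemma sum_box_psi5 :
  \sum_(i : box n) (D / n%:R) ^+ 3 * (3 * rho ^+ 2 * psi (rho ^+ 2) (Defs.center D i) x ^+ 5)
  = \sum_(a < 2 * n) D / n%:R * \sum_(b < 2 * n) D / n%:R *
    \sum_(c < 2 * n) D / n%:R * (3 * rho ^+ 2 * inv_hyp (B (x 0 0 - q a)
      + (x 0 1 - q b) ^+ 2) (x 0 2%:R - q c) ^+ 5).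
Proof.
under eq_bigr do rewrite psi_center.
rewrite (sum_ffun3 (fun a b c : 'I_(2 * n) => (D / n%:R) ^+ 3 * (3 * rho ^+ 2 *
  inv_hyp (B (x 0 0 - q a) + (x 0 1 - q b) ^+ 2) (x 0 2%:R - q c) ^+ 5))).
apply: eq_bigr => a _; rewrite mulr_sumr; apply: eq_bigr => b _.
by rewrite 2!mulr_sumr; apply: eq_bigr => c _; rewrite !exprS; ring.
Qed.

Let B_ge y : rho ^+ 2 <= B y. Proof. by rewrite lerDl sqr_ge0. Qed.
Let B_ge2 y z : rho ^+ 2 <= B y + z ^+ 2.
Proof. by rewrite (le_trans (B_ge y))// lerDl sqr_ge0. Qed.

Let I5E y z : 4 * rho ^+ 2 / (B y + z ^+ 2) ^+ 2 = 4 * rho ^+ 2 * inv_hyp (B y) z ^+ 4.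
Proof.
rewrite (_ : inv_hyp _ _ ^+ 4 = (inv_hyp (B y) z ^+ 2) ^+ 2); last by ring.
by rewrite (sqr_inv_hyp rho0 (B_ge y)) exprVn.
Qed.

Let I4E y : 2 * pi * rho ^+ 2 / Num.sqrt (B y) ^+ 3 =
  2 * pi * rho ^+ 2 * inv_hyp (rho ^+ 2) y ^+ 3.
Proof. by rewrite /inv_hyp exprVn. Qed.

Let e5 : R := 2 * D * (3 * rho ^+ 2 * 5 * rho^-1 ^+ 6).
Let e4 : R := 2 * D * (4 * rho ^+ 2 * 4 * rho^-1 ^+ 5).
Let e3 : R := 2 * D * (2 * pi * rho ^+ 2 * 3 * rho^-1 ^+ 4).

(** [e5], [e4] and [e3] are the midpoint errors of the three kernels per unit of mesh. An error of
    an inner sum enters every term of the next one, hence the nested factors [2 * D]; [tail_error]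
    nests the three tails, divided by [rho ^+ 2], in the same way. *)
Definition mesh_error : R := e3 + 2 * D * (e4 + 2 * D * e5).
Definition tail_error : R :=
  2 * (2 * pi / d ^+ 2) + 2 * D * (2 * (2 / d ^+ 3) + 2 * D * (2 * (3 / d ^+ 4))).

Lemma sum_psi5_le :
  \sum_(i : box n) (D / n%:R) ^+ 3 * (3 * rho ^+ 2 * psi (rho ^+ 2) (Defs.center D i) x ^+ 5)
  <= 4 * pi + mesh_error * (D / n%:R).
Proof.
rewrite sum_box_psi5.
apply: le_trans (kernel_sum_le2 (t := x 0 0) (e := (e4 + 2 * D * e5) * (D / n%:R))
  D0 n0 (kernel3 rho0 d0) _) _ => [a|]; last first.
  by apply: eq_ler; rewrite /mesh_error /e3; ring.
rewrite -I4E.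
apply: le_trans (kernel_sum_le2 (t := x 0 1) (e := e5 * (D / n%:R))
  D0 n0 (kernel4 rho0 (B_ge (x 0 0 - q a)) d0) _) _ => [b|]; last first.
  by apply: eq_ler; rewrite /e4; ring.
rewrite -I5E.
exact: kernel_sum_le D0 n0 (kernel5 rho0 (B_ge2 (x 0 0 - q a) (x 0 1 - q b)) d0).
Qed.

Lemma sum_psi5_ge : (forall k : 'I_3, `|x 0 k| <= D - d) ->
  4 * pi - rho ^+ 2 * tail_error - mesh_error * (D / n%:R) <=
  \sum_(i : box n) (D / n%:R) ^+ 3 * (3 * rho ^+ 2 * psi (rho ^+ 2) (Defs.center D i) x ^+ 5).
Proof.
move=> xd; rewrite sum_box_psi5.
pose t5 := 2 * (3 * rho ^+ 2 / d ^+ 4); pose t4 := 2 * (2 * rho ^+ 2 / d ^+ 3).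
apply: le_trans _ (kernel_sum_ge2
  (e := t4 + 2 * D * t5 + (e4 + 2 * D * e5) * (D / n%:R))
  D0 n0 (kernel3 rho0 d0) (xd 0) _) => [|a].
  by apply: eq_ler; rewrite /mesh_error /tail_error /e3 /t4 /t5; ring.
rewrite -I4E.
apply: le_trans _ (kernel_sum_ge2 (e := t5 + e5 * (D / n%:R))
  D0 n0 (kernel4 rho0 (B_ge (x 0 0 - q a)) d0) (xd 1) _) => [|b].
  by apply: eq_ler; rewrite /t4 /e4; ring.
rewrite -I5E.
apply: le_trans _ (kernel_sum_ge D0 n0
  (kernel5 rho0 (B_ge2 (x 0 0 - q a) (x 0 1 - q b)) d0) (xd 2%:R)).
by apply: eq_ler; rewrite /t5 /e5; ring.
Qed.

End triple_sums.

Ltac nneg := repeat (first [ done | exact: pi_ge0 | exact: ler0n | apply: addr_ge0 | apply: mulr_ge0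
  | apply: exprn_ge0 | rewrite invr_ge0 | apply: ltW ]).

(** * Closeness of the Laplacians, relative to the barrier *)

Section laplacian_error.
Context {R : realType}.

Lemma small_sqr (c e : R) : 0 <= c -> 0 < e ->
  exists2 r0 : R, 0 < r0 & forall r, 0 < r -> r <= r0 -> r ^+ 2 * c <= e.
Proof.
move=> c0 e0; have c10 : 0 < c + 1 by lra.
exists (Num.min 1 (e / (c + 1))); first by rewrite lt_min ltr01 divr_gt0.
move=> r r0; rewrite le_min => /andP[r1 re].
apply: (@le_trans _ _ (e / (c + 1) * (c + 1))); last by rewrite divfK ?gt_eqF.
apply: ler_pM => //; [by rewrite sqr_ge0| |lra].
by apply: le_trans re; rewrite expr2 ger_pMr.
Qed.

Lemma small_mesh (D e : R) : 0 < D -> 0 < e ->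
  exists n0 : nat, forall n, (n0 <= n)%N -> (0 < n)%N /\ D / n%:R <= e.
Proof.
move=> D0 e0; have De : 0 < D / e by rewrite divr_gt0.
exists (Num.bound (D / e)).+1 => n hn; split; first exact: leq_trans hn.
have nR : 0 < n%:R :> R by rewrite ltr0n (leq_trans _ hn).
rewrite ler_pdivrMr// mulrC -ler_pdivrMr//.
apply: ltW; apply: lt_le_trans (archi_boundP (ltW De)) _.
by rewrite ler_nat (leq_trans _ hn).
Qed.

Lemma psi_enorm_le1 (a : R) (p x : 'rV[R]_3) : 0 < a ->
  psi a p x * enorm (x - p) <= 1.
Proof.
move=> a0; have h : 0 < a + dotp (x - p) (x - p) by rewrite ltr_pwDl ?dotpp_ge0.
rewrite mulrC ler_pdivrMr ?rad_gt0// mul1r enormE /rad.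
by rewrite ler_sqrt ?(ltW h)// lerDr ltW.
Qed.

Lemma psi_gt0 (a : R) (p x : 'rV[R]_3) : 0 < a -> 0 < psi a p x.
Proof. by move=> a0; rewrite invr_gt0 rad_gt0// ltr_pwDl ?dotpp_ge0. Qed.

Variables (D : R) (A : 'rV[R]_3 -> R).
Hypotheses (D0 : 0 < D) (A_cont : continuous A) (A_ge0 : forall x, 0 <= A x)
  (A_supp : forall x, A x != 0 -> cube D x).

Definition mass (n : nat) (i : box n) : R := A (Defs.center D i) * (D / n%:R) ^+ 3.

Lemma mass_ge0 n (i : box n) : 0 <= mass i.
Proof. by rewrite mulr_ge0 ?exprn_ge0 ?divr_ge0 ?(ltW D0). Qed.

Lemma cube_enorm x : cube D x -> enorm x <= 2 * D.
Proof.
move=> Dx; apply: (@le_trans _ _ (Num.sqrt 3 * D)).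
  by apply: enorm_le_coord => k; rewrite ler_norml; exact: Dx.
rewrite ler_pM2r// -ler_sqr ?nnegrE ?sqrtr_ge0// (@sqr_sqrtr _ 3)//; lra.
Qed.

Lemma center_coord_le n (i : box n) (k : 'I_3) : (0 < n)%N ->
  `|Defs.center D i 0 k| <= D - D / n%:R / 2.
Proof.
move=> n0; have nR : 0 < n%:R :> R by rewrite ltr0n.
have h0 : 0 < D / n%:R by rewrite divr_gt0.
rewrite mxE; set h := D / n%:R in h0 *.
have DE : D = n%:R * h by rewrite /h mulrC divfK ?gt_eqF.
have j0 : 0 <= (i k)%:R :> R by [].
have j1 : (i k)%:R + 1 <= 2 * n%:R :> R.
  by rewrite -natrM natr1 ler_nat ltn_ord.
rewrite ler_norml; apply/andP; split.
  have : 0 <= (i k)%:R * h by rewrite mulr_ge0 // ltW.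
  lra.
have : ((i k)%:R + 1) * h <= 2 * n%:R * h by rewrite ler_pM2r.
lra.
Qed.

Lemma center_cube n (i : box n) : (0 < n)%N -> cube D (Defs.center D i).
Proof.
move=> n0 k; rewrite -ler_norml (le_trans (center_coord_le i k n0))//.
by rewrite lerBlDr lerDl !divr_ge0 ?(ltW D0).
Qed.

Lemma A_bounded : exists2 M, 0 <= M & forall x, A x <= M.
Proof.
have [M hM] := cont_bounded_compact (2 * D) A_cont.
exists M => [|x]; first by apply: le_trans (hM 0 _) => //; rewrite enorm0 mulr_ge0 ?(ltW D0).
have M0 : 0 <= M by apply: le_trans (hM 0 _) => //; rewrite enorm0 mulr_ge0 ?(ltW D0).
have [->//|/A_supp/cube_enorm/hM] := eqVneq (A x) 0.
by move=> h; exact: le_trans (ler_norm _) h.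
Qed.

Lemma sum_cells n (c : R) : (0 < n)%N ->
  \sum_(i : box n) (D / n%:R) ^+ 3 * c = 8 * D ^+ 3 * c.
Proof.
move=> n0; rewrite sumr_const card_ffun !card_ord -(mulr_natl _ (_ ^ _)) natrX natrM.
by field; rewrite pnatr_eq0 -lt0n.
Qed.

(** Let [t] be the largest [|x 0 k|], so [t > 2 * D]. Then [enorm (x - p) >= t / 2], while
    [D^2 + |x|^2 <= t^2 / 4 + 3 t^2], which is below [(4 * t / 2)^2]. *)
Lemma psi_far (a : R) (p x : 'rV[R]_3) (k : 'I_3) : 0 < a -> cube D p ->
  2 * D < `|x 0 k| -> psi a p x <= 4 * psi (D ^+ 2) 0 x.
Proof.
move=> a0 Dp kx.
have D20 : 0 < D ^+ 2 by rewrite exprn_gt0.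
have [t [t2 [k1 tk]] tle] : exists2 t, 2 * D < t /\ (exists k : 'I_3, t = `|x 0 k|) &
    forall k, `|x 0 k| <= t.
  have [k1 _ hk1] := @arg_maxP _ _ 'I_3 k xpredT (fun k => `|x 0 k|) isT.
  exists `|x 0 k1| => [|j]; last exact: hk1.
  by split; [apply: (lt_le_trans kx); exact: hk1|exists k1].
have t0 : 0 <= t by have := D0; lra.
have p1 : t / 2 <= enorm (x - p).
  have := coord_le_enorm (x - p) k1; rewrite !mxE.
  have := Dp k1; rewrite -ler_norml.
  have := lerB_dist (x 0 k1) (p 0 k1); rewrite -tk; lra.
have p2 : enorm x ^+ 2 <= 3 * t ^+ 2.
  have -> : 3 * t ^+ 2 = (Num.sqrt 3 * t) ^+ 2 by rewrite exprMn (@sqr_sqrtr _ 3).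
  by rewrite lerXn2r ?nnegrE ?enorm_ge0 ?(mulr_ge0 (sqrtr_ge0 _) t0) ?enorm_le_coord.
have xp0 : 0 < enorm (x - p) by have := D0; lra.
have r1 : 0 < rad (D ^+ 2) 0 x by rewrite rad_gt0// ltr_pwDl ?dotpp_ge0.
have r2 : 0 < rad a p x by rewrite rad_gt0// ltr_pwDl ?dotpp_ge0.
rewrite /psi ler_pdivlMr// mulrC ler_pdivrMr//.
apply: (@le_trans _ _ (4 * enorm (x - p))); last first.
  rewrite ler_pM2l// enormE /rad ler_sqrt ?lerDr ?(ltW a0)//.
  by rewrite addr_ge0 ?(ltW a0) ?dotpp_ge0.
rewrite -ler_sqr ?nnegrE ?mulr_ge0 ?(ltW r1) ?(ltW xp0)//.
rewrite sqr_rad ?ltr_pwDl ?dotpp_ge0// subr0 -sqr_enorm exprMn.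
have : (t / 2) ^+ 2 <= enorm (x - p) ^+ 2.
  by rewrite lerXn2r ?nnegrE ?(ltW xp0)// divr_ge0.
have : D ^+ 2 <= (t / 2) ^+ 2.
  by rewrite lerXn2r ?nnegrE ?(ltW D0) ?divr_ge0//; have := D0; lra.
lra.
Qed.

Lemma psi_near (x : 'rV[R]_3) : (forall k, `|x 0 k| <= 2 * D) -> (4 * D)^-1 <= psi (D ^+ 2) 0 x.
Proof.
move=> xD; have D20 : 0 < D ^+ 2 by rewrite exprn_gt0.
have D40 : 0 < 4 * D by rewrite mulr_gt0.
have r1 : 0 < rad (D ^+ 2) 0 x by rewrite rad_gt0// ltr_pwDl ?dotpp_ge0.
rewrite lef_pV2 ?posrE// -ler_sqr ?nnegrE ?(ltW r1) ?(ltW D40)//.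
rewrite sqr_rad ?ltr_pwDl ?dotpp_ge0// subr0 -sqr_enorm.
have : enorm x ^+ 2 <= 3 * (2 * D) ^+ 2.
  have -> : 3 * (2 * D) ^+ 2 = (Num.sqrt 3 * (2 * D)) ^+ 2.
    by rewrite [RHS]exprMn (@sqr_sqrtr _ 3).
  have D2 : 0 <= 2 * D by have := D0; lra.
  by rewrite lerXn2r ?nnegrE ?enorm_ge0 ?(mulr_ge0 (sqrtr_ge0 _) D2) ?enorm_le_coord.
rewrite !exprMn; lra.
Qed.

(* Near the boundary of the cube [A] is small, since a point at distance [d]
   lies outside. *)
Lemma A_small_boundary (d e : R) (x : 'rV[R]_3) : 0 < d ->
  (forall x y, enorm x <= 2 * D -> enorm (x - y) <= d -> `|A x - A y| <= e) ->
  0 <= e -> ~ (forall k : 'I_3, `|x 0 k| <= D - d) -> A x <= e.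
Proof.
move=> d0 hd e0 /existsNP[k /negP]; rewrite -ltNge => kx.
have [->//|/A_supp cx] := eqVneq (A x) 0.
pose s : R := if 0 <= x 0 k then d else - d.
have sd : `|s| = d by rewrite /s; case: ifP; rewrite ?normrN gtr0_norm.
pose y := x + s *: delta_mx 0 k.
have Ay : A y = 0.
  apply/eqP; apply: contraT => /A_supp/(_ k).
  rewrite !mxE !eqxx mulr1 -ler_norml leNgt => /negP[].
  move: kx; rewrite /s; case: ifPn => [x0|].
    by rewrite !ger0_norm//; lra.
  by rewrite -ltNge => x0; rewrite !ltr0_norm//; lra.
have := hd x y (cube_enorm cx); rewrite Ay subr0 ger0_norm//; apply.
have -> : x - y = (- s) *: delta_mx 0 k by rewrite /y opprD addNKr scaleNr.
rewrite enormZ normrN sd enormE dotp_delta mxE !eqxx.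
by rewrite sqrtr1 mulr1.
Qed.

(** The choices are made in this order: [d] from the uniform continuity of [A], then [rho] against
    the tails beyond [d], then the mesh against Lipschitz constants that blow up as [rho] tends to
    0. This is why [n0] depends on [rho]. *)
Lemma laplacian_error (e : R) : 0 < e ->
  exists2 rho0 : R, 0 < rho0 & forall rho, 0 < rho -> rho <= rho0 ->
    exists n0 : nat, forall n x, (n0 <= n)%N ->
    `|\sum_(i : box n) mass i * (3 * rho ^+ 2 * psi (rho ^+ 2) (Defs.center D i) x ^+ 5)
      - 4 * pi * A x| < e * (3 * D ^+ 2 * psi (D ^+ 2) 0 x ^+ 5).
Proof.
move=> e0; have [MA MA0 hMA] := A_bounded.
(* By [psi_near], a lower bound of the right-hand side on the doubled cube; a constant error bound
   is enough there. *)
pose e1 := e * (3 * D ^+ 2) * ((4 * D)^-1) ^+ 5.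
have D40 : 0 < (4 * D)^-1 by rewrite invr_gt0 mulr_gt0.
have e10 : 0 < e1 by rewrite !mulr_gt0 ?exprn_gt0.
have pi0 := @pi_gt0 R.
(* [C0] will bound both the discrete mass [S] and [|S - 4 pi|], so that each use of the modulus of
   continuity [e2] costs at most [e1 / 8]. *)
pose C0 := 4 * pi + 1 : R; have C00 : 0 < C0 by rewrite /C0; lra.
pose e2 := e1 / (8 * C0); have e20 : 0 < e2 by rewrite divr_gt0// mulr_gt0.
have [d d0 hd] := unif_cont_compact (2 * D) A_cont e20.
pose C := MA / d ^+ 5; have C_ge0 : 0 <= C by rewrite divr_ge0// exprn_ge0// ltW.
have T0 : 0 <= tail_error D d.
  by rewrite /tail_error; nneg.
have c1 : 0 <= 24 * C * D ^+ 3 + MA * tail_error D d.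
  by nneg.
have e40 : 0 < e1 / 4 by rewrite divr_gt0.
have [r1 r10 hr1] := small_sqr c1 e40.
have c2 : 0 <= 24 * 4 ^+ 5 * D ^+ 3 * MA.
  by nneg.
have c3 : 0 < e * D ^+ 2 by rewrite mulr_gt0// exprn_gt0.
have [r2 r20 hr2] := small_sqr c2 c3.
exists (Num.min r1 r2); first by rewrite lt_min r10.
move=> rho rho0; rewrite le_min => /andP[/(hr1 _ rho0){}hr1 /(hr2 _ rho0){}hr2].
have Q0 : 0 <= mesh_error D rho.
  by rewrite /mesh_error; nneg.
(* The mesh makes [mesh_error D rho * h] at most 1, as [C0] requires, and at most [e1 / 4] after
   multiplication by [MA]. *)
pose e3 := Num.min 1 (e1 / (4 * (MA + 1))) / (mesh_error D rho + 1).
have Q10 : 0 < mesh_error D rho + 1 by lra.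
have MA10 : 0 < 4 * (MA + 1) by lra.
have e30 : 0 < e3 by rewrite divr_gt0// lt_min ltr01 divr_gt0.
have [n0 hn0] := small_mesh D0 e30.
exists n0 => n x /hn0[n_gt0 hn].
set h := D / n%:R in hn.
have h0 : 0 < h by rewrite divr_gt0// ltr0n.
have [hQ1 hQ2] : mesh_error D rho * h <= 1 /\ MA * (mesh_error D rho * h) <= e1 / 4.
  have : mesh_error D rho * h <= Num.min 1 (e1 / (4 * (MA + 1))).
    apply: (@le_trans _ _ ((mesh_error D rho + 1) * h)).
      by rewrite ler_pM2r// lerDl.
    by rewrite mulrC -ler_pdivlMr.
  rewrite le_min => /andP[-> h2]; split=> //.
  apply: (@le_trans _ _ ((MA + 1) * (e1 / (4 * (MA + 1))))).
    by apply: ler_pM => //; [rewrite mulr_ge0// ltW|rewrite lerDl].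
  by apply: eq_ler; field; lra.
have rho20 : 0 < rho ^+ 2 by rewrite exprn_gt0.
have D20 : 0 < D ^+ 2 by rewrite exprn_gt0.
pose K (i : box n) := 3 * rho ^+ 2 * psi (rho ^+ 2) (Defs.center D i) x ^+ 5.
have K0 i : 0 <= K i by rewrite !mulr_ge0// ?exprn_ge0// ltW// psi_gt0.
have h30 : 0 <= h ^+ 3 by rewrite exprn_ge0// ltW.
(* Off the doubled cube [A] vanishes, and by [psi_far] the fifth powers in the sum are controlled by
   that of the barrier, with a factor [rho ^+ 2] to spare. *)
have [[k kx]|near] := pselect (exists k : 'I_3, 2 * D < `|x 0 k|).
  have Ax : A x = 0.
    apply/eqP; apply: contraT => /A_supp/(_ k).
    by rewrite -ler_norml leNgt => /negP[]; have := D0; lra.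
  rewrite Ax mulr0 subr0 ger0_norm; last first.
    by apply: sumr_ge0 => i _; rewrite mulr_ge0 ?mass_ge0 ?K0.
  have p0 := psi_gt0 0 x D20.
  apply: (@le_lt_trans _ _ (\sum_(i : box n) (D / n%:R) ^+ 3 *
      (MA * (3 * rho ^+ 2 * (4 * psi (D ^+ 2) 0 x) ^+ 5)))).
    apply: ler_sum => i _; rewrite [leRHS]mulrA; apply: ler_pM => //.
    - exact: mass_ge0.
    - exact: K0.
    - by rewrite /mass [leLHS]mulrC ler_wpM2l.
    - apply: ler_wpM2l; first by rewrite mulr_ge0// ltW.
      rewrite lerXn2r ?nnegrE//.
      + by rewrite ltW// psi_gt0.
      + by rewrite mulr_ge0// ltW.
      + by apply: psi_far kx => //; exact: center_cube.
  rewrite sum_cells//.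
  have p50 : 0 < psi (D ^+ 2) 0 x ^+ 5 by rewrite exprn_gt0.
  have := ler_wpM2r (ltW p50) hr2.
  have : 0 < e * D ^+ 2 * psi (D ^+ 2) 0 x ^+ 5 by rewrite mulr_gt0.
  rewrite [(4 * _) ^+ 5]exprMn.
  by move: (4 ^+ 5) (psi _ _ _ ^+ 5) => c p; have := c3; lra.
have {}near k : `|x 0 k| <= 2 * D.
  by rewrite leNgt; apply/negP => kx; apply: near; exists k.
pose S := \sum_(i : box n) h ^+ 3 * K i.
have S_ge0 : 0 <= S by apply: sumr_ge0 => i _; rewrite mulr_ge0.
have S_le : S <= 4 * pi + mesh_error D rho * h by exact: (sum_psi5_le x D0 rho0 d0 n_gt0).
(* Freeze [A] at [x]: the first sum is the oscillation of [A] weighted by the kernel, the second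
   term compares the mass [S] of the kernel with [4 pi]. *)
have -> : \sum_(i : box n) mass i * K i - 4 * pi * A x =
    \sum_(i : box n) h ^+ 3 * (K i * (A (Defs.center D i) - A x)) + A x * (S - 4 * pi).
  have -> : A x * (S - 4 * pi) = \sum_(i : box n) h ^+ 3 * (K i * A x) - 4 * pi * A x.
    rewrite mulrBr /S mulr_sumr; congr (_ - _); last by ring.
    by apply: eq_bigr => i _; ring.
  rewrite addrA -big_split/=; congr (_ - _); apply: eq_bigr => i _.
  by rewrite /mass -/h; ring.
have E1 : `|\sum_(i : box n) h ^+ 3 * (K i * (A (Defs.center D i) - A x))| <=
    e2 * S + 8 * D ^+ 3 * (3 * rho ^+ 2 * C).
  rewrite -(sum_cells _ n_gt0) -/h /S mulr_sumr -big_split/=.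
  apply: le_trans (ler_norm_sum _ _ _) _; apply: ler_sum => i _.
  rewrite normrM (ger0_norm h30) mulrCA -mulrDr; apply: ler_wpM2l => //.
  rewrite normrM (ger0_norm (K0 i)).
  (* Centres within [d] are covered by uniform continuity; for the others the kernel is at most
     [3 * rho ^+ 2 / d ^+ 5]. *)
  have [xd|xd] := lerP (enorm (Defs.center D i - x)) d.
    apply: (@le_trans _ _ (e2 * K i)).
      by rewrite mulrC ler_wpM2r// hd// cube_enorm//; exact: center_cube.
    by rewrite lerDl mulr_ge0// mulr_ge0// ltW.
  apply: (@le_trans _ _ (3 * rho ^+ 2 * C)); last first.
    by rewrite lerDr mulr_ge0// ltW.
  have AM : `|A (Defs.center D i) - A x| <= MA.
    rewrite ler_norml; have := A_ge0 x; have := A_ge0 (Defs.center D i).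
    by have := hMA x; have := hMA (Defs.center D i); lra.
  rewrite /K -[leLHS]mulrA; apply: ler_wpM2l; first by rewrite mulr_ge0// ltW.
  rewrite /C mulrC; apply: ler_pM => //; first by rewrite exprn_ge0// ltW// psi_gt0.
  have p0 := psi_gt0 (Defs.center D i) x rho20.
  rewrite -exprVn; apply: lerXn2r; rewrite ?nnegrE;
    [exact: ltW|by rewrite invr_ge0 ltW|].
  rewrite -[leRHS]mul1r ler_pdivlMr//.
  apply: le_trans (psi_enorm_le1 (Defs.center D i) x rho20).
  by rewrite ler_pM2l// enormB ltW.
have E2 : `|A x * (S - 4 * pi)| <= e2 * C0 + MA * (rho ^+ 2 * tail_error D d + mesh_error D rho * h).
  rewrite normrM (ger0_norm (A_ge0 x)).
  have MQ0 : 0 <= MA * (rho ^+ 2 * tail_error D d + mesh_error D rho * h).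
    by apply: mulr_ge0 => //; apply: addr_ge0; apply: mulr_ge0 => //; exact: ltW.
  (* At distance [d] from the faces the mass is close to [4 pi]; elsewhere [A x <= e2] and the crude
     bound on the mass suffices. *)
  have [inside|outside] := pselect (forall k : 'I_3, `|x 0 k| <= D - d).
    have S_ge : 4 * pi - rho ^+ 2 * tail_error D d - mesh_error D rho * h <= S.
      exact: sum_psi5_ge.
    apply: (@le_trans _ _ (MA * (rho ^+ 2 * tail_error D d + mesh_error D rho * h))).
      apply: ler_pM => //.
      have : 0 <= rho ^+ 2 * tail_error D d by rewrite mulr_ge0// ltW.
      by rewrite ler_norml; lra.
    by rewrite lerDr mulr_ge0 ?(ltW e20) ?(ltW C00).
  have Ae := A_small_boundary d0 hd (ltW e20) outside.
  apply: (@le_trans _ _ (e2 * C0)); last by rewrite lerDl.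
  apply: ler_pM => //.
  by rewrite ler_norml /C0; lra.
have E3 : e2 * S <= e2 * C0 by rewrite ler_pM2l// /C0; lra.
have E4 : e2 * C0 = e1 / 8 by rewrite /e2; field; lra.
have E5 : e1 <= e * (3 * D ^+ 2 * psi (D ^+ 2) 0 x ^+ 5).
  rewrite /e1 -mulrA; apply: ler_wpM2l; first exact: ltW.
  apply: ler_wpM2l; first by rewrite mulr_ge0// ltW.
  rewrite lerXn2r ?nnegrE ?(ltW D40) ?psi_near//.
  by rewrite ltW// psi_gt0.
have := ler_normD (\sum_(i : box n) h ^+ 3 * (K i * (A (Defs.center D i) - A x)))
  (A x * (S - 4 * pi)).
move: E1 E2 E3 E4 E5 hr1 hQ2 e10; lra.
Qed.

End laplacian_error.

(** * Uniform convergence of the potentials *)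

Section at_infinity.
Context {R : realType}.
Implicit Types (f g : 'rV[R]_3 -> R).

Lemma tends_cst (c : R) : tends_at_infinity (fun=> c) c.
Proof. by move=> e e0; exists 0 => x _; rewrite subrr normr0. Qed.

Lemma tendsD f g (a b : R) : tends_at_infinity f a -> tends_at_infinity g b ->
  tends_at_infinity (fun x => f x + g x) (a + b).
Proof.
move=> fa gb e e0; have e20 : 0 < e / 2 by rewrite divr_gt0.
have [M hM] := fa _ e20; have [N hN] := gb _ e20.
exists (Num.max M N) => x; rewrite gt_max => /andP[/hM h1 /hN h2].
rewrite (_ : _ - _ = (f x - a) + (g x - b)); last by ring.
apply: le_lt_trans (ler_normD _ _) _; lra.
Qed.

Lemma tendsZ (c : R) f (a : R) : tends_at_infinity f a ->
  tends_at_infinity (fun x => c * f x) (c * a).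
Proof.
move=> fa e e0; have c0 : 0 < `|c| + 1 by rewrite ltr_pwDr.
have ec : 0 < e / (`|c| + 1) by rewrite divr_gt0.
have [M hM] := fa _ ec; exists M => x /hM.
rewrite ltr_pdivlMr// -mulrBr normrM => h; apply: le_lt_trans h.
by rewrite mulrC ler_wpM2l// lerDl.
Qed.

Lemma tends_sum (I : Type) (s : seq I) (f : I -> 'rV[R]_3 -> R) :
  (forall i, tends_at_infinity (f i) 0) ->
  tends_at_infinity (fun x => \sum_(i <- s) f i x) 0.
Proof.
move=> h; elim: s => [|i s IH].
  rewrite (_ : (fun x => _) = fun=> 0); first exact: tends_cst.
  by apply/funext => x; rewrite big_nil.
rewrite (_ : (fun x => _) = fun x => f i x + \sum_(i <- s) f i x); last first.
  by apply/funext => x; rewrite big_cons.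
by have := tendsD (h i) IH; rewrite addr0.
Qed.

Lemma tends_psi (a : R) p : 0 < a -> tends_at_infinity (psi a p) 0.
Proof.
move=> a0 e e0; exists (enorm p + e^-1) => x hx.
have p0 := psi_gt0 p x a0; rewrite subr0 gtr0_norm//.
have h : e^-1 < enorm (x - p) by have := lerB_enorm x p; lra.
have := psi_enorm_le1 p x a0.
have : psi a p x * e^-1 < psi a p x * enorm (x - p) by rewrite ltr_pM2l.
by move=> /lt_le_trans /[apply]; rewrite ltr_pdivrMr// mul1r.
Qed.

Lemma continuousD_at f g x : {for x, continuous f} -> {for x, continuous g} ->
  {for x, continuous (fun y => f y + g y)}.
Proof. exact: continuousD. Qed.

Lemma continuousZ_at (c : R) f x : {for x, continuous f} ->
  {for x, continuous (fun y => c * f y)}.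
Proof. by move=> h; apply: continuousM => //; exact: cst_continuous. Qed.

Lemma continuous_sum_seq (I : Type) (s : seq I) (f : I -> 'rV[R]_3 -> R) x :
  (forall i, {for x, continuous (f i)}) ->
  {for x, continuous (fun y => \sum_(i <- s) f i y)}.
Proof.
move=> h; elim: s => [|i s IH].
  rewrite (_ : (fun x => _) = fun=> 0); first exact: cst_continuous.
  by apply/funext => y; rewrite big_nil.
rewrite (_ : (fun x => _) = fun x => f i x + \sum_(i <- s) f i x); last first.
  by apply/funext => y; rewrite big_cons.
exact: continuousD.
Qed.

End at_infinity.

(** * The smoothed sum and the Poisson solution *)

Section smoothed_potential.
Context {R : realType}.
Variables (D : R) (A chi : 'rV[R]_3 -> R).
Hypotheses (D0 : 0 < D) (A_cont : continuous A) (A_ge0 : forall x, 0 <= A x)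
  (A_supp : forall x, A x != 0 -> cube D x) (chiP : poisson_solution A chi).

Let D20 : 0 < D ^+ 2. Proof. exact: exprn_gt0. Qed.

Let psi_pos (a : R) (p x : 'rV[R]_3) : 0 < a -> 0 < a + dotp (x - p) (x - p).
Proof. by move=> a0; rewrite ltr_pwDl ?dotpp_ge0. Qed.

(** [chi] is superharmonic, but not strictly; a multiple [e] of the barrier is added to make the
    inequality strict, and [e] is sent to 0. *)
Lemma poisson_ge1 x : 1 <= chi x.
Proof.
have [chi2 lchi chi1] := chiP.
suff h e : 0 < e -> 1 - e * psi (D ^+ 2) 0 x <= chi x.
  rewrite leNgt; apply/negP => cx.
  have p0 := psi_gt0 0 x D20.
  have e0 : 0 < (1 - chi x) / (2 * psi (D ^+ 2) 0 x).
    by rewrite divr_gt0 ?mulr_gt0// subr_gt0.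
  have := h _ e0.
  rewrite (_ : (1 - chi x) / (2 * psi (D ^+ 2) 0 x) * psi (D ^+ 2) 0 x =
    (1 - chi x) / 2); last by field; exact: lt0r_neq0.
  lra.
move=> e0.
pose W y := chi y + (cst (-1) y + e * psi (D ^+ 2) 0 y).
have tW y := twice_diffD (Ck2_twice_diff y chi2) (twice_diffD (twice_diff_cst (-1) y)
  (twice_diffZ e (twice_diff_psi (ltW D20) (psi_pos 0 y D20)))).
suff : 0 <= W x by rewrite /W /=; lra.
apply: (superharmonic_ge0 _ tW) => [y|y|].
- apply: (continuousD_at (f := chi)); first exact: Ck2_continuous.
  apply: (continuousD_at (f := cst (-1))); first exact: cst_continuous.
  by apply: continuousZ_at; apply: psi_continuous; exact: psi_pos.
- rewrite big_split/= -/(laplacian chi y) lchi big_split/= -mulr_sumr.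
  rewrite laplacian_psi_sum ?psi_pos// big1 ?add0r//.
  have : 0 <= 4 * pi * A y by rewrite !mulr_ge0// pi_ge0.
  have : 0 < e * (3 * D ^+ 2 * psi (D ^+ 2) 0 y ^+ 5).
    apply: mulr_gt0 => //; apply: mulr_gt0; first exact: mulr_gt0.
    by apply: exprn_gt0; exact: psi_gt0.
  lra.
- rewrite (_ : 0 = 1 + (-1 + e * 0)); last by ring.
  apply: tendsD => //; apply: tendsD; first exact: tends_cst.
  by apply: tendsZ; exact: tends_psi.
Qed.

Definition chi_smooth (rho : R) (n : nat) (x : 'rV[R]_3) : R :=
  1 + \sum_(i : box n) mass D A i * psi (rho ^+ 2) (Defs.center D i) x.

(** The barrier is at most [1 / D], so [e * D] times it costs at most [e]. The sign [s] in [W]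
    yields both one-sided bounds from a single application of the maximum principle. *)
Lemma chi_smooth_compare (e : R) : 0 < e ->
  exists2 rho0 : R, 0 < rho0 & forall rho, 0 < rho -> rho <= rho0 ->
    exists n0 : nat, forall n x, (n0 <= n)%N ->
    `|chi_smooth rho n x - chi x| <= e.
Proof.
move=> e0; have [chi2 lchi chi1] := chiP.
have eD : 0 < e * D by rewrite mulr_gt0.
have [rho0 rho00 h] := laplacian_error D0 A_cont A_ge0 A_supp eD.
exists rho0 => // rho rhop /(h _ rhop)[n0 hn0]; exists n0 => n x /(fun hn y => hn0 n y hn) {hn0}h.
have rho20 : 0 < rho ^+ 2 by rewrite exprn_gt0.
pose W s y := s * (cst 1 y +
    \sum_(i : box n) mass D A i * psi (rho ^+ 2) (Defs.center D i) y)
  + (- s * chi y + e * D * psi (D ^+ 2) 0 y).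
suff Wge0 s : `|s| = 1 -> 0 <= W s x.
  have := Wge0 1 (normr1 _); have := Wge0 (-1) (normrN1 _); rewrite /W /=.
  have : e * D * psi (D ^+ 2) 0 x <= e.
    have : rad (D ^+ 2) 0 x >= D.
      rewrite -[leLHS](gtr0_norm D0) -sqrtr_sqr /rad ler_sqrt ?(ltW (psi_pos _ _ D20))//.
      by rewrite lerDl dotpp_ge0.
    rewrite -mulrA => hr; rewrite ger_pMr// /psi ler_pdivrMr ?mul1r//.
    exact: lt_le_trans hr.
  rewrite /chi_smooth ler_norml; lra.
move=> s1.
have tW y := twice_diffD (twice_diffZ s (twice_diffD (twice_diff_cst 1 y)
  (twice_diff_sum (s := index_enum (box n)) (fun i _ => twice_diffZ (mass D A i)
    (twice_diff_psi (ltW rho20) (psi_pos (Defs.center D i) y rho20))))))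
  (twice_diffD (twice_diffZ (- s) (Ck2_twice_diff y chi2))
  (twice_diffZ (e * D) (twice_diff_psi (ltW D20) (psi_pos 0 y D20)))).
apply: (superharmonic_ge0 _ tW) => [y|y|].
- apply: (continuousD_at (f := fun y => s * _)).
    apply: continuousZ_at; apply: (continuousD_at (f := cst 1)).
      exact: cst_continuous.
    apply: continuous_sum_seq => i.
    by apply: continuousZ_at; apply: psi_continuous; exact: psi_pos.
  apply: (continuousD_at (f := fun y => - s * chi y)).
    by apply: continuousZ_at; exact: Ck2_continuous.
  by apply: continuousZ_at; apply: psi_continuous; exact: psi_pos.
- rewrite big_split/= -mulr_sumr big_split/= big1 ?add0r// exchange_big/=.
  rewrite (eq_bigr (fun i : box n => mass D A i *
    (- 3 * rho ^+ 2 * psi (rho ^+ 2) (Defs.center D i) y ^+ 5))); last first.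
    by move=> i _; rewrite -mulr_sumr laplacian_psi_sum// psi_pos.
  rewrite big_split/= -mulr_sumr -/(laplacian chi y) lchi -mulr_sumr.
  rewrite laplacian_psi_sum ?psi_pos//.
  rewrite (eq_bigr (fun i : box n => - (mass D A i *
    (3 * rho ^+ 2 * psi (rho ^+ 2) (Defs.center D i) y ^+ 5)))); last first.
    by move=> i _; ring.
  rewrite sumrN; move: (h y); set S := \sum_(i : box n) _ => hS.
  have : `|s * (S - 4 * pi * A y)| < e * D * (3 * D ^+ 2 * psi (D ^+ 2) 0 y ^+ 5).
    by rewrite normrM s1 mul1r.
  rewrite ltr_norml => /andP[+ _]; lra.
- suff : tends_at_infinity (W s) (s * (1 + 0) + (- s * 1 + e * D * 0)).
    by rewrite (_ : s * _ + _ = 0); last by ring.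
  apply: tendsD; first apply: tendsZ.
    apply: tendsD; first exact: tends_cst.
    apply: (@tends_sum R (box n) _ (fun i y =>
      mass D A i * psi (rho ^+ 2) (Defs.center D i) y)) => i.
    by have := tendsZ (mass D A i) (tends_psi (Defs.center D i) rho20); rewrite mulr0.
  apply: tendsD; first exact: tendsZ.
  by apply: tendsZ; exact: tends_psi.
Qed.

End smoothed_potential.

(** * Sums of an integrable singularity *)

Section sqrt_sums.
Context {R : realType}.
Implicit Types (a h s t u : R).

(* A primitive of [s |-> |s| ^ (-1/2) / 2]. *)
Definition signed_sqrt s : R := Num.sqrt s - Num.sqrt (- s).

Lemma sqrtr_le0 s : s <= 0 -> Num.sqrt s = 0.
Proof. by move=> s0; apply/eqP; rewrite sqrtr_eq0. Qed.

(** If the cell lies to the right of 0, its far end is at most four times the argument of the square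
    root on the left. If it contains 0, the increment of [signed_sqrt] is at least [sqrt h], and the
    cut-off [h / 2] bounds the left side. *)
Lemma signed_sqrt_cell u h : 0 < h ->
  h / Num.sqrt (Num.max `|u + h / 2| (h / 2)) <=
  4 * (signed_sqrt (u + h) - signed_sqrt u).
Proof.
move=> h0.
have s4 : Num.sqrt 4 = 2 :> R.
  rewrite (_ : 4 = 2 ^+ 2); last by ring.
  by rewrite sqrtr_sqr ger0_norm.
(* the symmetry [u |-> - u - h] exchanges the two end points *)
wlog u0 : u / - h < u => [th|].
  have [|uh] := ltrP (- h) u; first exact: th.
  have := th (- u - h); rewrite (_ : - u - h + h / 2 = - (u + h / 2)); last by field.
  rewrite normrN /signed_sqrt (_ : - u - h + h = - u); last by ring.
  rewrite (_ : - (- u - h) = u + h) ?opprK; last by ring.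
  rewrite (_ : - u - h = - (u + h)); last by ring.
  by rewrite (_ : Num.sqrt (- u) - _ - _ = Num.sqrt (u + h) - Num.sqrt (- (u + h))
    - (Num.sqrt u - Num.sqrt (- u))); [apply; lra|ring].
have uh0 : 0 < u + h by lra.
rewrite /signed_sqrt (sqrtr_le0 (_ : - (u + h) <= 0)) ?subr0; last lra.
have b0 : 0 < Num.max `|u + h / 2| (h / 2) by rewrite lt_max divr_gt0 ?orbT.
rewrite ler_pdivrMr ?sqrtr_gt0//.
set b := Num.max _ _ in b0 *.
have bh : h / 2 <= b by rewrite le_max lexx orbT.
have bu : u + h / 2 <= b by rewrite le_max ler_norm.
have [u1|u1] := lerP 0 u.
  rewrite (sqrtr_le0 (_ : - u <= 0)) ?subr0; last lra.
  have vw : 0 < Num.sqrt (u + h) + Num.sqrt u.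
    by rewrite ltr_pwDl ?sqrtr_ge0 ?sqrtr_gt0.
  rewrite -(ler_pM2r vw).
  rewrite (_ : 4 * _ * _ * _ = 4 * Num.sqrt b *
    (Num.sqrt (u + h) ^+ 2 - Num.sqrt u ^+ 2)); last by ring.
  rewrite !sqr_sqrtr ?(ltW uh0)// (_ : u + h - u = h); last by ring.
  rewrite mulrC ler_pM2r//.
  have : Num.sqrt u <= Num.sqrt (u + h) by rewrite ler_sqrt; lra.
  have : Num.sqrt (u + h) <= Num.sqrt (4 * b) by rewrite ler_sqrt; lra.
  by rewrite sqrtrM// s4; lra.
rewrite (sqrtr_le0 (ltW u1)) sub0r opprK.
have E : h <= (Num.sqrt (u + h) + Num.sqrt (- u)) ^+ 2.
  rewrite sqrrD !sqr_sqrtr ?(ltW uh0)//; last lra.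
  have : 0 <= Num.sqrt (u + h) * Num.sqrt (- u) by rewrite mulr_ge0 ?sqrtr_ge0.
  lra.
have E2 : Num.sqrt h <= Num.sqrt (u + h) + Num.sqrt (- u).
  by rewrite -ler_sqr ?nnegrE ?sqrtr_ge0 ?addr_ge0 ?sqrtr_ge0// (sqr_sqrtr (ltW h0)).
have E3 : Num.sqrt h <= 4 * Num.sqrt b.
  have : Num.sqrt h <= Num.sqrt (4 * b) by rewrite ler_sqrt; lra.
  by rewrite sqrtrM// s4; have := sqrtr_ge0 b; lra.
rewrite -{1}(sqr_sqrtr (ltW h0)) expr2 mulrAC.
by rewrite mulrC ler_pM ?sqrtr_ge0// mulrC.
Qed.

(** The cell bounds telescope, leaving a bound independent of [n] for sums of an unbounded
    function. *)
Lemma sqrt_sum_le (D t r : R) (n : nat) : 0 < D -> (0 < n)%N -> `|t| <= r ->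
  \sum_(j < 2 * n) D / n%:R /
    Num.sqrt (Num.max `|t - (- D + (j%:R + 2^-1) * (D / n%:R))| (D / n%:R / 2))
  <= 8 * Num.sqrt (D + r).
Proof.
move=> D0 n0 tr.
have n0R : n%:R != 0 :> R by rewrite pnatr_eq0 -lt0n.
have h0 : 0 < D / n%:R by rewrite divr_gt0// ltr0n.
set h := D / n%:R in h0 *.
pose g (j : nat) := 4 * signed_sqrt (- D - t + j%:R * h).
apply: (@le_trans _ _ (\sum_(j < 2 * n) (g j.+1 - g j))).
  apply: ler_sum => j _; rewrite /g -mulrBr.
  have := signed_sqrt_cell (- D - t + j%:R * h) h0.
  rewrite (_ : - D - t + j%:R * h + h = - D - t + j.+1%:R * h); last first.
    by rewrite -natr1; ring.
  rewrite (_ : - D - t + j%:R * h + h / 2 = - (t - (- D + (j%:R + 2^-1) * h))).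
    by rewrite normrN.
  by field.
rewrite -(big_mkord xpredT (fun j => g j.+1 - g j)) telescope_sumr// /g -mulrBr.
rewrite natrM mul0r addr0 (_ : - D - t + 2 * n%:R * h = D - t); last first.
  by rewrite /h; field.
move: tr; rewrite ler_norml => /andP[t1 t2].
rewrite /signed_sqrt.
have s1 : Num.sqrt (D - t) <= Num.sqrt (D + r) by rewrite ler_sqrt; lra.
have s2 : Num.sqrt (- (- D - t)) <= Num.sqrt (D + r) by rewrite ler_sqrt; lra.
have := sqrtr_ge0 (- (D - t)); have := sqrtr_ge0 (- D - t); lra.
Qed.

(** With [s] the square root of [c2^2 + r^2], the difference is [(s - r) / (r s)]. The geometric
    mean of [s - r <= c2] and [s - r <= s] gains the small factor [sqrt c2] and leaves a singularity
    [r^(-3/2)], still integrable in dimension 3. *)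
Lemma inv_diff_le (c2 r : R) : 0 < c2 -> 0 < r ->
  0 <= r^-1 - (Num.sqrt (c2 ^+ 2 + r ^+ 2))^-1 <= Num.sqrt c2 / Num.sqrt r ^+ 3.
Proof.
move=> c0 r0; set s := Num.sqrt _.
have s2 : s ^+ 2 = c2 ^+ 2 + r ^+ 2 by rewrite sqr_sqrtr// addr_ge0 ?sqr_ge0.
have s0 : 0 < s by rewrite sqrtr_gt0 ltr_pwDl ?exprn_gt0 ?sqr_ge0.
have rs : r <= s.
  by rewrite -ler_sqr ?nnegrE ?(ltW r0) ?(ltW s0)// s2 lerDr sqr_ge0.
have sc : s - r <= c2.
  rewrite lerBlDr -ler_sqr ?nnegrE ?(ltW s0) ?addr_ge0 ?(ltW r0) ?(ltW c0)//.
  rewrite s2 sqrrD; have : 0 <= c2 * r by rewrite mulr_ge0 ?ltW.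
  lra.
rewrite subr_ge0 lef_pV2 ?posrE// rs /=.
have a0 : 0 < Num.sqrt r by rewrite sqrtr_gt0.
have a2 : r = Num.sqrt r ^+ 2 by rewrite sqr_sqrtr// ltW.
have key : (s - r) * Num.sqrt r <= Num.sqrt c2 * s.
  have sr0 : 0 <= s - r by lra.
  rewrite -{1}(sqr_sqrtr sr0) -{2}(sqr_sqrtr (ltW s0)) !expr2 -mulrA.
  apply: ler_pM; rewrite ?mulr_ge0 ?sqrtr_ge0 ?ler_sqrt ?(ltW c0)//.
  apply: ler_pM; rewrite ?sqrtr_ge0 ?ler_sqrt ?(ltW s0)//; lra.
rewrite ler_pdivlMr ?exprn_gt0// -(ler_pM2r s0).
apply: le_trans key; rewrite le_eqVlt; apply/orP; left; apply/eqP.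
by rewrite {1 3}a2; field; rewrite !lt0r_neq0.
Qed.

End sqrt_sums.

(** * From the smoothed sum back to point charges *)

Section desingularization.
Context {R : realType}.
Variables (D : R) (A chi : 'rV[R]_3 -> R).
Hypotheses (D0 : 0 < D) (A_cont : continuous A) (A_ge0 : forall x, 0 <= A x)
  (A_supp : forall x, A x != 0 -> cube D x) (chiP : poisson_solution A chi).

(* [chi_n] with the potential of each charge cut off inside the excised ball. *)
Definition chi_cut (n : nat) (x : 'rV[R]_3) : R :=
  1 + \sum_(i : box n) mass D A i / Num.max (enorm (x - Defs.center D i)) (D / n%:R ^+ 2).

(** The cut-off at half the mesh is needed since a single coordinate difference may vanish; it is
    harmless, since a charge outside the box of [x] is at distance at least half the mesh. *)
Let b (n : nat) (x : 'rV[R]_3) (i : box n) (k : 'I_3) : R :=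
  Num.max `|x 0 k - Defs.center D i 0 k| (D / n%:R / 2).

(** The product form factors the sum over the boxes into three sums along the axes. *)
Lemma sum_box_sqrt (n : nat) (x : 'rV[R]_3) (r : R) : (0 < n)%N -> enorm x <= r ->
  \sum_(i : box n) (D / n%:R) ^+ 3 * \prod_(k < 3) (Num.sqrt (b x i k))^-1
  <= (8 * Num.sqrt (D + r)) ^+ 3.
Proof.
move=> n0 xr.
have h0 : 0 < D / n%:R by rewrite divr_gt0// ltr0n.
pose g (k : 'I_3) (j : 'I_(2 * n)) := D / n%:R /
  Num.sqrt (Num.max `|x 0 k - (- D + (j%:R + 2^-1) * (D / n%:R))| (D / n%:R / 2)).
rewrite (eq_bigr (fun i : box n => \prod_(k < 3) g k (i k))); last first.
  move=> i _; rewrite big_split/= prodr_const card_ord; congr (_ * _).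
  by apply: eq_bigr => k _; rewrite /b mxE.
rewrite -(bigA_distr_bigA g) -[X in _ ^+ X](card_ord 3) -prodr_const.
apply: ler_prod => k _; apply/andP; split.
  by apply: sumr_ge0 => j _; rewrite divr_ge0 ?sqrtr_ge0 ?ltW.
by apply: sqrt_sum_le => //; exact: le_trans (coord_le_enorm x k) xr.
Qed.

(** The open box around the centre contains [x]. At most one charge is singular in this sense; it is
    estimated alone, by its mass over the cut-off radius, of order [D ^+ 2 / n]. *)
Let sing (n : nat) (x : 'rV[R]_3) (i : box n) : bool :=
  [forall k : 'I_3, `|x 0 k - Defs.center D i 0 k| < D / n%:R / 2].

Lemma sing_unique (n : nat) (x : 'rV[R]_3) (i j : box n) : (0 < n)%N ->
  sing x i -> sing x j -> i = j.
Proof.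
move=> n0 /forallP si /forallP sj; apply/ffunP => k; apply/val_inj.
have h0 : 0 < D / n%:R by rewrite divr_gt0// ltr0n.
have := si k; have := sj k; rewrite !mxE; set h := D / n%:R in h0 *.
rewrite !ltr_norml => /andP[h1 h2] /andP[h3 h4].
have e1 : (i k)%:R < (j k)%:R + 1 :> R by rewrite -(ltr_pM2r h0); lra.
have e2 : (j k)%:R < (i k)%:R + 1 :> R by rewrite -(ltr_pM2r h0); lra.
move: e1 e2; rewrite !natr1 !ltr_nat !ltnS => e1 e2.
by apply/eqP; rewrite eqn_leq e1 e2.
Qed.

Lemma cut_smooth_le (rho r MA : R) (n : nat) x : 0 < rho -> (1 < n)%N ->
  D / n%:R ^+ 2 <= rho -> (forall y, A y <= MA) -> enorm x <= r ->
  `|chi_cut n x - chi_smooth D A rho n x| <=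
    MA * (Num.sqrt rho * (8 * Num.sqrt (D + r)) ^+ 3 + D ^+ 2 / n%:R).
Proof.
move=> rho0 n1 eta_rho hMA xr.
have n0 : (0 < n)%N by exact: ltnW.
have nR : 0 < n%:R :> R by rewrite ltr0n.
have h0 : 0 < D / n%:R by rewrite divr_gt0.
have MA0 : 0 <= MA by exact: le_trans (A_ge0 0) (hMA 0).
pose eta := D / n%:R ^+ 2; have eta0 : 0 < eta by rewrite divr_gt0// exprn_gt0.
(* This uses [1 < n]: the cut-off in [chi_cut] then acts at most on the singular charge. *)
have etah : eta <= D / n%:R / 2.
  rewrite /eta ler_pdivrMr ?exprn_gt0// (_ : D / n%:R / 2 * _ = D * (n%:R / 2)).
    by rewrite ler_pMr// ler_pdivlMr// mul1r ler_nat.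
  by field; rewrite lt0r_neq0.
have rho20 : 0 < rho ^+ 2 by rewrite exprn_gt0.
rewrite /chi_cut /chi_smooth opprD addrACA subrr add0r -sumrB.
apply: le_trans (ler_norm_sum _ _ _) _.
pose T (i : box n) := (D / n%:R) ^+ 3 * \prod_(k < 3) (Num.sqrt (b x i k))^-1.
have T0 i : 0 <= T i.
  apply: mulr_ge0; first by rewrite exprn_ge0// ltW.
  by apply: prodr_ge0 => k _; rewrite invr_ge0 sqrtr_ge0.
apply: (@le_trans _ _ (\sum_(i : box n) (MA * (Num.sqrt rho * T i) +
    (sing x i)%:R * (MA * (D ^+ 2 / n%:R))))).
  apply: ler_sum => i _.
  have -> : mass D A i / Num.max (enorm (x - Defs.center D i)) (D / n%:R ^+ 2) -
      mass D A i * psi (rho ^+ 2) (Defs.center D i) x =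
    mass D A i * ((Num.max (enorm (x - Defs.center D i)) eta)^-1 -
      psi (rho ^+ 2) (Defs.center D i) x) by rewrite /eta; ring.
  have m0 := mass_ge0 D0 A_ge0 i.
  have mle : mass D A i <= MA * (D / n%:R) ^+ 3.
    by rewrite /mass ler_wpM2r// exprn_ge0// ltW.
  rewrite normrM (ger0_norm m0).
  have p0 := psi_gt0 (Defs.center D i) x rho20.
  have [si|nsi] := boolP (sing x i).
    rewrite mul1r; apply: (@le_trans _ _ (MA * (D ^+ 2 / n%:R))); last first.
      by rewrite lerDr; apply: mulr_ge0 => //; apply: mulr_ge0; rewrite ?sqrtr_ge0.
    rewrite (_ : D ^+ 2 / n%:R = (D / n%:R) ^+ 3 * eta^-1); last first.
      by rewrite /eta; field; rewrite !lt0r_neq0.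
    rewrite mulrA; apply: ler_pM => //.
    have i1 : (Num.max (enorm (x - Defs.center D i)) eta)^-1 <= eta^-1.
      by rewrite lef_pV2 ?posrE// ?lt_max ?eta0 ?orbT// le_max lexx orbT.
    have i2 : psi (rho ^+ 2) (Defs.center D i) x <= eta^-1.
      rewrite lef_pV2 ?posrE ?rad_gt0 ?ltr_pwDl ?dotpp_ge0//.
      apply: le_trans eta_rho _; rewrite -[leLHS](gtr0_norm rho0) -sqrtr_sqr.
      by rewrite ler_sqrt ?lerDl ?dotpp_ge0// addr_ge0 ?sqr_ge0 ?dotpp_ge0.
    have i3 : 0 <= (Num.max (enorm (x - Defs.center D i)) eta)^-1.
      by rewrite invr_ge0 le_max (ltW eta0) orbT.
    by rewrite ler_norml; apply/andP; split; lra.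
  rewrite mul0r addr0 (_ : MA * (Num.sqrt rho * T i) = MA * (D / n%:R) ^+ 3 *
    (Num.sqrt rho * \prod_(k < 3) (Num.sqrt (b x i k))^-1)); last by rewrite /T; ring.
  apply: ler_pM => //.
  have rh : D / n%:R / 2 <= enorm (x - Defs.center D i).
    move: nsi; rewrite negb_forall => /existsP[k]; rewrite -leNgt => hk.
    apply: le_trans hk _; have := coord_le_enorm (x - Defs.center D i) k.
    by rewrite !mxE.
  have r0 : 0 < enorm (x - Defs.center D i).
    by apply: lt_le_trans rh; rewrite divr_gt0.
  have -> : Num.max (enorm (x - Defs.center D i)) eta = enorm (x - Defs.center D i).
    by apply/max_idPl; exact: le_trans rh.
  have := inv_diff_le rho0 r0.
  rewrite sqr_enorm -/(rad (rho ^+ 2) (Defs.center D i) x).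
  rewrite -/(psi (rho ^+ 2) (Defs.center D i) x) => /andP[d1 d2].
  rewrite ger0_norm//; apply: le_trans d2 _; apply: ler_wpM2l; first exact: sqrtr_ge0.
  rewrite -exprVn -[X in _ ^+ X](card_ord 3) -prodr_const.
  apply: ler_prod => k _; rewrite invr_ge0 sqrtr_ge0/=.
  have bk0 : 0 < b x i k by rewrite lt_max divr_gt0 ?orbT.
  have sb0 : 0 < Num.sqrt (b x i k) by rewrite sqrtr_gt0.
  have sr0 : 0 < Num.sqrt (enorm (x - Defs.center D i)) by rewrite sqrtr_gt0.
  rewrite lef_pV2 ?posrE// ler_sqrt ?(ltW r0)//.
  rewrite ge_max rh andbT; have := coord_le_enorm (x - Defs.center D i) k.
  by rewrite !mxE.
rewrite big_split/= -mulr_sumr -mulr_sumr -mulr_suml mulrDr; apply: lerD.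
  rewrite ler_wpM2l// ler_wpM2l ?sqrtr_ge0//; exact: sum_box_sqrt.
rewrite -[leRHS]mul1r; apply: ler_wpM2r.
  by apply: mulr_ge0 => //; rewrite divr_ge0 ?sqr_ge0.
have [i0 si0|none] := pickP (@sing n x).
  rewrite (bigD1 i0)//= si0 big1 ?addr0// => i ii0.
  by case: (boolP (sing x i)) => // si; rewrite (sing_unique n0 si si0) eqxx in ii0.
by rewrite big1// => i _; rewrite none.
Qed.

(** [rho] is fixed before [n]. The smoothed sum takes [e / 2] of the error, the smoothing of the
    regular charges [e / 4], and the singular charge [e / 4]. *)
Lemma chi_cut_cvg (r e : R) : 0 < e -> exists n0 : nat, forall n x, (n0 <= n)%N ->
  enorm x <= r -> `|chi_cut n x - chi x| <= e.
Proof.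
move=> e0; have [r0|r0] := ltrP r 0.
  by exists 0 => n x _ xr; have := enorm_ge0 x; lra.
have [MA MA0 hMA] := A_bounded D0 A_cont A_supp.
have e20 : 0 < e / 2 by rewrite divr_gt0.
have [rho0 rho00 hrho] := chi_smooth_compare D0 A_cont A_ge0 A_supp chiP e20.
pose C := MA * (8 * Num.sqrt (D + r)) ^+ 3.
have C0 : 0 <= C by rewrite mulr_ge0// exprn_ge0// mulr_ge0// sqrtr_ge0.
have C10 : 0 < 4 * (C + 1) by lra.
have d0 : 0 < e / (4 * (C + 1)) by rewrite divr_gt0.
pose rho := Num.min rho0 ((e / (4 * (C + 1))) ^+ 2).
have rhop : 0 < rho by rewrite lt_min rho00 exprn_gt0.
have [|n1 hn1] := hrho rho rhop; first by rewrite ge_min lexx.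
have [n2 hn2] := small_mesh D0 rhop.
have M10 : 0 < 4 * (MA + 1) * D by rewrite !mulr_gt0//; lra.
have e40 : 0 < e / (4 * (MA + 1) * D) by rewrite divr_gt0.
have [n3 hn3] := small_mesh D0 e40.
exists (maxn (maxn n1 n2) (maxn n3 2)) => n x.
rewrite !geq_max => /andP[/andP[nn1 nn2] /andP[nn3 n_gt1]] xr.
have [n0 hr] := hn2 n nn2; have [_ he] := hn3 n nn3.
have nR : 0 < n%:R :> R by rewrite ltr0n.
have n1R : 1 <= n%:R :> R by rewrite ler1n.
have eta_rho : D / n%:R ^+ 2 <= rho.
  apply: le_trans hr; rewrite expr2 invfM mulrA ler_pdivrMr//.
  by rewrite ler_peMr// divr_ge0 ?ltW.
have h1 := hn1 n x nn1.
have h2 := cut_smooth_le rhop n_gt1 eta_rho hMA xr.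
have h3 : MA * (Num.sqrt rho * (8 * Num.sqrt (D + r)) ^+ 3) <= e / 4.
  rewrite mulrCA -/C.
  have sr : Num.sqrt rho <= e / (4 * (C + 1)).
    rewrite -[leRHS](gtr0_norm d0) -sqrtr_sqr ler_sqrt ?sqr_ge0//.
    by rewrite ge_min lexx orbT.
  apply: (@le_trans _ _ (e / (4 * (C + 1)) * (C + 1))).
    by apply: ler_pM => //; rewrite ?sqrtr_ge0//; lra.
  by apply: eq_ler; field; lra.
have h4 : MA * (D ^+ 2 / n%:R) <= e / 4.
  apply: (@le_trans _ _ ((MA + 1) * (D * (e / (4 * (MA + 1) * D))))).
    apply: ler_pM => //; [by rewrite divr_ge0 ?sqr_ge0 ?ltW|lra|].
    by rewrite expr2 -mulrA ler_pM2l.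
  apply: eq_ler; field; rewrite (lt0r_neq0 D0)/=; lra.
rewrite -(subrKA (chi_smooth D A rho n x)).
apply: le_trans (ler_normD _ _) _; move: h2; rewrite mulrDr; lra.
Qed.

End desingularization.

(** * Length and distance *)

Section smooth_curves.
Context {R : realType}.
Implicit Types (c : R -> 'rV[R]_3) (f : 'rV[R]_3 -> R) (a b t : R).

Definition speed f c t : R := f (c t) ^+ 2 * enorm (derive1 c t).

Lemma enorm_speedE f c t :
  Num.sqrt ((derive1 c t *m conformal_metric f (c t) *m (derive1 c t)^T) 0 0)
  = speed f c t.
Proof.
rewrite /conformal_metric mul_mx_scalar -scalemxAl mxE.
have -> : (derive1 c t *m (derive1 c t)^T) 0 0 = dotp (derive1 c t) (derive1 c t).
  by rewrite mxE; apply: eq_bigr => k _; rewrite mxE.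
rewrite (_ : f (c t) ^+ 4 = (f (c t) ^+ 2) ^+ 2); last by ring.
by rewrite sqrtrM ?sqr_ge0// sqrtr_sqr ger0_norm ?sqr_ge0// -enormE.
Qed.

Lemma derivable_continuous (V : normedModType R) (c : R -> V) t :
  derivable c t 1 -> {for t, continuous c}.
Proof. by move=> /derivable1_diffP/differentiable_continuous. Qed.

Lemma smooth_curve_continuous c : smooth_curve c -> continuous c.
Proof. by move=> sc t; apply: derivable_continuous; exact: (sc 0%N). Qed.

Lemma smooth_curve_derive1 c : smooth_curve c -> smooth_curve (derive1 c).
Proof.
move=> sc n t; have -> : derive1n n (derive1 c) = derive1n n.+1 c.
  by rewrite /derive1n -iterSr.
exact: sc.
Qed.

Lemma speed_continuous f c : continuous f -> smooth_curve c ->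
  continuous (speed f c).
Proof.
move=> cf sc t.
have -> : speed f c = (fun s => f (c s) ^+ 2) * (fun s => enorm (derive1 c s)) by [].
apply: continuousM.
  apply: (@continuous_comp _ _ _ (f \o c) (fun y => y ^+ 2)).
    by apply: continuous_comp; [exact: smooth_curve_continuous|exact: cf].
  exact: exprn_continuous.
apply: (@continuous_comp _ _ _ (derive1 c) (@enorm R)).
  by apply: smooth_curve_continuous; exact: smooth_curve_derive1.
exact: enorm_continuous.
Qed.

Lemma speed_ge0 f c t : 0 <= speed f c t.
Proof. by rewrite mulr_ge0 ?sqr_ge0 ?enorm_ge0. Qed.

(** The integral starts at [a - 1] and is considered up to [b + 1], so that the derivative is
    two-sided at [a] and [b] as well. *)
Lemma primitive_exists (g : R -> R) a b : continuous g ->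
  exists G : R -> R, forall t, a <= t <= b -> is_derive t 1 G (g t).
Proof.
move=> cg; pose mu := @lebesgue_measure R.
exists (fun x => (\int[mu]_(t in [set` `[a - 1, x]]) g t)%R) => t /andP[at0 tb].
have tb1 : t < b + 1 by lra.
have gi : mu.-integrable `[a - 1, b + 1] (EFin \o g).
  apply: continuous_compact_integrable; first exact: segment_compact.
  exact: continuous_subspaceT.
have at1 : a - 1 < t by lra.
have [d1 d2] := continuous_FTC1_closed tb1 gi at1 (cg t).
by apply: DeriveDef => //; rewrite -d2 derive1E.
Qed.

Lemma derivable_affine (V : normedModType R) (c : R -> V) (k m t : R) :
  derivable c (k * t + m) 1 -> is_derive t 1 (fun s => c (k * s + m))
    (k *: derive1 c (k * t + m)).
Proof.
move=> dc.
have d1 : is_derive t 1 (fun s => k * s + m) k.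
  have := is_deriveD_fun (is_deriveZ_fun k (is_derive_id (t : R^o) 1))
    (is_derive_cst m (t : R^o) 1).
  by rewrite mulr1 addr0.
have /derivable1_diffP dth : derivable (fun s => k * s + m) t 1 by case: d1.
have /derivable1_diffP dc' := dc.
have dcomp := differentiable_comp dth dc'.
apply: DeriveDef; first by apply/derivable1_diffP.
rewrite -derive1E derive1E' // diff_comp //= -derive1E' //.
have -> : (fun s => k * s + m)^`()%classic t = k by rewrite derive1E; case: d1.
by rewrite diff1E.
Qed.

Lemma derive1n_affine c (k m : R) n : smooth_curve c ->
  derive1n n (fun s => c (k * s + m)) = fun s => k ^+ n *: derive1n n c (k * s + m).
Proof.
move=> sc; elim: n => [|n IH]; apply/funext => t; first by rewrite expr0 scale1r.
rewrite !derive1nS IH derive1E.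
have d := derivable_affine (sc n (k * t + m)).
have := @is_deriveZ _ _ _ _ (k ^+ n) _ _ _ d.
by move=> /@derive_val ->; rewrite scalerA exprSr.
Qed.

Lemma smooth_curve_affine c (k m : R) : smooth_curve c ->
  smooth_curve (fun s => c (k * s + m)).
Proof.
move=> sc n t; rewrite derive1n_affine//; apply: derivableZ.
by have [] := derivable_affine (sc n (k * t + m)).
Qed.

Lemma speed_affine f c (k m t : R) : smooth_curve c ->
  speed f (fun s => c (k * s + m)) t = `|k| * speed f c (k * t + m).
Proof.
move=> sc; rewrite /speed derive1E.
have [_ ->] := derivable_affine (sc 0%N (k * t + m)).
by rewrite enormZ; ring.
Qed.

Lemma derive1_line (x v : 'rV[R]_3) t : is_derive t 1 (fun s => x + s *: v) v.
Proof.
have dZ : is_derive t 1 (fun s : R => s *: v) v.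
  apply: DeriveDef; first by apply/derivable1_diffP.
  by rewrite deriveE//= diff_val /= scale1r.
have := @is_deriveD _ _ _ _ _ _ _ _ _ (is_derive_cst x t 1) dZ.
by rewrite add0r.
Qed.

Lemma smooth_curve_line (x v : 'rV[R]_3) : smooth_curve (fun s => x + s *: v).
Proof.
have d1 : derive1 (fun s => x + s *: v) = cst v.
  by apply/funext => s; rewrite derive1E; have [_ ->] := derive1_line x v s.
have dn n : derive1n n.+2 (fun s => x + s *: v) = cst 0.
  elim: n => [|n IH].
    rewrite derive1nS derive1n1 d1; apply/funext => s; exact: derive1_cst.
  by rewrite derive1nS IH; apply/funext => s; exact: derive1_cst.
move=> [|[|n]] t.
- by have [] := derive1_line x v t.
- by rewrite derive1n1 d1; exact: derivable_cst.
- by rewrite dn; exact: derivable_cst.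
Qed.

Lemma speed_line f (x v : 'rV[R]_3) t :
  speed f (fun s => x + s *: v) t = f (x + t *: v) ^+ 2 * enorm v.
Proof. by rewrite /speed derive1E; have [_ ->] := derive1_line x v t. Qed.

End smooth_curves.

(** * Length of piecewise smooth curves through primitives *)

Section path_length.
Context {R : realType}.
Implicit Types (gamma : R -> 'rV[R]_3) (f : 'rV[R]_3 -> R) (a b t L : R).

(** The length is the increment of a primitive of the speed of the smooth extension [c]; the
    derivative of [gamma] itself may be a dummy value at the end points. *)
Definition smooth_piece f gamma a b L : Prop :=
  exists (c : R -> 'rV[R]_3) (G : R -> R), [/\ a < b, smooth_curve c,
    forall t, a <= t <= b -> gamma t = c t,
    forall t, a <= t <= b -> is_derive t 1 G (speed f c t) & L = G b - G a].

(* [Len f gamma a b L]: on [[a, b]] the curve [gamma] is piecewise smooth, of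
   length [L] for the metric [f ^ 4 g_E]. *)
Inductive Len f gamma : R -> R -> R -> Prop :=
| Len_smooth a b L of smooth_piece f gamma a b L : Len f gamma a b L
| Len_cat a b c L L' of Len f gamma a b L & Len f gamma b c L' :
    Len f gamma a c (L + L').

Lemma Len_lt f gamma a b L : Len f gamma a b L -> a < b.
Proof.
elim=> [{}a {}b {}L [c [G []]]//|{}a {}b c {}L L' _ ab _ bc].
exact: lt_trans bc.
Qed.

Lemma Len_congr f gamma gamma' a b L : (forall t, a <= t <= b -> gamma t = gamma' t) ->
  Len f gamma a b L -> Len f gamma' a b L.
Proof.
move=> E H; elim: H E => [{}a {}b {}L [c [G [ab sc gc dG ->]]] E
    |{}a {}b c {}L L' l1 IH1 l2 IH2 E].
  apply: Len_smooth; exists c, G; split=> // t tab.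
  by rewrite -E// gc.
have ab := Len_lt l1; have bc := Len_lt l2.
apply: (Len_cat (b := b)).
- by apply: IH1 => t /andP[h1 h2]; apply: E; rewrite h1 (le_trans h2)// ltW.
- by apply: IH2 => t /andP[h1 h2]; apply: E; rewrite h2 andbT (le_trans _ h1)// ltW.
Qed.

Lemma primitive_le (G g : R -> R) a b : a <= b ->
  (forall t, a <= t <= b -> is_derive t 1 G (g t)) ->
  (forall t, a <= t <= b -> 0 <= g t) -> G a <= G b.
Proof.
move=> ab dG g0.
have Gc : {within `[a, b], continuous G}.
  apply: derivable_within_continuous => t; rewrite in_itv/= => /dG dGt.
  by case: dGt.
have dG' t : t \in `]a, b[%R -> is_derive t 1 G (g t).
  by rewrite in_itv/= => /andP[h1 h2]; apply: dG; rewrite !ltW.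
have [t tab E] := MVT_segment ab dG' Gc.
rewrite -subr_ge0 E mulr_ge0 ?subr_ge0//; apply: g0; move: tab.
by rewrite in_itv.
Qed.

(** Project on the unit vector [e] of the chord: by the Cauchy-Schwarz inequality
    [G t - m * dotp (c t) e] is nondecreasing. *)
Lemma piece_chord f (c : R -> 'rV[R]_3) (G : R -> R) a b (m : R) : 0 <= m -> a <= b ->
  smooth_curve c -> (forall t, a <= t <= b -> is_derive t 1 G (speed f c t)) ->
  (forall t, a <= t <= b -> m <= f (c t) ^+ 2) ->
  m * enorm (c b - c a) <= G b - G a.
Proof.
move=> m0 ab sc dG fm.
have [->|v0] := eqVneq (c b) (c a).
  rewrite subrr enorm0 mulr0 subr_ge0; apply: (primitive_le ab dG) => t _.
  exact: speed_ge0.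
set v := c b - c a; have vn : 0 < enorm v by rewrite enorm_gt0 subr_eq0.
pose e := (enorm v)^-1 *: v.
have e1 : enorm e = 1 by rewrite enormZ gtr0_norm ?invr_gt0// mulVf// gt_eqF.
have ev : dotp v e = enorm v.
  by rewrite dotpZr -sqr_enorm expr2 mulrA mulVf ?mul1r// gt_eqF.
pose H t := G t - m * dotp (c t) e.
have dH t : a <= t <= b -> is_derive t 1 H (speed f c t - m * dotp (derive1 c t) e).
  move=> tab; apply: is_deriveB_fun; first exact: dG.
  apply: is_deriveZ_fun.
  have dc := sc 0%N t.
  have dck k : is_derive t 1 (fun s => c s 0 k) (derive1 c t 0 k).
    rewrite derive1E (derive_mx dc) mxE; apply: derivableP.
    by have := (derivable_mxP _ _ _).1 dc 0 k.
  rewrite (_ : (fun s => dotp (c s) e) = fun s => \sum_(k < 3) (e 0 k * c s 0 k)).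
    rewrite (_ : dotp _ e = \sum_(k < 3) (e 0 k * derive1 c t 0 k)).
      apply: is_derive_sum_fun => k; exact: is_deriveZ_fun.
    by apply: eq_bigr => k _; rewrite mulrC.
  by apply/funext => s; apply: eq_bigr => k _; rewrite mulrC.
have : H a <= H b.
  apply: (primitive_le ab dH) => t tab; rewrite subr_ge0 /speed.
  apply: (@le_trans _ _ (m * enorm (derive1 c t))).
    apply: ler_wpM2l => //.
    by apply: le_trans (CauchySchwarz _ _) _; rewrite e1 mulr1.
  by rewrite ler_wpM2r ?enorm_ge0// fm.
rewrite /H -ev /v dotpDl dotpNl; lra.
Qed.

Lemma Len_ge0 f gamma a b L : Len f gamma a b L -> 0 <= L.
Proof.
elim=> [{}a {}b {}L [c [G [ab sc gc dG ->]]]|{}a {}b c {}L L' _ L0 _ L'0].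
  by rewrite subr_ge0; apply: (primitive_le (ltW ab) dG) => t _; exact: speed_ge0.
exact: addr_ge0.
Qed.

Lemma Len_chord f gamma a b L (m : R) : 0 <= m -> Len f gamma a b L ->
  (forall t, a <= t <= b -> m <= f (gamma t) ^+ 2) ->
  m * enorm (gamma b - gamma a) <= L.
Proof.
move=> m0 H; elim: H => [{}a {}b {}L [c [G [ab sc gc dG ->]]] fm
    |{}a {}b c {}L L' l1 IH1 l2 IH2 fm].
  rewrite !gc ?lexx ?(ltW ab)//; apply: piece_chord dG _ => //; first exact: ltW.
  by move=> t tab; rewrite -gc// fm.
have ab := Len_lt l1; have bc := Len_lt l2.
have h1 : m * enorm (gamma b - gamma a) <= L.
  by apply: IH1 => t /andP[h1 h2]; apply: fm; rewrite h1 (le_trans h2)// ltW.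
have h2 : m * enorm (gamma c - gamma b) <= L'.
  by apply: IH2 => t /andP[h1' h2]; apply: fm; rewrite h2 andbT (le_trans _ h1')// ltW.
have := ler_wpM2l m0 (ler_enormB (gamma c) (gamma b) (gamma a)); lra.
Qed.

Lemma Len_chord_sub f gamma a b L t : (forall x, 1 <= f x) ->
  Len f gamma a b L -> a <= t <= b -> enorm (gamma t - gamma a) <= L.
Proof.
move=> f1 H; have f2 x : 1 <= f x ^+ 2 by rewrite exprn_ege1.
elim: H t => [{}a {}b {}L [c [G [ab sc gc dG ->]]] t /andP[ta tb]
    |{}a {}b c {}L L' l1 IH1 l2 IH2 t /andP[ta tc]].
  rewrite !gc ?lexx ?(ltW ab) ?ta ?tb//.
  have sub u : a <= u <= t -> a <= u <= b.
    by move=> /andP[-> h]; exact: le_trans tb.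
  apply: (@le_trans _ _ (G t - G a)).
    rewrite -[leLHS]mul1r; apply: (piece_chord ler01 ta sc) => [u /sub|u _].
      exact: dG.
    exact: f2.
  rewrite lerD2r; apply: (primitive_le tb) => [u /andP[tu ub]|u _]; last exact: speed_ge0.
  by apply: dG; rewrite ub (le_trans ta).
have [tb|bt] := lerP t b.
  by apply: le_trans (IH1 _ _) _; rewrite ?ta// lerDl (Len_ge0 l2).
have h1 : enorm (gamma b - gamma a) <= L by apply: IH1; rewrite lexx (ltW (Len_lt l1)).
have h2 : enorm (gamma t - gamma b) <= L' by apply: IH2; rewrite tc ltW.
by apply: le_trans (ler_enormB _ (gamma b) _) _; rewrite addrC lerD.
Qed.

(** Intermediate value theorem for the primitive on the piece where the length [l] is reached;
    [0 < l < L] keeps both parts on nondegenerate intervals. *)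
Lemma Len_split f gamma a b L l : Len f gamma a b L -> 0 < l -> l < L ->
  exists t, Len f gamma a t l /\ Len f gamma t b (L - l).
Proof.
move=> H; elim: H l => [{}a {}b {}L [c [G [ab sc gc dG ->]]] l l0 lL
    |{}a {}b c {}L L' l1 IH1 l2 IH2 l l0 lL].
  have Gc : {within `[a, b], continuous G}.
    apply: derivable_within_continuous => t; rewrite in_itv/= => /dG dGt.
    by case: dGt.
  have [|t] := IVT (ltW ab) Gc (v := G a + l).
    by rewrite ge_min le_max; apply/andP; split; apply/orP; [left|right]; lra.
  rewrite in_itv/= => /andP[ta tb] Gt.
  have {}ta : a < t.
    rewrite lt_neqAle ta andbT; apply/eqP => E.
    by move: Gt; rewrite E; lra.
  have {}tb : t < b.
    rewrite lt_neqAle tb andbT; apply/eqP => E.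
    by move: lL; rewrite -E Gt; lra.
  exists t; split; apply: Len_smooth; exists c, G; split=> //; try lra.
  - by move=> u /andP[h1 h2]; apply: gc; rewrite h1 (le_trans h2)// ltW.
  - by move=> u /andP[h1 h2]; apply: dG; rewrite h1 (le_trans h2)// ltW.
  - by move=> u /andP[h1 h2]; apply: gc; rewrite h2 andbT (le_trans _ h1)// ltW.
  - by move=> u /andP[h1 h2]; apply: dG; rewrite h2 andbT (le_trans _ h1)// ltW.
have [lL1|lL1|->] := ltgtP l L.
- have [t [h1 h2]] := IH1 l l0 lL1; exists t; split=> //.
  by rewrite addrAC; exact: Len_cat h2 l2.
- have [||t [h1 h2]] := IH2 (l - L); [lra|lra|].
  exists t; split; last by rewrite (_ : L + L' - l = L' - (l - L))//; ring.
  by rewrite -(subrKC L l); exact: Len_cat l1 h1.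
- by exists b; split=> //; rewrite addrAC subrr add0r.
Qed.

Lemma Len_affine_pos f gamma a b L (k m : R) : 0 < k -> Len f gamma a b L ->
  Len f (fun s => gamma (k * s + m)) ((a - m) / k) ((b - m) / k) L.
Proof.
move=> k0; have kn0 := lt0r_neq0 k0.
have im u : k * ((u - m) / k) + m = u by rewrite mulrCA mulfV// mulr1 subrK.
elim=> [{}a {}b {}L [c [G [ab sc gc dG ->]]]|{}a {}b c {}L L' _ l1 _ l2]; last first.
  exact: (Len_cat l1 l2).
have inn t : (a - m) / k <= t <= (b - m) / k -> a <= k * t + m <= b.
  by rewrite ler_pdivrMr// ler_pdivlMr// lerBlDr lerBrDr (mulrC t).
apply: Len_smooth; exists (fun s => c (k * s + m)), (fun s => G (k * s + m)).
rewrite !im; split=> //.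
- by rewrite ltr_pM2r ?invr_gt0// ltrD2r.
- exact: smooth_curve_affine.
- by move=> t /inn /gc ->.
- move=> t /inn h; rewrite speed_affine// gtr0_norm//.
  have [dd dv] := dG _ h; rewrite -dv -derive1E; exact: derivable_affine.
Qed.

Lemma Len_reverse f gamma a b L (m : R) : Len f gamma a b L ->
  Len f (fun s => gamma (-1 * s + m)) (m - b) (m - a) L.
Proof.
have im u : -1 * (m - u) + m = u by ring.
elim=> [{}a {}b {}L [c [G [ab sc gc dG ->]]]|{}a {}b c {}L L' _ l1 _ l2]; last first.
  by rewrite (addrC L); exact: Len_cat l2 l1.
have inn t : m - b <= t <= m - a -> a <= -1 * t + m <= b.
  by move=> /andP[? ?]; apply/andP; split; lra.
apply: Len_smooth; exists (fun s => c (-1 * s + m)), (fun s => -1 * G (-1 * s + m)).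
rewrite !im; split; [by lra|exact: smooth_curve_affine| | |by ring].
- by move=> t /inn /gc ->.
- move=> t /inn h; rewrite speed_affine// normrN1 mul1r.
  have [dd dv] := dG _ h; have := is_deriveZ_fun (-1) (derivable_affine dd).
  by rewrite derive1E dv scaleRE mulrA mulrNN !mul1r.
Qed.

Lemma segment_length f x y (M : R) : continuous f ->
  (forall t, 0 <= t <= 1 -> f (x + t *: (y - x)) ^+ 2 <= M) ->
  exists2 L, Len f (fun s : R => x + s *: (y - x)) 0 1 L & L <= M * enorm (y - x).
Proof.
move=> cf fM; pose c := fun s : R => x + s *: (y - x).
have sc : smooth_curve c by exact: smooth_curve_line.
have [G hG] := primitive_exists 0 1 (speed_continuous cf sc).
exists (G 1 - G 0).
  by apply: Len_smooth; exists c, G; split=> //; exact: ltr01.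
pose H t := M * enorm (y - x) * t - G t.
have dH t : 0 <= t <= 1 -> is_derive t 1 H (M * enorm (y - x) * 1 - speed f c t).
  move=> t01; apply: is_deriveB_fun; last exact: hG.
have : H 0 <= H 1.
  apply: (primitive_le ler01 dH) => t t01; rewrite mulr1 subr_ge0 speed_line.
  by rewrite ler_wpM2r ?enorm_ge0// fM.
rewrite /H; lra.
Qed.

Lemma Len_exists f gamma a b (s : seq R) : continuous f -> s != [::] ->
  itv_partition a b s ->
  (forall i, (i < size s)%N -> exists c : R -> 'rV[R]_3, smooth_curve c /\
    forall t, nth 0 (a :: s) i <= t <= nth 0 (a :: s) i.+1 -> gamma t = c t) ->
  exists L, Len f gamma a b L.
Proof.
move=> cf; elim: s a => [//|u s IH] a _ sp hc.
have [c [sc gc]] := hc 0%N (ltn0Sn _).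
have au : a < u by case: sp => /= /andP[].
have [G hG] := primitive_exists a u (speed_continuous cf sc).
have l1 : Len f gamma a u (G u - G a).
  by apply: Len_smooth; exists c, G; split.
have sp' := itv_partition_cons sp.
have [s0|s0] := eqVneq s [::].
  by move: sp'; rewrite s0 => /itv_partition_nil <-; eexists; exact: l1.
have [|L l2] := IH u s0 sp'; last by eexists; exact: Len_cat l1 l2.
by move=> i si; exact: (hc i.+1).
Qed.

Lemma Len_partition f gamma a b L : Len f gamma a b L ->
  exists s : seq R, itv_partition a b s /\
  (forall i, (i < size s)%N -> exists c : R -> 'rV[R]_3, smooth_curve c /\
    forall t, nth 0 (a :: s) i <= t <= nth 0 (a :: s) i.+1 -> gamma t = c t).
Proof.
elim=> [{}a {}b {}L [c [G [ab sc gc _ _]]]|{}a {}b c {}L L' _ [s [s1 s2]] _ [s' [s1' s2']]].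
  by exists [:: b]; split; [exact: itv_partition1|case=> // _; exists c].
exists (s ++ s'); split; first exact: itv_partition_cat s1 s1'.
have lastb : nth 0 (a :: s) (size s) = b by exact: itv_partition_nth_size s1.
have nthE i : (size s <= i)%N -> nth 0 (a :: s ++ s') i = nth 0 (b :: s') (i - size s).
  rewrite leq_eqVlt => /orP[/eqP<-|si].
    by rewrite -cat_cons nth_cat /= ltnSn subnn.
  by rewrite -cat_cons nth_cat /= ltnNge si /= -(subnSK si).
move=> i; rewrite size_cat => si.
have [is_|si'] := ltnP i (size s).
  have [e [se he]] := s2 i is_; exists e; split=> // t; rewrite -cat_cons !nth_cat /=.
  by rewrite !ltnS is_ (ltnW is_); exact: he.
have [|e [se he]] := s2' (i - size s)%N; first by rewrite ltn_subLR.
exists e; split=> // t; rewrite !nthE// ?(leq_trans si')// subSn//.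
exact: he.
Qed.

End path_length.

(** * The distance induced by a conformal metric *)

Section riemannian_distance.
Context {R : realType}.
Implicit Types (gamma : R -> 'rV[R]_3) (f g : 'rV[R]_3 -> R) (S : set 'rV[R]_3)
  (x y z : 'rV[R]_3) (a b t L : R).
Let mu := @lebesgue_measure R.

Lemma curve_lengthE f gamma : curve_length (conformal_metric f) gamma =
  (\int[mu]_(t in `[0%R, 1%R]) (speed f gamma t)%:E)%E.
Proof. by apply: eq_integral => t _; rewrite enorm_speedE. Qed.

(** Only on the open interval: at a breakpoint [gamma] need not have the derivative of [c]. *)
Lemma speed_piece f gamma (c : R -> 'rV[R]_3) a b :
  (forall t, a <= t <= b -> gamma t = c t) ->
  {in `]a, b[, speed f gamma =1 speed f c}.
Proof.
move=> gc t; rewrite in_itv/= => /andP[ta tb].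
suff E : derive1 gamma t = derive1 c t by rewrite /speed E gc// (ltW ta) (ltW tb).
rewrite !derive1E; apply: near_eq_derive.
near=> s; apply: gc; apply/andP; split; apply: ltW; near: s.
  exact: lt_nbhsr.
exact: lt_nbhsl.
Unshelve. all: by end_near. Qed.

(** Fundamental theorem of calculus on each smooth piece, the end points being negligible; this
    identifies [Len] with the integral in [curve_length]. *)
Lemma Len_integral f gamma a b L : continuous f -> Len f gamma a b L ->
  measurable_fun `[a, b] (speed f gamma) /\
  (\int[mu]_(t in `[a, b]) (speed f gamma t)%:E = L%:E)%E.
Proof.
move=> cf; elim=> [{}a {}b {}L [c [G [ab sc gc dG ->]]]
    |{}a {}b c {}L L' l1 [m1 i1] l2 [m2 i2]].
  have E := speed_piece f gc; have cs := speed_continuous cf sc.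
  have mc : measurable_fun `]a, b[ (speed f c).
    by apply: measurable_funTS; exact: continuous_measurable_fun.
  have mg : measurable_fun `]a, b[ (speed f gamma).
    by apply: eq_measurable_fun mc => t; rewrite inE => tab; rewrite (E t tab).
  split; first exact: measurable_fun_itv_cc mg.
  rewrite (eq_integral_itv_bounded true false mg mc E) (continuous_FTC2 ab (F := G))//.
  - exact: continuous_subspaceT.
  - have cG t : a <= t <= b -> {for t, continuous G}.
      by move=> /dG[dd _]; exact: derivable_continuous.
    split=> [t||].
    + by rewrite in_itv/= => /andP[h1 h2]; case: (dG t) => //; rewrite !ltW.
    + by apply: cvg_at_right_filter; apply: cG; rewrite lexx ltW.
    + by apply: cvg_at_left_filter; apply: cG; rewrite lexx ltW.
  - move=> t; rewrite in_itv/= => /andP[h1 h2]; rewrite derive1E.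
    by case: (dG t) => //; rewrite !ltW.
have ab := Len_lt l1; have bc := Len_lt l2.
have U : `[a, c]%classic = `[a, b]%classic `|` `]b, c]%classic.
  by rewrite -itv_bndbnd_setU// bnd_simp ltW.
have m2' : measurable_fun `]b, c] (speed f gamma).
  by apply: measurable_funS m2 => //; apply: subset_itvr; rewrite bnd_simp.
have mU : measurable_fun (`[a, b]%classic `|` `]b, c]%classic) (speed f gamma).
  exact/measurable_funU.
split; first by rewrite U.
rewrite U integral_setU//=.
- rewrite i1 (integral_itv_obnd_cbnd (b := BRight c)) ?i2//.
  exact/measurable_EFinP.
- exact/measurable_EFinP.
- apply/disj_setPLR => t /=; rewrite !in_itv/= => /andP[_ tb].
  by move=> /andP[/lt_le_trans/(_ tb)]; rewrite ltxx.
Qed.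

Definition joins S f x y gamma L : Prop :=
  [/\ Len f gamma 0 1 L, gamma 0 = x, gamma 1 = y
    & forall t, 0 <= t <= 1 -> S (gamma t)].

Lemma Len_piecewise_smooth f gamma L : Len f gamma 0 1 L -> piecewise_smooth gamma.
Proof. exact: Len_partition. Qed.

Lemma piecewise_smooth_Len f gamma : continuous f -> piecewise_smooth gamma ->
  exists L, Len f gamma 0 1 L.
Proof.
move=> cf [s [s1 s2]]; apply: (Len_exists cf _ s1 s2).
by apply/eqP => s0; move: s1; rewrite s0 => /itv_partition_nil/eqP; rewrite eq_sym oner_eq0.
Qed.

Notation rd S f := (riem_dist S (conformal_metric f)).

Lemma riem_dist_le S f x y gamma L : continuous f -> joins S f x y gamma L ->
  (rd S f x y <= L%:E)%E.
Proof.
move=> cf [l g0 g1 gS]; apply: ereal_inf_lbound; exists gamma.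
  by split=> //; exact: Len_piecewise_smooth l.
by rewrite curve_lengthE; case: (Len_integral cf l).
Qed.

Lemma riem_dist_ge S f x y (l : \bar R) : continuous f ->
  (forall gamma L, joins S f x y gamma L -> (l <= L%:E)%E) -> (l <= rd S f x y)%E.
Proof.
move=> cf h; apply: le_ereal_inf_tmp => _ [gamma [pg g0 g1 gS] <-].
have [L lL] := piecewise_smooth_Len cf pg.
rewrite curve_lengthE; have [_ ->] := Len_integral cf lL.
by apply: (h gamma L); split.
Qed.

Lemma riem_dist_ge0 S f x y : continuous f -> (0 <= rd S f x y)%E.
Proof.
by move=> cf; apply: riem_dist_ge => // gamma L [/Len_ge0 L0 _ _ _]; rewrite lee_fin.
Qed.

Lemma riem_dist_approx S f x y (e : R) : continuous f -> 0 < e ->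
  rd S f x y \is a fin_num ->
  exists gamma L, joins S f x y gamma L /\ L <= fine (rd S f x y) + e.
Proof.
move=> cf e0 dfin.
have [_ [gamma [pg g0 g1 gS] <-]] := lb_ereal_inf_adherent e0 dfin.
have [L lL] := piecewise_smooth_Len cf pg.
rewrite curve_lengthE; have [_ ->] := Len_integral cf lL => hL.
exists gamma, L; split=> //; rewrite -lee_fin EFinD fineK//; exact: ltW.
Qed.

Lemma riem_dist_fin S f x y gamma L : continuous f -> joins S f x y gamma L ->
  rd S f x y \is a fin_num.
Proof.
move=> cf j; rewrite ge0_fin_numE ?riem_dist_ge0//.
by apply: le_lt_trans (riem_dist_le cf j) _; rewrite ltry.
Qed.

(** Curves inside [S] see the conformal factor on [S] only. This is what allows replacing [chi_n],
    singular at the centres, by a continuous function. *)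
Lemma riem_dist_eq S f g : (forall x, S x -> f x = g x) -> rd S f = rd S g.
Proof.
move=> fg; apply/funext => x; apply/funext => y.
have E gamma : (forall t, 0 <= t <= 1 -> S (gamma t)) ->
    curve_length (conformal_metric f) gamma = curve_length (conformal_metric g) gamma.
  move=> gS; rewrite !curve_lengthE; apply: eq_integral => t.
  by rewrite inE/= in_itv/= => t01; rewrite /speed (fg _ (gS t t01)).
apply: (congr1 (@ereal_inf R)); apply/seteqP.
split=> _ [gamma h <-]; (exists gamma; first exact: h); case: h => _ _ _ gS.
  exact: esym (E _ gS).
exact: E _ gS.
Qed.

Lemma joins_sym S f x y gamma L : joins S f x y gamma L ->
  joins S f y x (fun s => gamma (-1 * s + 1)) L.
Proof.
move=> [l g0 g1 gS]; split.
- by have := Len_reverse 1 l; rewrite subrr subr0.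
- by rewrite mulr0 add0r.
- by rewrite mulN1r addNr.
- by move=> t /andP[t0 t1]; apply: gS; apply/andP; split; lra.
Qed.

Lemma joins_trans S f x y z gamma gamma' L L' : joins S f x y gamma L ->
  joins S f y z gamma' L' -> exists gamma'', joins S f x z gamma'' (L + L').
Proof.
move=> [l g0 g1 gS] [l' g0' g1' gS'].
exists (fun s => if s <= 2^-1 then gamma (2 * s + 0) else gamma' (2 * s + (-1))).
have two0 : 0 < 2 :> R by [].
split.
- apply: (Len_cat (b := 2^-1)).
    have := Len_affine_pos 0 two0 l; rewrite subr0 mul0r subr0 mul1r.
    by apply: Len_congr => t /andP[_ ->].
  have := Len_affine_pos (-1) two0 l'; rewrite sub0r opprK mul1r.
  rewrite (_ : (1 + 1) / 2 = 1 :> R); last by field.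
  apply: Len_congr => t /andP[t2 _]; case: ifPn => // tt.
  have -> : t = 2^-1 by apply/eqP; rewrite eq_le tt.
  by rewrite addr0 mulfV// subrr g1.
- by rewrite invr_ge0 ler0n mulr0 addr0.
- have -> : (1 <= 2^-1 :> R) = false by apply/negP; lra.
  by rewrite (_ : 2 * 1 + -1 = 1 :> R); last by ring.
- move=> t /andP[t0 t1]; case: ifPn => [th|]; last rewrite -ltNge => th.
    by apply: gS; apply/andP; split; lra.
  by apply: gS'; apply/andP; split; lra.
Qed.

Lemma riem_dist_sym S f x y : continuous f -> rd S f x y = rd S f y x.
Proof.
move=> cf; apply/eqP; rewrite eq_le; apply/andP.
by split; apply: riem_dist_ge => // gamma L /joins_sym j; exact: riem_dist_le j.
Qed.

Lemma riem_dist_triangle S f x y z : continuous f ->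
  rd S f x y \is a fin_num -> rd S f y z \is a fin_num ->
  rd S f x z \is a fin_num /\
  fine (rd S f x z) <= fine (rd S f x y) + fine (rd S f y z).
Proof.
move=> cf fxy fyz.
have fxz : rd S f x z \is a fin_num.
  have [g1 [L1 [j1 _]]] := riem_dist_approx cf ltr01 fxy.
  have [g2 [L2 [j2 _]]] := riem_dist_approx cf ltr01 fyz.
  by have [g3 j3] := joins_trans j1 j2; exact: riem_dist_fin cf j3.
split=> //; apply/ler_addgt0Pr => e e0; have e20 : 0 < e / 2 by rewrite divr_gt0.
have [g1 [L1 [j1 h1]]] := riem_dist_approx cf e20 fxy.
have [g2 [L2 [j2 h2]]] := riem_dist_approx cf e20 fyz.
have [g3 j3] := joins_trans j1 j2.
have := riem_dist_le cf j3; rewrite -(fineK fxz) lee_fin; lra.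
Qed.

Lemma riem_dist_ge_enorm S f x y : continuous f -> (forall x, 1 <= f x) ->
  ((enorm (y - x))%:E <= rd S f x y)%E.
Proof.
move=> cf f1; apply: riem_dist_ge => // gamma L [l <- <- _]; rewrite lee_fin.
rewrite -[leLHS]mul1r; apply: (Len_chord ler01 l) => t _.
by rewrite exprn_ege1.
Qed.

Lemma riem_dist_eq0 S f x y : continuous f -> (forall z, 1 <= f z) ->
  riem_dist S (conformal_metric f) x y = 0%E -> x = y.
Proof.
move=> cf f1 xy; have := riem_dist_ge_enorm S x y cf f1; rewrite xy lee_fin => h.
by apply/eqP; rewrite eq_sym -subr_eq0 -enorm_eq0 eq_le h enorm_ge0.
Qed.

Lemma riem_dist_segment S f x y (M : R) : continuous f ->
  (forall t, 0 <= t <= 1 -> S (x + t *: (y - x)) /\ f (x + t *: (y - x)) ^+ 2 <= M) ->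
  rd S f x y \is a fin_num /\ fine (rd S f x y) <= M * enorm (y - x).
Proof.
move=> cf h.
have [L l lM] := segment_length cf (fun t t01 => proj2 (h t t01)).
have j : joins S f x y (fun s => x + s *: (y - x)) L.
  split=> //; [by rewrite scale0r addr0|by rewrite scale1r subrKC|].
  by move=> t /h[].
have fxy := riem_dist_fin cf j; split=> //.
by apply: le_trans lM; have := riem_dist_le cf j; rewrite -(fineK fxy) lee_fin.
Qed.

Lemma riem_distxx S f x : continuous f -> S x -> rd S f x x = 0%E.
Proof.
move=> cf Sx; have [|h1 h2] := @riem_dist_segment S f x x (f x ^+ 2) cf.
  by move=> t _; rewrite subrr scaler0 addr0.
rewrite -(fineK h1); congr EFin; apply/eqP; rewrite eq_le.
move: h2; rewrite subrr enorm0 mulr0 => ->/=.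
by rewrite fine_ge0// riem_dist_ge0.
Qed.

End riemannian_distance.

Notation rdist S f x y := (fine (riem_dist S (conformal_metric f) x y)).

(** * Perforated balls *)

Section perforated_ball.
Context {R : realType} {I : finType}.
Variables (act : pred I) (p : I -> 'rV[R]_3) (r h eta : R).
Hypotheses (eta0 : 0 < eta) (eta_h : 16 * eta <= h)
  (sep : forall i j, act i -> act j -> i != j -> h <= enorm (p i - p j))
  (inside : forall i x, act i -> enorm (x - p i) < h -> enorm x < r).
Implicit Types (x y z w u v e : 'rV[R]_3) (f g : 'rV[R]_3 -> R).

(** [U_nR] in abstract form: of the lattice of centres only the separation [sep] and the room
    [inside] up to the boundary of the ball are kept. *)
Definition perforated : set 'rV[R]_3 :=
  [set x | enorm x < r /\ forall i, act i -> eta <= enorm (x - p i)].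

Lemma eball0E : eball 0 r = [set x : 'rV[R]_3 | enorm x < r].
Proof. by apply/seteqP; split=> x; rewrite /eball /= subr0. Qed.

Lemma perforated_sub : perforated `<=` eball 0 r.
Proof. by rewrite eball0E => x []. Qed.

Lemma enorm_segment x y t : enorm x < r -> enorm y < r -> 0 <= t <= 1 ->
  enorm (x + t *: (y - x)) < r.
Proof.
move=> xr yr /andP[t0 t1].
have -> : x + t *: (y - x) = (1 - t) *: x + t *: y.
  by rewrite scalerBr scalerBl scale1r addrA addrAC.
apply: le_lt_trans (ler_enormD _ _) _; rewrite !enormZ !ger0_norm ?subr_ge0//.
have [->|tn1] := eqVneq t 1; first by rewrite subrr mul0r mul1r add0r.
have t1' : 0 < 1 - t by rewrite subr_gt0 lt_neqAle tn1.
have : (1 - t) * enorm x < (1 - t) * r by rewrite ltr_pM2l.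
have : t * enorm y <= t * r by rewrite ler_wpM2l// ltW.
lra.
Qed.

Lemma perforated_near i x : act i -> eta <= enorm (x - p i) ->
  enorm (x - p i) <= h - eta -> perforated x.
Proof.
move=> ai xi xh; split.
  by apply: (inside ai); have := eta0; lra.
move=> j aj; have [->//|ji] := eqVneq j i.
have ij : i != j by rewrite eq_sym.
have := ler_enormB (p i) x (p j); rewrite (enormB (p i) x).
have := sep ai aj ij; lra.
Qed.

Lemma unit_vector : exists e : 'rV[R]_3, enorm e = 1.
Proof.
exists (delta_mx 0 0).
by rewrite enormE dotp_delta mxE !eqxx sqrtr1.
Qed.

(** A point in a hole is pushed radially onto the sphere bounding it, the centre itself in an
    arbitrary direction. The other holes are too far away to be entered. *)
Lemma perforated_proj x : enorm x < r ->
  exists2 x', perforated x' & enorm (x' - x) <= eta.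
Proof.
move=> xr; have [[i [ai xi]]|out] := pselect (exists i, act i /\ enorm (x - p i) < eta);
  last first.
  exists x; last by rewrite subrr enorm0 ltW.
  by split=> // i ai; rewrite leNgt; apply/negP => xi; apply: out; exists i.
have [e e1 ex] : exists2 e, enorm e = 1 & x - p i = enorm (x - p i) *: e.
  have [x0|x0] := eqVneq (x - p i) 0.
    have [e e1] := unit_vector; exists e => //.
    by rewrite x0 enorm0 scale0r.
  have n0 : enorm (x - p i) != 0 by rewrite enorm_eq0.
  exists ((enorm (x - p i))^-1 *: (x - p i)).
    by rewrite enormZ ger0_norm ?invr_ge0 ?enorm_ge0// mulVf.
  by rewrite scalerA mulfV// scale1r.
have E : (p i + eta *: e) - p i = eta *: e by rewrite addrAC subrr add0r.
exists (p i + eta *: e).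
  apply: (perforated_near ai); rewrite E enormZ e1 mulr1 gtr0_norm//.
  have := eta0; have := eta_h; lra.
have -> : p i + eta *: e - x = (eta - enorm (x - p i)) *: e.
  by rewrite scalerBl -ex opprB addrCA addrA.
rewrite enormZ e1 mulr1 ger0_norm; first by rewrite gerBl enorm_ge0.
by rewrite subr_ge0 ltW.
Qed.

(** Up to sign, a quarter turn of the first two coordinates of [v], or a coordinate vector when
    these vanish. *)
Lemma orthogonal_unit v z : exists e, [/\ enorm e = 1, dotp v e = 0 & 0 <= dotp z e].
Proof.
suff [e e1 ve] : exists2 e, enorm e = 1 & dotp v e = 0.
  have [ze|ze] := lerP 0 (dotp z e); first by exists e.
  by exists (- e); rewrite enormN !dotpNr ve oppr0 oppr_ge0 (ltW ze).
have [v0|v0] := eqVneq (v 0 0 ^+ 2 + v 0 1 ^+ 2) 0.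
  exists (delta_mx 0 0); first by rewrite enormE dotp_delta mxE !eqxx sqrtr1.
  rewrite dotp_delta; apply/eqP; rewrite -sqrf_eq0; apply/eqP.
  have := sqr_ge0 (v 0 0); have := sqr_ge0 (v 0 1); lra.
pose u : 'rV[R]_3 := - v 0 1 *: delta_mx 0 0 + v 0 0 *: delta_mx 0 1.
have uu : dotp u u = v 0 0 ^+ 2 + v 0 1 ^+ 2.
  by rewrite dotpE !mxE /=; ring.
have u0 : enorm u != 0 by rewrite -sqrf_eq0 sqr_enorm uu.
exists ((enorm u)^-1 *: u).
  by rewrite enormZ ger0_norm ?invr_ge0 ?enorm_ge0// mulVf.
rewrite dotpZr; apply/eqP; rewrite mulf_eq0; apply/orP; right; apply/eqP.
by rewrite dotpE !mxE /=; ring.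
Qed.

Lemma enorm_shift_ge (s : R) u e : enorm e = 1 -> 0 <= s -> 0 <= dotp u e ->
  enorm u ^+ 2 + s ^+ 2 <= enorm (u + s *: e) ^+ 2.
Proof.
move=> e1 s0 ue; rewrite !sqr_enorm dotpDl !dotpDr !dotpZl !dotpZr (dotpC e u).
have -> : dotp e e = 1 by rewrite -sqr_enorm e1 expr1n.
have := mulr_ge0 s0 ue; rewrite expr2; lra.
Qed.

(* Shifting the whole segment by [eta] in a direction [e] orthogonal to it and
   pointing away from the only hole that it meets clears that hole. *)
Lemma perforated_detour g z w (M : R) : continuous g -> perforated z -> perforated w ->
  enorm (w - z) <= h / 4 ->
  (forall y, perforated y -> enorm (y - z) <= h / 2 -> g y ^+ 2 <= M) ->
  riem_dist perforated (conformal_metric g) z w \is a fin_num /\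
  rdist perforated g z w <= M * (enorm (w - z) + 2 * eta).
Proof.
move=> cg zP wP zw gM.
have [e00 eh] := (eta0, eta_h).
have M0 : 0 <= M.
  apply: le_trans (gM z zP _); first exact: sqr_ge0.
  by rewrite subrr enorm0; lra.
have seg_norm t : 0 <= t <= 1 -> enorm (t *: (w - z)) <= enorm (w - z).
  by move=> /andP[t0 t1]; rewrite enormZ ger0_norm// ler_piMl ?enorm_ge0.
have [segP|] := pselect (forall t, 0 <= t <= 1 -> perforated (z + t *: (w - z))).
  have [|h1 h2] := @riem_dist_segment R perforated g z w M cg.
    move=> t t01; split; first exact: segP.
    apply: gM; first exact: segP.
    by rewrite addrAC subrr add0r (le_trans (seg_norm t t01))//; lra.
  split=> //; apply: le_trans h2 _.
  by rewrite ler_wpM2l// lerDl; lra.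
move=> /existsNP[t /not_implyP[t01 nP]].
pose y := z + t *: (w - z).
have yr : enorm y < r by apply: enorm_segment => //; [case: zP|case: wP].
have [i [ai yi]] : exists i, act i /\ enorm (y - p i) < eta.
  apply: contrapT => no; apply: nP; split=> // i ai.
  by rewrite leNgt; apply/negP => yi; apply: no; exists i.
have [e [e1 ve ze]] := orthogonal_unit (w - z) (z - p i).
(* One statement for the three legs of the detour: on the first and third [s] is 0 or 1 and the
   bound holds because [z] and [w] avoid the hole, on the second because [tau] is [eta]. *)
have clear s tau : 0 <= s <= 1 -> 0 <= tau <= eta ->
    eta ^+ 2 <= enorm (z + s *: (w - z) - p i) ^+ 2 + tau ^+ 2 ->
    perforated (z + s *: (w - z) + tau *: e) /\
    enorm (z + s *: (w - z) + tau *: e - z) <= h / 2.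
  move=> s01 /andP[t0 t1] hs.
  have ntau : enorm (tau *: e) <= eta by rewrite enormZ e1 mulr1 ger0_norm.
  have nz : enorm (z + s *: (w - z) + tau *: e - z) <= h / 4 + eta.
    rewrite (_ : _ - z = s *: (w - z) + tau *: e); last first.
      by rewrite (addrC _ (- z)) !addrA addNr add0r.
    by apply: le_trans (ler_enormD _ _) _; have := seg_norm s s01; lra.
  split; last lra.
  have zy : enorm (z - y) <= h / 4.
    rewrite /y opprD addNKr enormN; exact: le_trans (seg_norm t t01) zw.
  apply: (perforated_near ai).
    rewrite -ler_sqr ?nnegrE ?enorm_ge0 ?(ltW e00)//.
    rewrite addrAC; apply: le_trans hs _; apply: enorm_shift_ge => //.
    have -> : z + s *: (w - z) - p i = (z - p i) + s *: (w - z) by rewrite addrAC.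
    by rewrite dotpDl dotpZl ve mulr0 addr0.
  apply: le_trans (ler_enormB _ z _) _.
  have := ler_enormB z y (p i); lra.
have etasq : eta ^+ 2 <= enorm (z - p i) ^+ 2.
  by rewrite lerXn2r ?nnegrE ?enorm_ge0 ?(ltW e00)//; apply: (proj2 zP).
have etasq' : eta ^+ 2 <= enorm (w - p i) ^+ 2.
  by rewrite lerXn2r ?nnegrE ?enorm_ge0 ?(ltW e00)//; apply: (proj2 wP).
have dir a s tau : a + s *: (tau *: e) - a = (s * tau) *: e.
  by rewrite addrAC subrr add0r scalerA.
have in01 s : 0 <= s <= 1 -> 0 <= s * eta <= eta.
  move=> /andP[s0 s1]; rewrite mulr_ge0 ?(ltW e00)//= ger_pMl//.
have [|f1 l1] := @riem_dist_segment R perforated g z (z + eta *: e) M cg.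
  move=> s s01; have -> : z + s *: (z + eta *: e - z) = z + 0 *: (w - z) + (s * eta) *: e.
    by rewrite (addrAC z) subrr add0r scale0r addr0 scalerA.
  have [|||c1 c2] := @clear 0 (s * eta); [by rewrite lexx ler01|exact: in01| |].
    by rewrite scale0r addr0 (le_trans etasq)// lerDl sqr_ge0.
  by split=> //; exact: gM.
have [|f2 l2] := @riem_dist_segment R perforated g (z + eta *: e) (w + eta *: e) M cg.
  move=> s s01; have -> : z + eta *: e + s *: (w + eta *: e - (z + eta *: e)) =
      z + s *: (w - z) + eta *: e.
    by rewrite opprD addrACA subrr addr0 addrAC.
  have [|||c1 c2] := @clear s eta; [by []|by rewrite lexx ltW| |].
    by rewrite lerDr sqr_ge0.
  by split=> //; exact: gM.
have [|f3 l3] := @riem_dist_segment R perforated g (w + eta *: e) w M cg.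
  move=> s s01; have -> : w + eta *: e + s *: (w - (w + eta *: e)) =
      z + 1 *: (w - z) + ((1 - s) * eta) *: e.
    rewrite scale1r subrKC opprD addNKr scalerN scalerA -addrA -scalerBl.
    by congr (_ + _ *: _); ring.
  have [|||c1 c2] := @clear 1 ((1 - s) * eta).
  - by rewrite lexx ler01.
  - by apply: in01; case/andP: s01 => ? ?; apply/andP; split; lra.
  - by rewrite scale1r subrKC (le_trans etasq')// lerDl sqr_ge0.
  - by split=> //; exact: gM.
have [f12 l12] := riem_dist_triangle cg f1 f2.
have [f13 l13] := riem_dist_triangle cg f12 f3.
split=> //; apply: le_trans l13 _.
have E1 : enorm (z + eta *: e - z) = eta.
  by rewrite addrAC subrr add0r enormZ e1 mulr1 gtr0_norm.
have E2 : enorm (w + eta *: e - (z + eta *: e)) = enorm (w - z).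
  by rewrite opprD addrACA subrr addr0.
have E3 : enorm (w - (w + eta *: e)) = eta.
  by rewrite opprD addNKr enormN enormZ e1 mulr1 gtr0_norm.
move: l1 l2 l3; rewrite E1 E2 E3; lra.
Qed.

End perforated_ball.

(** * Distances with and without holes *)

Section distance_comparison.
Context {R : realType}.

Lemma Len_compare (f g : 'rV[R]_3 -> R) (gamma : R -> 'rV[R]_3) (a b L k : R) :
  continuous f -> Len g gamma a b L ->
  (forall t, a <= t <= b -> f (gamma t) ^+ 2 <= k * g (gamma t) ^+ 2) ->
  exists2 L', Len f gamma a b L' & L' <= k * L.
Proof.
move=> cf; elim=> [{}a {}b {}L [c [G [ab sc gc dG ->]]] fg
    |{}a {}b c {}L L' l1 IH1 l2 IH2 fg].
  have [F dF] := primitive_exists a b (speed_continuous cf sc).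
  exists (F b - F a); first by apply: Len_smooth; exists c, F; split.
  pose H t := k * G t - F t.
  have dH t : a <= t <= b -> is_derive t 1 H (k * speed g c t - speed f c t).
    move=> tab; apply: is_deriveB_fun; last exact: dF.
    by apply: is_deriveZ_fun; exact: dG.
  have : H a <= H b.
    apply: (primitive_le (ltW ab) dH) => t tab.
    rewrite /speed mulrA -mulrBl mulr_ge0 ?enorm_ge0// subr_ge0 -gc//.
    exact: fg.
  rewrite /H; lra.
have ab := Len_lt l1; have bc := Len_lt l2.
have [|L1 h1 h1'] := IH1.
  by move=> t /andP[h1 h2]; apply: fg; rewrite h1 (le_trans h2)// ltW.
have [|L2 h2 h2'] := IH2.
  by move=> t /andP[t1 t2]; apply: fg; rewrite t2 andbT (le_trans _ t1)// ltW.
by exists (L1 + L2); [exact: Len_cat h1 h2|lra].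
Qed.

(** Since [om <= 1 / 4], the factor [(1 + om) ^+ 2] is at most [1 + 3 * om], and [dg <= Lm + E]
    turns the multiplicative bound into an additive one. *)
Lemma dist_arith (dg df Lm E om : R) : 0 <= om -> om <= 4^-1 -> 0 <= E ->
  0 <= df -> 0 <= dg -> df <= Lm - 1 -> dg <= df + E -> df <= (1 + om) ^+ 2 * dg ->
  `|dg - df| <= E + 3 * om * (Lm + E).
Proof.
move=> om0 om1 E0 df0 dg0 dfL dgE dfg.
have oE : 0 <= om * (Lm + E) by rewrite mulr_ge0//; lra.
have s1 : (1 + om) ^+ 2 * dg <= (1 + 3 * om) * dg.
  rewrite ler_wpM2r// (_ : (1 + om) ^+ 2 = 1 + 2 * om + om * om); last by ring.
  have := ler_wpM2l om0 om1; lra.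
have s2 : om * dg <= om * (Lm + E) by rewrite ler_wpM2l//; lra.
by rewrite ler_norml; apply/andP; split; lra.
Qed.

Context {I : finType}.
Variables (act : pred I) (p : I -> 'rV[R]_3) (r h eta : R).
Hypotheses (eta0 : 0 < eta) (eta_h : 16 * eta <= h)
  (sep : forall i j, act i -> act j -> i != j -> h <= enorm (p i - p j))
  (inside : forall i x, act i -> enorm (x - p i) < h -> enorm x < r).
Variables (f g : 'rV[R]_3 -> R) (om K : R).
Hypotheses (cf : continuous f) (cg : continuous g) (f1 : forall x, 1 <= f x)
  (g1 : forall x, 1 <= g x) (om0 : 0 <= om) (om1 : om <= 4^-1)
  (fg : forall x, enorm x < r -> `|g x - f x| <= om)
  (fK : forall x, enorm x < r -> f x <= K)
  (fu : forall x y, enorm x < r -> enorm y < r -> enorm (y - x) <= h ->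
    `|f y - f x| <= om).

Let U := perforated act p r eta.

Let sub_ball x : eball 0 r x -> enorm x < r.
Proof. by rewrite eball0E. Qed.

(** Induction on the number of pieces of length [h / 16]. A chord, lengthened by the displacement
    [2 * eta <= h / 8] of its end points, stays below the [h / 4] allowed by [perforated_detour].
    Each piece costs [4 * eta] in Euclidean length: half for the end points, half for the detour. *)
Lemma Len_lift (gamma : R -> 'rV[R]_3) (N : nat) (a b L : R) x y :
  Len f gamma a b L -> (forall t, a <= t <= b -> enorm (gamma t) < r) ->
  L <= N.+1%:R * (h / 16) -> U x -> U y ->
  enorm (x - gamma a) <= eta -> enorm (y - gamma b) <= eta ->
  riem_dist U (conformal_metric g) x y \is a fin_num /\
  rdist U g x y <= (1 + 16 * om) * L + N.+1%:R * (4 * (K + 1) ^+ 2 * eta).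
Proof.
have [e0 eh] := (eta0, eta_h); have [w0 w1] := (om0, om1).
have h0 : 0 < h by lra.
have single a2 b2 L2 x2 y2 : Len f gamma a2 b2 L2 ->
    (forall t, a2 <= t <= b2 -> enorm (gamma t) < r) -> L2 <= h / 16 ->
    U x2 -> U y2 -> enorm (x2 - gamma a2) <= eta -> enorm (y2 - gamma b2) <= eta ->
    riem_dist U (conformal_metric g) x2 y2 \is a fin_num /\
    rdist U g x2 y2 <= (1 + 16 * om) * L2 + 4 * (K + 1) ^+ 2 * eta.
  move=> l gr Lh Ux Uy xa yb; have ab := Len_lt l.
  have ain : a2 <= a2 <= b2 by rewrite lexx ltW.
  have bin : a2 <= b2 <= b2 by rewrite lexx ltW.
  have ar := gr _ ain.
  set F := f (gamma a2).
  have F1 : 1 <= F by exact: f1.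
  have FK : F <= K by exact: fK.
  have chord : enorm (gamma b2 - gamma a2) <= L2 by exact: Len_chord_sub l bin.
  have dist : enorm (y2 - x2) <= enorm (gamma b2 - gamma a2) + 2 * eta.
    have := ler_enormB y2 (gamma b2) x2; have := ler_enormB (gamma b2) (gamma a2) x2.
    rewrite (enormB (gamma a2) x2); lra.
  (* Within [h] of [gamma a2], [f] is within [om] of [F] and [g] within [om] of [f]: hence the upper
     bound [F + 2 * om] for [g] here and the lower bound [F - om] for [f] below. *)
  have [||fin dle] := @perforated_detour _ _ act p r h eta eta0 eta_h sep inside
      g x2 y2 ((F + 2 * om) ^+ 2) cg Ux Uy.
  - lra.
  - move=> z Uz zx; have zr := proj1 Uz.
    have za : enorm (z - gamma a2) <= h.
      have := ler_enormB z x2 (gamma a2); lra.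
    apply: lerXn2r; rewrite ?nnegrE; [exact: le_trans (g1 z)|lra|].
    have := fu ar zr za; have := fg zr; rewrite -/F !ler_norml.
    by move=> /andP[? ?] /andP[? ?]; lra.
  split=> //; apply: le_trans dle _.
  have low : (F - om) ^+ 2 * enorm (gamma b2 - gamma a2) <= L2.
    apply: (Len_chord _ l); first exact: sqr_ge0.
    move=> t tab; have tr := gr t tab.
    apply: lerXn2r; rewrite ?nnegrE; [lra|exact: le_trans (f1 _)|].
    have ta : enorm (gamma t - gamma a2) <= h.
      by have := Len_chord_sub f1 l tab; lra.
    have := fu ar tr ta; rewrite -/F ler_norml => /andP[? ?]; lra.
  (* Since [F >= 1] and [om <= 1 / 4], the bracket that remains after factoring out [om] is at least
     [2 * F ^+ 2 - 3 / 4], which is positive. *)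
  have Mm : (F + 2 * om) ^+ 2 <= (1 + 16 * om) * (F - om) ^+ 2.
    rewrite -subr_ge0 (_ : _ - _ = om * (16 * F ^+ 2 - 6 * F - 3 * om -
      32 * (om * F) + 16 * om ^+ 2)); last by ring.
    apply: mulr_ge0 => //.
    have := sqr_ge0 om; have FF : F <= F ^+ 2 by rewrite expr2 ler_peMr//; lra.
    have : om * F <= 4^-1 * F by rewrite ler_wpM2r//; lra.
    lra.
  have MK : (F + 2 * om) ^+ 2 <= (K + 1) ^+ 2.
    by rewrite lerXn2r ?nnegrE//; lra.
  have cn := enorm_ge0 (gamma b2 - gamma a2).
  have s1 : (F + 2 * om) ^+ 2 * enorm (gamma b2 - gamma a2) <= (1 + 16 * om) * L2.
    apply: (@le_trans _ _ ((1 + 16 * om) * (F - om) ^+ 2 * enorm (gamma b2 - gamma a2))).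
      by rewrite ler_wpM2r.
    by rewrite -mulrA ler_wpM2l//; lra.
  have s2 : (F + 2 * om) ^+ 2 * eta <= (K + 1) ^+ 2 * eta by rewrite ler_wpM2r// ltW.
  have : (F + 2 * om) ^+ 2 * (enorm (y2 - x2) + 2 * eta) <=
      (F + 2 * om) ^+ 2 * (enorm (gamma b2 - gamma a2) + 4 * eta).
    rewrite ler_wpM2l ?sqr_ge0//; lra.
  lra.
elim: N a b L x y => [|N IH] a b L x y l gr LN Ux Uy xa yb.
  rewrite mul1r in LN; have [fin dle] := single _ _ _ _ _ l gr LN Ux Uy xa yb.
  by split=> //; rewrite mul1r.
have [Lh|Lh] := lerP L (h / 16).
  have [fin dle] := single _ _ _ _ _ l gr Lh Ux Uy xa yb.
  split=> //; apply: le_trans dle _; rewrite lerD2l ler_peMl ?ler1n//.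
  by rewrite mulr_ge0 ?(ltW e0)// mulr_ge0 ?sqr_ge0.
have h160 : 0 < h / 16 by rewrite divr_gt0.
have [t [l1 l2]] := Len_split l h160 Lh.
have ta := Len_lt l1; have tb := Len_lt l2.
have [|z Uz zt] := @perforated_proj _ _ act p r h eta eta0 eta_h sep inside (gamma t).
  by apply: gr; rewrite !ltW.
have gr1 u : a <= u <= t -> enorm (gamma u) < r.
  by move=> /andP[u1 u2]; apply: gr; rewrite u1 (le_trans u2)// ltW.
have gr2 u : t <= u <= b -> enorm (gamma u) < r.
  by move=> /andP[u1 u2]; apply: gr; rewrite u2 andbT (le_trans _ u1)// ltW.
have [fin1 d1] := single _ _ _ _ _ l1 gr1 (lexx _) Ux Uz xa zt.
have LN' : L - h / 16 <= N.+1%:R * (h / 16).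
  by move: LN; rewrite -[N.+2%:R]natr1; lra.
have [fin2 d2] := IH _ _ _ z y l2 gr2 LN' Uz Uy zt yb.
have [fin d] := riem_dist_triangle cg fin1 fin2; split=> //.
apply: le_trans d _; rewrite -[N.+2%:R]natr1; lra.
Qed.

(** [Lm - 1] bounds the diameter of the ball for [f ^ 4 g_E], and the 1 leaves room for almost
    minimizing curves. [E] adds the change of conformal factor along such a curve to the cost of at
    most [16 * Lm / h + 1] pieces. *)
Let Lm := 2 * r * K ^+ 2 + 1.
Let E := 16 * om * Lm + (16 * Lm / h + 1) * (4 * (K + 1) ^+ 2 * eta).

Lemma ball_dist x y : enorm x < r -> enorm y < r ->
  riem_dist (eball 0 r) (conformal_metric f) x y \is a fin_num /\
  rdist (eball 0 r) f x y <= K ^+ 2 * enorm (y - x).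
Proof.
move=> xr yr; apply: riem_dist_segment => // t t01.
have tr := enorm_segment xr yr t01.
rewrite eball0E; split=> //.
have := f1 (x + t *: (y - x)); have := fK tr => k1 k2.
by rewrite lerXn2r ?nnegrE//; lra.
Qed.

Lemma ball_dist_le x y : enorm x < r -> enorm y < r -> rdist (eball 0 r) f x y <= Lm - 1.
Proof.
move=> xr yr; have [_ d] := ball_dist xr yr; apply: le_trans d _.
rewrite /Lm addrK mulrC ler_wpM2r ?sqr_ge0//.
have := ler_enormD y (- x); rewrite enormN; lra.
Qed.

(** An almost minimizing curve of the ball is lifted. Its slack is at most 1, so that its length
    stays below [Lm] and [E] does not depend on it; the slack then tends to 0. *)
Lemma perforated_dist_le x y : U x -> U y ->
  riem_dist U (conformal_metric g) x y \is a fin_num /\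
  rdist U g x y <= rdist (eball 0 r) f x y + E.
Proof.
move=> Ux Uy; have [e0 eh] := (eta0, eta_h).
have h0 : 0 < h by lra.
have [xr yr] := (proj1 Ux, proj1 Uy).
have [ffin _] := ball_dist xr yr; have dL := ball_dist_le xr yr.
have main e : 0 < e -> e <= 1 ->
    riem_dist U (conformal_metric g) x y \is a fin_num /\
    rdist U g x y <= rdist (eball 0 r) f x y + E + e * (1 + 16 * om).
  move=> ep e1; have [gamma [L [[l gx gy gS] Le]]] := riem_dist_approx cf ep ffin.
  have L0 := Len_ge0 l.
  have q0 : 0 <= L / (h / 16) by rewrite divr_ge0 ?divr_ge0 ?(ltW h0).
  have /andP[n1 n2] := truncn_itv q0; set N := Num.truncn _ in n1 n2.
  have h16 : 0 < h / 16 by rewrite divr_gt0.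
  have gr t : 0 <= t <= 1 -> enorm (gamma t) < r.
    by move=> t01; apply: sub_ball; exact: gS.
  have LN : L <= N.+1%:R * (h / 16) by rewrite -ler_pdivrMr// ltW.
  have xa : enorm (x - gamma 0) <= eta by rewrite gx subrr enorm0 ltW.
  have yb : enorm (y - gamma 1) <= eta by rewrite gy subrr enorm0 ltW.
  have [fin d] := Len_lift l gr LN Ux Uy xa yb.
  split=> //; apply: le_trans d _.
  have LLm : L <= Lm by lra.
  have Nle : N.+1%:R <= 16 * Lm / h + 1.
    rewrite -natr1 lerD2r; apply: le_trans n1 _.
    rewrite (_ : L / (h / 16) = 16 * L / h); last by field; exact: lt0r_neq0.
    by rewrite ler_pM2r ?invr_gt0// ler_pM2l.
  have c0 : 0 <= 4 * (K + 1) ^+ 2 * eta.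
    by rewrite mulr_ge0 ?(ltW e0)// mulr_ge0 ?sqr_ge0.
  have := ler_wpM2r c0 Nle.
  have := mulr_ge0 (ltW ep) om0; have := ler_wpM2l om0 LLm.
  rewrite /E; lra.
have [fin _] := main 1 ltr01 (lexx _); split=> //.
apply/ler_addgt0Pr => e ep.
pose e' := Num.min 1 (e / (1 + 16 * om)).
have o1 : 0 < 1 + 16 * om by have := om0; lra.
have e'0 : 0 < e' by rewrite lt_min ltr01 divr_gt0.
have [|_ d] := main e' e'0; first by rewrite ge_min lexx.
apply: le_trans d _; rewrite lerD2l -ler_pdivlMr//.
by rewrite ge_min lexx orbT.
Qed.

(** The same curve serves in the ball, and [g >= 1] turns [f <= g + om] into [f <= (1 + om) * g]. *)
Lemma ball_dist_le_perforated x y : U x -> U y ->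
  rdist (eball 0 r) f x y <= (1 + om) ^+ 2 * rdist U g x y.
Proof.
move=> Ux Uy; have [gfin _] := perforated_dist_le Ux Uy.
have [ffin _] := ball_dist (proj1 Ux) (proj1 Uy).
have k0 : 0 < (1 + om) ^+ 2 by rewrite exprn_gt0//; have := om0; lra.
apply/ler_addgt0Pr => e e0; have e'0 : 0 < e / (1 + om) ^+ 2 by rewrite divr_gt0.
have [gamma [L [[l gx gy gS] Le]]] := riem_dist_approx cg e'0 gfin.
have [|L' l' LL] := Len_compare (k := (1 + om) ^+ 2) cf l.
  move=> t t01; have [tr _] := gS t t01; rewrite -exprMn; apply: lerXn2r; rewrite ?nnegrE.
  - exact: le_trans (f1 _).
  - by rewrite mulr_ge0//; [have := om0; lra|exact: le_trans (g1 _)].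
  - have := fg tr; rewrite ler_norml => /andP[? ?].
    have := ler_wpM2l om0 (g1 (gamma t)); lra.
have j : joins (eball 0 r) f x y gamma L'.
  by split=> // t /gS[]; rewrite eball0E.
have := riem_dist_le cf j; rewrite -(fineK ffin) lee_fin => d.
apply: le_trans d _; apply: le_trans LL _.
have := ler_wpM2l (ltW k0) Le; rewrite mulrDr mulrCA mulfV ?gt_eqF// mulr1.
by [].
Qed.

Lemma perforated_dist_compare x y : U x -> U y ->
  `|rdist U g x y - rdist (eball 0 r) f x y| <= E + 3 * om * (Lm + E).
Proof.
move=> Ux Uy; have [_ d1] := perforated_dist_le Ux Uy.
have d2 := ball_dist_le_perforated Ux Uy.
have dL := ball_dist_le (proj1 Ux) (proj1 Uy).
have g0 : 0 <= rdist U g x y by rewrite fine_ge0// riem_dist_ge0.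
have f0 : 0 <= rdist (eball 0 r) f x y by rewrite fine_ge0// riem_dist_ge0.
have Lm0 : 0 <= Lm.
  by apply: le_trans ler01 _; rewrite -subr_ge0; exact: le_trans dL.
have h0 : 0 <= h by apply: le_trans eta_h; rewrite mulr_ge0// ltW.
have E0 : 0 <= E.
  rewrite /E addr_ge0//; first by rewrite !mulr_ge0.
  apply: mulr_ge0; last by rewrite mulr_ge0 ?(ltW eta0)// mulr_ge0 ?sqr_ge0.
  by rewrite addr_ge0// divr_ge0// mulr_ge0.
exact: dist_arith.
Qed.

Lemma perforated_dense x : enorm x < r ->
  exists2 x', U x' & rdist (eball 0 r) f x' x <= K ^+ 2 * eta.
Proof.
move=> xr; have [x' Ux' xx'] := @perforated_proj _ _ act p r h eta eta0 eta_h sep inside x xr.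
exists x' => //; have [_ d] := ball_dist (proj1 Ux') xr; apply: le_trans d _.
by rewrite ler_wpM2l ?sqr_ge0// enormB.
Qed.

End distance_comparison.

(** * Gromov-Hausdorff distance *)

Section gluing.
Context {R : realType} {T1 T2 : Type}.
Variables (d1 : T1 -> T1 -> R) (d2 : T2 -> T2 -> R) (j : T1 -> T2) (e : R).
Hypotheses (d1xx : forall x, d1 x x = 0) (d1_eq0 : forall x y, d1 x y = 0 -> x = y)
  (d1C : forall x y, d1 x y = d1 y x)
  (d1T : forall y x z, d1 x z <= d1 x y + d1 y z).
Hypotheses (d2xx : forall x, d2 x x = 0) (d2_eq0 : forall x y, d2 x y = 0 -> x = y)
  (d2C : forall x y, d2 x y = d2 y x)
  (d2T : forall y x z, d2 x z <= d2 x y + d2 y z).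
Hypotheses (e0 : 0 < e) (d12 : forall x y, `|d1 x y - d2 (j x) (j y)| <= e).

Let d1_ge0 x y : 0 <= d1 x y.
Proof. by have := d1T y x x; rewrite d1xx (d1C y x); lra. Qed.

Let d2_ge0 x y : 0 <= d2 x y.
Proof. by have := d2T y x x; rewrite d2xx (d2C y x); lra. Qed.

(** The cheapest passage from [u] to [v] through some pair [w], [j w], without the length [e] of the
    crossing. *)
Definition bridge (u : T1) (v : T2) : R :=
  inf [set d1 u w + d2 (j w) v | w in [set: T1]].

Lemma bridge_le u v w : bridge u v <= d1 u w + d2 (j w) v.
Proof.
apply: ge_inf; last by exists w.
by exists 0 => _ [w' _ <-]; rewrite addr_ge0.
Qed.

Lemma bridge_ge u v l : (forall w, l <= d1 u w + d2 (j w) v) -> l <= bridge u v.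
Proof.
move=> h; apply: lb_le_inf; first by exists (d1 u u + d2 (j u) v), u.
by move=> _ [w _ <-].
Qed.

Let bridge_ge0 u v : 0 <= bridge u v.
Proof. by apply: bridge_ge => w; rewrite addr_ge0. Qed.

(* [T1] and [T2] are joined by a bridge of length [e] from each [u] to [j u]; the
   triangle inequality needs [`|d1 - d2| <= e]. *)
Definition glued_dist (x y : T1 + T2) : R :=
  match x, y with
  | inl u, inl u' => d1 u u'
  | inr v, inr v' => d2 v v'
  | inl u, inr v => bridge u v + e
  | inr v, inl u => bridge u v + e
  end.

Lemma glued_distxx x : glued_dist x x = 0.
Proof. by case: x => /=. Qed.

Lemma glued_dist_eq0 x y : glued_dist x y = 0 -> x = y.
Proof.
case: x y => [u|v] [u'|v'] /=; [by move/d1_eq0->| | |by move/d2_eq0->].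
  by move=> h; exfalso; have := bridge_ge0 u v'; have := e0; move: h; lra.
by move=> h; exfalso; have := bridge_ge0 u' v; have := e0; move: h; lra.
Qed.

Lemma glued_distC x y : glued_dist x y = glued_dist y x.
Proof. by case: x y => [u|v] [u'|v'] /=. Qed.

Let triangle112 u u' v : bridge u v <= d1 u u' + bridge u' v.
Proof.
rewrite addrC -lerBlDr; apply: bridge_ge => w.
have := bridge_le u v w; have := d1T u' u w; lra.
Qed.

Let triangle122 u v v' : bridge u v' <= bridge u v + d2 v v'.
Proof.
rewrite -lerBlDr; apply: bridge_ge => w.
have := bridge_le u v' w; have := d2T v (j w) v'; lra.
Qed.

(** A trip that crosses at [w] and returns at [w'] covers in [T2] at least [d2 (j w) (j w')], which
    is at least [d1 w w' - e]; the crossings counted in [glued_dist] pay for this loss. *)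
Let triangle121 u u' v : d1 u u' <= bridge u v + bridge u' v + e.
Proof.
suff : d1 u u' - e - bridge u' v <= bridge u v by lra.
apply: bridge_ge => w.
suff : d1 u u' - e - (d1 u w + d2 (j w) v) <= bridge u' v by lra.
apply: bridge_ge => w'.
have := d1T w u u'; have := d1T w' w u'; rewrite (d1C w' u').
have := d2T v (j w) (j w'); rewrite (d2C v).
have := d12 w w'; rewrite ler_norml => /andP[_]; lra.
Qed.

Let triangle212 u v v' : d2 v v' <= bridge u v + bridge u v' + e.
Proof.
suff : d2 v v' - e - bridge u v' <= bridge u v by lra.
apply: bridge_ge => w.
suff : d2 v v' - e - (d1 u w + d2 (j w) v) <= bridge u v' by lra.
apply: bridge_ge => w'.
have := d2T (j w) v v'; have := d2T (j w') (j w) v'; rewrite (d2C v (j w)).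
have := d1T u w w'; rewrite (d1C w u).
have := d12 w w'; rewrite ler_norml => /andP[+ _]; lra.
Qed.

Lemma glued_dist_triangle y x z : glued_dist x z <= glued_dist x y + glued_dist y z.
Proof.
have e0' := e0.
case: x y z => [u|v] [u'|v'] [u''|v''] /=; try exact: d1T; try exact: d2T.
- by have := triangle112 u u' v''; lra.
- by have := triangle121 u u'' v'; lra.
- by have := triangle122 u v' v''; lra.
- by have := triangle112 u'' u' v; rewrite (d1C u'' u'); lra.
- by have := triangle212 u' v v''; lra.
- by have := triangle122 u'' v' v; rewrite (d2C v' v); lra.
Qed.

Lemma bridge_near u : bridge u (j u) <= 0.
Proof. by have := bridge_le u (j u) u; rewrite d1xx d2xx addr0. Qed.

Lemma bridge_close w v : bridge w v <= d2 (j w) v.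
Proof. by have := bridge_le w v w; rewrite d1xx add0r. Qed.

Definition glued_choice : choiceType :=
  HB.pack (T1 + T2)%type (gen_eqMixin (T1 + T2)%type) (gen_choiceMixin (T1 + T2)%type).

Definition glued_space : metricType R :=
  HB.pack (Choice.sort glued_choice) (isMetric.Build R glued_choice
    glued_distxx glued_dist_eq0 glued_distC glued_dist_triangle).

Lemma glued_mdistE (x y : T1 + T2) :
  mdist (x : glued_space) (y : glued_space) = glued_dist x y.
Proof. by []. Qed.

End gluing.

(** * Bounding the Gromov-Hausdorff distance by gluing *)

Section GH_estimate.
Context {R : realType} {T : Type}.
Variables (S1 S2 : set T) (d1 d2 : T -> T -> \bar R) (e : R).
Hypotheses (S12 : S1 `<=` S2) (e0 : 0 < e) (S1_neq0 : S1 !=set0).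
Hypotheses (d1_fin : forall x y, S1 x -> S1 y -> d1 x y \is a fin_num)
  (d1xx : forall x, S1 x -> d1 x x = 0%E)
  (d1_eq0 : forall x y, S1 x -> S1 y -> d1 x y = 0%E -> x = y)
  (d1C : forall x y, d1 x y = d1 y x)
  (d1T : forall y x z, S1 x -> S1 y -> S1 z ->
    fine (d1 x z) <= fine (d1 x y) + fine (d1 y z)).
Hypotheses (d2_fin : forall x y, S2 x -> S2 y -> d2 x y \is a fin_num)
  (d2xx : forall x, S2 x -> d2 x x = 0%E)
  (d2_eq0 : forall x y, S2 x -> S2 y -> d2 x y = 0%E -> x = y)
  (d2C : forall x y, d2 x y = d2 y x)
  (d2T : forall y x z, S2 x -> S2 y -> S2 z ->
    fine (d2 x z) <= fine (d2 x y) + fine (d2 y z)).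
Hypotheses (d12 : forall x y, S1 x -> S1 y -> `|fine (d1 x y) - fine (d2 x y)| <= e)
  (dense : forall v, S2 v -> exists2 w, S1 w & fine (d2 w v) <= e).

(** Glue along the inclusion of [S1] in [S2]: one [e] is the length of a bridge, the other the
    density of [S1]. The gluing is done on subtypes, since the axioms of a metric hold on [S1] and
    [S2] only. *)
Lemma GH_dist_le : (GH_dist S1 d1 S2 d2 <= (2 * e)%:E)%E.
Proof.
pose T1 := {x : T | S1 x}; pose T2 := {x : T | S2 x}.
pose D1 (u v : T1) := fine (d1 (sval u) (sval v)).
pose D2 (u v : T2) := fine (d2 (sval u) (sval v)).
pose j (u : T1) : T2 := exist _ (sval u) (S12 (svalP u)).
have sig_inj (S : set T) (u v : {x : T | S x}) : sval u = sval v -> u = v.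
  by case: u v => [u hu] [v hv] /= uv; subst v; congr exist; exact: Prop_irrelevance.
have D1xx u : D1 u u = 0 by rewrite /D1 d1xx//; exact: svalP.
have D2xx u : D2 u u = 0 by rewrite /D2 d2xx//; exact: svalP.
have D10 u v : D1 u v = 0 -> u = v.
  move=> h; apply: sig_inj; apply: d1_eq0; [exact: svalP|exact: svalP|].
  by rewrite -(fineK (d1_fin (svalP u) (svalP v))) -/(D1 u v) h.
have D20 u v : D2 u v = 0 -> u = v.
  move=> h; apply: sig_inj; apply: d2_eq0; [exact: svalP|exact: svalP|].
  by rewrite -(fineK (d2_fin (svalP u) (svalP v))) -/(D2 u v) h.
have D1C u v : D1 u v = D1 v u by rewrite /D1 d1C.
have D2C u v : D2 u v = D2 v u by rewrite /D2 d2C.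
have D1T v u w : D1 u w <= D1 u v + D1 v w by apply: d1T; exact: svalP.
have D2T v u w : D2 u w <= D2 u v + D2 v w by apply: d2T; exact: svalP.
have D12 u v : `|D1 u v - D2 (j u) (j v)| <= e by apply: d12; exact: svalP.
pose Z := glued_space D1xx D10 D1C D1T D2xx D20 D2C D2T e0 D12.
have [x0 Sx0] := S1_neq0.
(* An arbitrary value for the two embeddings off [S1] and [S2]. *)
pose z0 : Z := inl (exist _ x0 Sx0 : T1).
pose f1 (x : T) : Z :=
  match pselect (S1 x) with left h => inl (exist _ x h : T1) | right _ => z0 end.
pose f2 (x : T) : Z :=
  match pselect (S2 x) with left h => inr (exist _ x h : T2) | right _ => z0 end.
have f1E x (h : S1 x) : f1 x = inl (exist _ x h : T1).
  rewrite /f1; case: pselect => // h'.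
  by congr inl; exact: sig_inj.
have f2E x (h : S2 x) : f2 x = inr (exist _ x h : T2).
  rewrite /f2; case: pselect => // h'.
  by congr inr; exact: sig_inj.
apply: ge_ereal_inf; exists (hausdorff_dist (f1 @` S1) (f2 @` S2)).
  exists Z, f1, f2; split=> // x y Sx Sy.
    by rewrite (f1E x Sx) (f1E y Sy) glued_mdistE /= /D1 /= fineK//; exact: d1_fin.
  by rewrite (f2E x Sx) (f2E y Sy) glued_mdistE /= /D2 /= fineK//; exact: d2_fin.
rewrite /hausdorff_dist ge_max; apply/andP; split; apply: ge_ereal_sup => _ [_ [x Sx <-] <-].
  apply: ge_ereal_inf; exists (mdist (f1 x) (f2 x))%:E.
    by exists (f2 x) => //; exists x => //; exact: S12.
  rewrite (f1E x Sx) (f2E x (S12 Sx)) glued_mdistE /= lee_fin.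
  have := bridge_near j D1xx D1C D1T D2xx D2C D2T (exist _ x Sx : T1).
  rewrite /j /=; have := e0; lra.
have [w Sw wx] := dense Sx.
apply: ge_ereal_inf; exists (mdist (f1 w) (f2 x))%:E.
  by exists (f1 w) => //; exists w.
rewrite (f1E w Sw) (f2E x Sx) glued_mdistE /= lee_fin.
have := bridge_close j D1xx D1C D1T D2xx D2C D2T (exist _ w Sw : T1) (exist _ x Sx : T2).
rewrite /D2 /=; lra.
Qed.

End GH_estimate.

(** A supremum over the empty set is [-oo]; a point of [S2] makes the second supremum of every
    Hausdorff distance non-negative. *)
Lemma GH_dist_ge0 (R : realType) (T1 T2 : Type) (S1 : set T1) (d1 : T1 -> T1 -> \bar R)
    (S2 : set T2) (d2 : T2 -> T2 -> \bar R) : S2 !=set0 -> (0 <= GH_dist S1 d1 S2 d2)%E.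
Proof.
move=> [x Sx]; apply: le_ereal_inf_tmp => _ [Z [f1 [f2 [_ _ ->]]]].
rewrite /hausdorff_dist le_max; apply/orP; right.
apply: le_trans (ereal_sup_ubound _); last by exists (f2 x) => //; exists x.
by apply: le_ereal_inf_tmp => _ [a _ <-]; rewrite lee_fin mdist_ge0.
Qed.

(** * Brill-Lindquist-Riemann sums *)

Section scalar_curvature.
Context {R : realType}.

Lemma twice_diff_scal (f : 'rV[R]_3 -> R) x (p : 'I_3 -> 'rV[R]_3 -> R)
    (q : 'I_3 -> 'I_3 -> R) : (forall y, 0 < f y) -> twice_diff f x p q ->
  scal (conformal_metric f) x = - 8 * f x ^- 5 * \sum_(i < 3) q i i.
Proof.
move=> f0 fpq; rewrite -(twice_diff_laplacian fpq); apply: scal_conformal => [|i j].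
  apply: (@filterS _ (nbhs x) _ _ _ _ (proj1 fpq)) => y fy.
  by split=> // i; have [] := fy i.
by have [] := twice_diff_partial2 i j fpq.
Qed.

Lemma psi0E (p x : 'rV[R]_3) : psi 0 p x = (enorm (x - p))^-1.
Proof. by rewrite /psi /rad add0r -enormE. Qed.

Lemma chi_n_gt0 (D : R) (n : nat) (alpha : box n -> R) x : (forall i, 0 <= alpha i) ->
  0 < chi_n D alpha x.
Proof.
move=> a0; rewrite ltr_pwDl//; apply: sumr_ge0 => i _.
by rewrite mulr_ge0// invr_ge0 enorm_ge0.
Qed.

(** The sum is restricted to the actual charges, as [x] may be the centre of a box without charge;
    each remaining potential is [psi 0], harmonic near [x]. *)
Lemma scal_chi_n (D : R) (n : nat) (alpha : box n -> R) x : (forall i, 0 <= alpha i) ->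
  (forall i, alpha i != 0 -> 0 < enorm (x - Defs.center D i)) ->
  scal (conformal_metric (chi_n D alpha)) x = 0.
Proof.
move=> a0 xD.
have chi_gt0 y : 0 < chi_n D alpha y by exact: chi_n_gt0.
pose s := [seq i <- index_enum (box n) | alpha i != 0].
have chiE : chi_n D alpha = fun y =>
    cst 1 y + \sum_(i <- s) alpha i * psi 0 (Defs.center D i) y.
  apply/funext => y; rewrite /chi_n big_filter [in RHS]big_mkcond/=.
  by congr (_ + _); apply: eq_bigr => i _; case: eqP => [->|_]; rewrite ?mul0r ?psi0E.
have pos i : i \in s -> 0 < 0 + dotp (x - Defs.center D i) (x - Defs.center D i).
  by rewrite mem_filter => /andP[ai _]; rewrite add0r -sqr_enorm exprn_gt0 ?xD.
have td := twice_diffD (twice_diff_cst 1 x) (twice_diff_sum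
  (fun i si => twice_diffZ (alpha i) (twice_diff_psi (lexx 0) (pos i si)))).
rewrite chiE in chi_gt0 *; rewrite (twice_diff_scal chi_gt0 td).
rewrite [X in _ * X](_ : _ = 0) ?mulr0//.
rewrite big_split/= big1_eq add0r exchange_big/= big_seq big1// => i si.
by rewrite -mulr_sumr laplacian_psi_sum ?pos// mulr0 mul0r mulr0.
Qed.

Lemma scal_poisson (A chi : 'rV[R]_3 -> R) x : (forall y, 1 <= chi y) ->
  poisson_solution A chi ->
  scal (conformal_metric chi) x = 32 * pi * chi x ^- 5 * A x.
Proof.
move=> chi1 [chi2 lchi _].
have chi0 y : 0 < chi y by exact: lt_le_trans (chi1 y).
rewrite (twice_diff_scal chi0 (Ck2_twice_diff x chi2)).
rewrite (_ : \sum_(i < 3) _ = laplacian chi x)// lchi; ring.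
Qed.

End scalar_curvature.

Section point_charges.
Context {R : realType}.
Variables (D r : R) (A : 'rV[R]_3 -> R).
Hypotheses (D0 : 0 < D) (A_ge0 : forall x, 0 <= A x).

Lemma chi_cut_ge1 n x : 1 <= chi_cut D A n x.
Proof.
rewrite lerDl; apply: sumr_ge0 => i _; rewrite divr_ge0 ?mass_ge0//.
by rewrite le_max enorm_ge0.
Qed.

Lemma chi_cut_continuous n : (0 < n)%N -> continuous (chi_cut D A n).
Proof.
move=> n0 x; apply: continuousD_at; first exact: cst_continuous.
apply: (@continuous_sum_seq R _ _ (fun i y =>
  mass D A i / Num.max (enorm (y - Defs.center D i)) (D / n%:R ^+ 2))) => i.
apply: continuousZ_at.
have h : {for x, continuous ((fun y => enorm (y - Defs.center D i)) \max cst (D / n%:R ^+ 2))}.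
  apply: (@continuous_max R); [exact: enormB_continuous|exact: cst_continuous].
apply: (@continuousV R _ _ x _ h).
by rewrite gt_eqF//= lt_max divr_gt0 ?exprn_gt0 ?ltr0n ?orbT.
Qed.

Lemma center_sep n (i j : box n) : (0 < n)%N -> i != j ->
  D / n%:R <= enorm (Defs.center D i - Defs.center D j).
Proof.
move=> n0 ij; have [k ikjk] : exists k, i k != j k.
  apply: contrapT => h; move/eqP: ij; apply; apply/ffunP => k; apply/eqP.
  by apply: contrapT => /negP ?; apply: h; exists k.
apply: le_trans (coord_le_enorm _ k); rewrite !mxE.
rewrite (_ : _ - _ = ((i k)%:R - (j k)%:R) * (D / n%:R)); last by ring.
rewrite normrM (ger0_norm (x := D / n%:R)) ?divr_ge0 ?(ltW D0)//.
rewrite -[leLHS]mul1r ler_wpM2r ?divr_ge0 ?(ltW D0)//.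
have {ikjk} : (i k : nat) != j k by [].
rewrite neq_ltn => /orP[]; rewrite -(ler_nat R) -natr1 => h.
  by rewrite ler0_norm; lra.
by rewrite ger0_norm; lra.
Qed.

(** The centres have norm at most [sqrt 3 * D], so a ball of radius the mesh around one of them fits
    into the large ball once the mesh is below [r - sqrt 3 * D]. *)
Lemma center_inside n (i : box n) x : (0 < n)%N -> D / n%:R <= r - Num.sqrt 3 * D ->
  enorm (x - Defs.center D i) < D / n%:R -> enorm x < r.
Proof.
move=> n0 hn xc; have := ler_enormD (x - Defs.center D i) (Defs.center D i).
have := enorm_le_coord (fun k => center_coord_le D0 i k n0).
have h0 : 0 < D / n%:R by rewrite divr_gt0 ?ltr0n.
have s0 : 0 <= Num.sqrt 3 * (D / n%:R / 2) by rewrite mulr_ge0 ?sqrtr_ge0//; lra.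
rewrite mulrBr subrK; lra.
Qed.

Lemma U_nRE n : (0 < n)%N -> U_nR D r (mass D A (n:=n)) =
  perforated (fun i : box n => mass D A i != 0) (Defs.center D (n:=n)) r (D / n%:R ^+ 2).
Proof.
move=> n0; rewrite /U_nR eball0E; apply/seteqP; split=> x [xr h]; split=> //.
  by move=> i ai; rewrite leNgt; apply/negP => xi; apply: h; exists i.
by move=> [i ai]; rewrite /eball /= ltNge h.
Qed.

Lemma chi_n_chi_cut n x : (0 < n)%N -> U_nR D r (mass D A (n:=n)) x ->
  chi_n D (mass D A (n:=n)) x = chi_cut D A n x.
Proof.
move=> n0; rewrite U_nRE// => -[_ h]; congr (_ + _); apply: eq_bigr => i _.
have [->|ai] := eqVneq (mass D A i) 0; first by rewrite !mul0r.
by congr (_ / _); rewrite max_l// h.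
Qed.

End point_charges.

Lemma cvge0 (R : realType) (u : nat -> \bar R) : (forall n, (0 <= u n)%E) ->
  (forall e : R, 0 < e -> exists n0 : nat, forall n, (n0 <= n)%N -> (u n <= e%:E)%E) ->
  u @ \oo --> 0%E.
Proof.
move=> u0 h; apply/fine_cvgP; split.
  have [n0 hn] := h 1 ltr01; exists n0 => // n /hn un.
  by rewrite ge0_fin_numE//; apply: le_lt_trans un _; rewrite ltry.
apply/cvgrPdist_le => e e0; have [n0 hn] := h e e0; exists n0 => // n /hn un /=.
rewrite sub0r normrN ger0_norm ?fine_ge0// -lee_fin fineK//.
by rewrite ge0_fin_numE//; apply: le_lt_trans un _; rewrite ltry.
Qed.

(** * Choice of the constants and passage to the limit *)

Section limit.
Context {R : realType}.
Variables (D r : R) (A chi : 'rV[R]_3 -> R).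
Hypotheses (D0 : 0 < D) (Dr : Num.sqrt 3 * D < r)
  (A_cont : continuous A) (A_ge0 : forall x, 0 <= A x)
  (A_supp : forall x, A x != 0 -> cube D x) (chiP : poisson_solution A chi).

(** Here [t] is [1 / n], the mesh is [D * t] and the holes have radius [D * t ^+ 2]. The cost of the
    pieces is [4 (K + 1)^2 (16 Lm + D t) t <= C t], so [E <= 3 e / 16]; the last bound controls the
    density of the perforated ball. *)
Lemma error_arith (Lm e om C K t : R) : 0 < Lm -> 0 < e -> 0 <= om -> om <= 4^-1 ->
  om * Lm <= e / 128 -> C = 4 * (K + 1) ^+ 2 * (16 * Lm + D) -> 0 <= K ->
  0 < t -> t <= 1 -> C * t <= e / 16 ->
  let E := 16 * om * Lm
    + (16 * Lm / (D * t) + 1) * (4 * (K + 1) ^+ 2 * (D * t ^+ 2)) in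
  E + 3 * om * (Lm + E) <= e / 2 /\ K ^+ 2 * (D * t ^+ 2) <= e / 2.
Proof.
move=> Lm0 e0 om0 om1 omL CE K0 t0 t1 Ct E.
have d0 := D0; have Dn0 := lt0r_neq0 D0; have tn0 := lt0r_neq0 t0.
have K1 : 0 <= (K + 1) ^+ 2 by rewrite sqr_ge0.
have Eb : E <= 3 * e / 16.
  have -> : E = 16 * (om * Lm) + 4 * (K + 1) ^+ 2 * (16 * Lm + D * t) * t.
    by rewrite /E; field; rewrite Dn0 tn0.
  suff : 4 * (K + 1) ^+ 2 * (16 * Lm + D * t) * t <= C * t by lra.
  rewrite CE; apply: ler_wpM2r; first exact: ltW.
  apply: ler_wpM2l; first by rewrite mulr_ge0.
  by rewrite lerD2l -[leRHS]mulr1; apply: ler_wpM2l => //; exact: ltW.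
have oE : om * E <= 4^-1 * (3 * e / 16).
  have := ler_wpM2l om0 Eb; have : om * (3 * e / 16) <= 4^-1 * (3 * e / 16).
    by apply: ler_wpM2r => //; lra.
  lra.
split; first by rewrite mulrDr -!mulrA; lra.
apply: (@le_trans _ _ (C * t)); last by lra.
have -> : K ^+ 2 * (D * t ^+ 2) = (K ^+ 2 * D * t) * t by ring.
apply: ler_wpM2r; first exact: ltW.
apply: (@le_trans _ _ (K ^+ 2 * D)).
  rewrite -[leRHS]mulr1; apply: ler_wpM2l => //.
  by apply: mulr_ge0; [exact: sqr_ge0|exact: ltW].
rewrite CE; apply: ler_pM; [exact: sqr_ge0|exact: ltW| |lra].
have : 0 <= K ^+ 2 by exact: sqr_ge0.
by rewrite sqrrD1; lra.
Qed.

Let Cn n := U_nR D r (mass D A (n:=n)).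

Lemma GH_limit (e : R) : 0 < e -> exists n0 : nat, forall n, (n0 <= n)%N ->
  (GH_dist (Cn n) (riem_dist (Cn n) (conformal_metric (chi_n D (mass D A (n:=n)))))
     (eball 0 r) (riem_dist (eball 0 r) (conformal_metric chi)) <= e%:E)%E.
Proof.
move=> e0; have d0 := D0.
have r0 : 0 < r by apply: le_lt_trans Dr; rewrite mulr_ge0 ?sqrtr_ge0 ?ltW.
have ball0 : enorm (0 : 'rV[R]_3) < r by rewrite enorm0.
have cchi : continuous chi by have [h _ _] := chiP; exact: Ck2_continuous.
have chi1 : forall x, 1 <= chi x by move=> x; exact: (poisson_ge1 D0 A_ge0 chiP).
have [K hK] := cont_bounded_compact r cchi.
have chiK x : enorm x < r -> chi x <= K.
  by move=> /ltW/hK; apply: le_trans; exact: ler_norm.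
have K0 : 0 <= K by have := chiK _ ball0; have := chi1 0; lra.
pose Lm := 2 * r * K ^+ 2 + 1.
have Lm0 : 0 < Lm.
  rewrite /Lm; have : 0 <= 2 * r * K ^+ 2 by rewrite mulr_ge0 ?sqr_ge0// mulr_ge0// ltW.
  lra.
(* The same [om] bounds the distance from [chi_cut] to [chi] and the oscillation of [chi] over one
   mesh length. *)
pose om := Num.min 4^-1 (e / 128 / Lm).
have om0 : 0 < om by rewrite lt_min invr_gt0 !divr_gt0 ?ltr0n.
have om1 : om <= 4^-1 by rewrite ge_min lexx.
have omL : om * Lm <= e / 128 by rewrite -ler_pdivlMr// ge_min lexx orbT.
pose C := 4 * (K + 1) ^+ 2 * (16 * Lm + D).
have C0 : 0 < C by rewrite !mulr_gt0 ?exprn_gt0//; lra.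
have [n1 hn1] := chi_cut_cvg D0 A_cont A_ge0 A_supp chiP r om0.
have [d dp hd] := unif_cont_compact r cchi om0.
have [n2 hn2] := small_mesh D0 dp.
have rD : 0 < r - Num.sqrt 3 * D by rewrite subr_gt0.
have [n3 hn3] := small_mesh D0 rD.
have e16 : 0 < e / 16 by rewrite divr_gt0.
have [n4 hn4] := small_mesh C0 e16.
(* The last entry ensures [n >= 16], that is, [16 * eta <= h]. *)
exists (maxn (maxn n1 n2) (maxn (maxn n3 n4) 16)) => n.
rewrite !geq_max => /andP[/andP[/hn1 cut /hn2[n0 hd']] /andP[/andP[/hn3[_ hr] /hn4[_ hC]] h16]].
have nR : 0 < n%:R :> R by rewrite ltr0n.
have nn0 := lt0r_neq0 nR.
pose t : R := n%:R^-1; have t0 : 0 < t by rewrite invr_gt0.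
have t16 : 16 * t <= 1 by rewrite ler_pdivrMr// mul1r (ler_nat R 16).
have t1 : t <= 1 by lra.
have [err1 err2] := error_arith Lm0 e0 (ltW om0) om1 omL (erefl C) K0 t0 t1 hC.
pose h := D * t; pose eta := D * t ^+ 2.
have etaE : D / n%:R ^+ 2 = eta by rewrite /eta /t exprVn.
have eta0 : 0 < eta by rewrite mulr_gt0// exprn_gt0.
have eta_h : 16 * eta <= h.
  rewrite /eta /h (_ : _ * _ = D * t * (16 * t)); last by ring.
  by rewrite -[leRHS]mulr1; apply: ler_wpM2l => //; rewrite mulr_ge0 ?ltW.
have e20 : 0 < e / 2 by rewrite divr_gt0.
rewrite (_ : e = 2 * (e / 2)); last by field.
(* On the perforated ball [chi_n] is the continuous function [chi_cut], to which the comparison of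
   distances applies. *)
rewrite (riem_dist_eq (fun x Ux => chi_n_chi_cut n0 Ux)) /Cn U_nRE// etaE.
set act := fun i : box n => mass D A i != 0; set p := Defs.center D (n:=n).
have sep i j : act i -> act j -> i != j -> h <= enorm (p i - p j).
  by move=> _ _; exact: center_sep.
have inside i x : act i -> enorm (x - p i) < h -> enorm x < r.
  by move=> _; exact: center_inside.
have ccut := @chi_cut_continuous _ D A D0 n n0.
have cut1 x : 1 <= chi_cut D A n x by exact: chi_cut_ge1.
have fg x : enorm x < r -> `|chi_cut D A n x - chi x| <= om by move=> /ltW; exact: cut.
have fu x y : enorm x < r -> enorm y < r -> enorm (y - x) <= h ->
    `|chi y - chi x| <= om.
  by move=> _ yr yx; apply: hd; [exact: ltW|exact: le_trans yx hd'].
have ballE x : eball 0 r x -> enorm x < r by rewrite eball0E.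
pose le := perforated_dist_le eta0 eta_h sep inside cchi ccut chi1 cut1
  (ltW om0) om1 fg chiK fu.
pose cmp := perforated_dist_compare eta0 eta_h sep inside cchi ccut chi1 cut1
  (ltW om0) om1 fg chiK fu.
have dense x : enorm x < r -> exists2 x', perforated act p r eta x' &
    rdist (eball 0 r) chi x' x <= K ^+ 2 * eta.
  exact: (perforated_dense eta0 eta_h sep inside cchi chi1 chiK).
apply: GH_dist_le => //.
- exact: perforated_sub.
- by have [x' Ux' _] := dense _ ball0; exists x'.
- by move=> x y Ux Uy; have [] := le x y Ux Uy.
- by move=> x Ux; exact: riem_distxx.
- by move=> x y _ _; exact: riem_dist_eq0.
- by move=> x y; exact: riem_dist_sym.
- move=> y x z Ux Uy Uz; have [xy _] := le x y Ux Uy; have [yz _] := le y z Uy Uz.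
  by have [_] := riem_dist_triangle ccut xy yz.
- by move=> x y /ballE xr /ballE yr; have [] := ball_dist cchi chi1 chiK xr yr.
- by move=> x Ux; exact: riem_distxx.
- by move=> x y _ _; exact: riem_dist_eq0.
- by move=> x y; exact: riem_dist_sym.
- move=> y x z /ballE xr /ballE yr /ballE zr.
  have [xy _] := ball_dist cchi chi1 chiK xr yr; have [yz _] := ball_dist cchi chi1 chiK yr zr.
  by have [_] := riem_dist_triangle cchi xy yz.
- by move=> x y Ux Uy; apply: le_trans (cmp x y Ux Uy) err1.
- by move=> v /ballE /dense[w Uw wv]; exists w => //; exact: le_trans wv err2.
Qed.

End limit.

Unset Implicit Arguments.

Theorem corollary1p5 (R : realType) (D r : R) (A chi : 'rV[R]_3 -> R)
    (hD : 0 < D) (hr : Num.sqrt 3 * D < r)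
    (hA_smooth : smooth A) (hA_ge0 : forall x, 0 <= A x)
    (hA_neq0 : exists x, A x != 0)
    (hA_supp : closure [set x | A x != 0] `<=` cube D)
    (hchi : poisson_solution A chi) :
  (exists alpha : forall n : nat, box n -> R,
    [/\ BLRS D A alpha,
        (forall n : nat, (0 < n)%N ->
           forall x, U_nR D r (alpha n) x ->
             scal (conformal_metric (chi_n D (alpha n))) x = 0)
      & (fun n : nat =>
           GH_dist (U_nR D r (alpha n))
             (riem_dist (U_nR D r (alpha n))
                (conformal_metric (chi_n D (alpha n))))
             (eball 0 r)
             (riem_dist (eball 0 r) (conformal_metric chi)))
          @ \oo --> 0%E]) /\
  (forall x, eball 0 r x ->
     scal (conformal_metric chi) x = 32 * pi * chi x ^- 5 * A x) /\
  (exists x, eball 0 r x /\ scal (conformal_metric chi) x != 0).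
Proof.
have A_cont : continuous A by exact: (hA_smooth 0).
have A_supp x : A x != 0 -> cube D x by move=> Ax; apply: hA_supp; exact: subset_closure.
have chi1 x : 1 <= chi x := poisson_ge1 hD hA_ge0 hchi x.
have chi_gt0 x : 0 < chi x by exact: lt_le_trans (chi1 x).
split; last first.
  split=> [x _|]; first exact: scal_poisson.
  (* A point where [A] does not vanish lies in the cube, hence in the ball because
     [sqrt 3 * D < r]. *)
  have [x Ax] := hA_neq0; exists x; split.
    rewrite eball0E; apply: le_lt_trans hr; apply: enorm_le_coord => k.
    by rewrite ler_norml; exact: A_supp.
  rewrite (scal_poisson x chi1 hchi).
  by rewrite !mulf_neq0 ?invr_eq0 ?expf_neq0 ?(gt_eqF (pi_gt0 R)) ?(gt_eqF (chi_gt0 x))//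
    lt0r_neq0.
have mass0 n (i : box n) : 0 <= mass D A i by exact: mass_ge0.
exists (fun n => mass D A (n:=n)); split.
(* With these charges each deviation in the Brill-Lindquist-Riemann condition is exactly 0. *)
- split=> //; exists 0 => _ [n [i [_ ->]]].
  by rewrite subrr normr0 mulr0.
- move=> n n0 x; rewrite U_nRE// => -[_ h]; apply: scal_chi_n => // i ai.
  by apply: lt_le_trans (h i ai); rewrite divr_gt0 ?exprn_gt0 ?ltr0n.
- apply: cvge0 => [n|e e0]; last exact: GH_limit.
  apply: GH_dist_ge0; exists 0; rewrite eball0E /= enorm0.
  by apply: le_lt_trans hr; rewrite mulr_ge0 ?sqrtr_ge0 ?ltW.
Qed.
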